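(* Let $(X,\theta,\mu,\alpha)$ be a Markov map with $\theta$-invariant probability measure $\mu$ and with adequately embedded Gibbs-Markov structure $(\Omega,\beta,\eta)$ with exponential tails. Let $H$ be a subgroup of the countable group $G$, $H_0=\bigcap_{g\in G}gHg^{-1}$, and let $\gamma:X\to G$, $x\mapsto\gamma_x$, be a map which is constant on cylinders of length $1$ (i.e. on the elements of $\alpha$) such that $\mathfrak{g}:=\gamma(X)$ is finite. Let $\mathbf{V}=\{Hg:g\in G\}$, $$T:X\times\mathbf{V}\to X\times\mathbf{V},\ (x,Hg)\mapsto(\theta(x),Hg\gamma_x),\qquad T_0:X\times G/H_0\to X\times G/H_0,\ (x,H_0g)\mapsto(\theta(x),H_0g\gamma_x),$$ and assume that $T_0$ is topologically transitive. Fix $\mathbf{o}\in\mathbf{V}$. If $$R_\Omega(T)=\limsup_{n\to\infty}\sqrt[n]{\mu(\{x\in\Omega\cap\theta^{-n}(\Omega):\mathbf{o}\,\gamma_x\gamma_{\theta(x)}\cdots\gamma_{\theta^{n-1}(x)}=\mathbf{o}\})}=1,$$ then the Schreier graph associated with $\mathfrak{g}$ is $\mu$-amenable.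
   Context: Markov map. $(X,\theta,\mu,\alpha)$ consists of a standard probability space $(X,\mathcal{B},\mu)$, an at most countable partition $\alpha$ of $X$ into measurable sets of positive measure, and $\theta:X\to X$ such that for all $a,b\in\alpha$: $\theta|_a:a\to\theta(a)$ is invertible, bimeasurable and non-singular; and either $\mu(a\cap\theta(b))=0$ or $\mu(a\cap\theta(b)^c)=0$; moreover the sets $[w_1\ldots w_n]=\bigcap_{k=1}^n\theta^{-k+1}(w_k)$, $w_i\in\alpha$, $n\ge1$, generate $\mathcal{B}$ mod $\mu$. $\mathcal{W}^1=\alpha$; $\mathcal{W}^n$ is the set of admissible words $w=(w_1\ldots w_n)$, $w_i\in\alpha$, i.e. $\theta(w_i)\supset w_{i+1}$ (mod $\mu$); $\mathcal{W}^\infty=\bigcup_{n\ge1}\mathcal{W}^n$. For $w\in\mathcal{W}^n$, $\tau_w:\theta^n([w])\to[w]$ is the inverse of $\theta^n|_{[w]}$ and $\varphi_w=\frac{d\mu\circ\tau_w}{d\mu}$. Gibbs-Markov map with full branches: a Markov map such that $\theta([w])=X$ mod $\mu$ for all $w\in\mathcal{W}^1$ and there are $C>0$, $r\in(0,1)$ with $|\log\varphi_w(x)-\log\varphi_w(y)|\le C\,d_r(x,y)$ for all $w\in\mathcal{W}^\infty$ and a.e. $x,y$, where $d_r(x,y)=r^{\min\{i:x_i\ne y_i\}}$ and $(x_i),(y_i)$ are the itineraries of $x,y$ with respect to the partition. Embedded Gibbs-Markov structure $(\Omega,\beta,\eta)$: $\Omega\subset X$ is a finite union of elements of $\alpha$,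 $\beta\subset\mathcal{W}^\infty$, $\eta:\beta\to\mathbb{N}$, $\{[u]:u\in\beta\}$ is a partition of $\Omega$ mod $\mu$, and, with $\eta(x):=\eta(u)$ and $\sigma(x):=\theta^{\eta(u)}(x)$ for $x\in[u]$, $u\in\beta$, and $\nu:=\mu(\Omega)^{-1}\mu|_\Omega$, $(\Omega,\sigma,\nu,\beta)$ is a Gibbs-Markov map with full branches. It is adequate if (a) there is a sequence $(C_n)$ with $\lim_n C_n/n=0$ and $|\log\varphi_w(x)-\log\varphi_w(y)|\le C_n\,d_\sigma(x,y)$ for all $w\in\mathcal{W}^n$, $a\in\alpha$ with $[wa]\ne\emptyset$, $[w],[a]\subset\Omega$, and all $x,y\in[a]$, where $d_\sigma$ is the metric $d_r$ with respect to $(\Omega,\sigma)$ and the partition $\beta$; (b) there is an almost surely finite function $\eta^\dagger:\Omega\to\mathbb{N}$ such that for a.e. $x\in\Omega$ and all $l=0,\ldots,\eta(x)-1$ with $\theta^l(x)\in\Omega$ one has $\eta(x)-l\le\eta^\dagger(\theta^l(x))$. It has exponential tails if $\limsup_{n\to\infty}\sqrt[n]{\mu(\{x\in\Omega:\eta(x)=n\})}<1$. $T_0$ is topologically transitive if for all $a,b\in\alpha$ and $g,h\in G$ there is $n\ge1$ such that $T_0^n(a\times\{H_0g\})\cap(b\times\{H_0h\})$ has positive measure with respect to the product of $\mu$ and counting measure. The Schreier graph associated with $\mathfrak{g}$ has vertices $\mathbf{V}=\{Hg:g\in G\}$ and directed edges $\mathbf{E}=\{(Hg,Hgh):g\in G,h\in\mathfrak{g}\}$.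 For $e\in\mathbf{E}$ with source $s(e)$ and target $t(e)$, let $p(e)=\mu(\{x\in X:s(e)\gamma_x=t(e)\})$, and $\partial^\epsilon K=\{v\in K:\exists e\in\mathbf{E}, s(e)=v, t(e)\notin K, p(e)>\epsilon\}$ for $K\subset\mathbf{V}$. The graph is $\mu$-amenable if $\lim_{\epsilon\to0}\inf\{|\partial^\epsilon K|/|K|:K\subset\mathbf{V},0<|K|<\infty\}=0$. *)

(* Defs.v *)
From HB Require Import structures.
From mathcomp Require Import all_boot all_order all_algebra.
From mathcomp Require Import finmap.
From mathcomp Require Import all_classical all_reals all_analysis.

Set Implicit Arguments.
Unset Strict Implicit.
Unset Printing Implicit Defensive.

Import Order.TTheory GRing.Theory Num.Theory.
Import numFieldNormedType.Exports.

Local Open Scope classical_set_scope.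
Local Open Scope ring_scope.

(* Measures are always carried by an ambient measurable space X.  A system
   living on a subset Omega of X is described by a probability on X that gives
   no mass to the complement of Omega; statements "mod mu" then only see
   Omega. *)

(** ** Markov maps *)

(* X carries a Polish topology whose Borel sigma-algebra is the sigma-algebra
   of X.  (hausdorff_space turns the pseudometric into a metric.) *)
Definition standard_space (R : realType) (d : measure_display)
    (X : measurableType d) : Prop :=
  exists (P : completePseudoMetricType R) (f : X -> P),
    [/\ hausdorff_space P, @second_countable P, bijective f &
        forall A : set X, measurable A <-> <<s @open P >> (f @` A)].

(* (F i), i in J, is a partition of A up to mu-null sets. *)
Definition partition_mod (R : realType) (d : measure_display)
    (X : measurableType d) (mu : probability X R) (I : Type) (J : set I)
    (F : I -> set X) (A : set X) : Prop :=
  [/\ forall i, J i -> measurable (F i) /\ mu (F i `\` A) = 0%E,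
      forall i j, J i -> J j -> i <> j -> mu (F i `&` F j) = 0%E &
      mu (A `\` \bigcup_(i in J) F i) = 0%E].

(* [w_1 ... w_n]; letters are elements of the partition, i.e. subsets of X. *)
Definition cylinder (X : Type) (theta : X -> X) (w : seq (set X)) : set X :=
  [set x | forall k, (k < size w)%N -> nth set0 w k (iter k theta x)].

Definition nonsingular_bijection_on (R : realType) (d : measure_display)
    (X : measurableType d) (mu : probability X R) (theta : X -> X)
    (a : set X) : Prop :=
  [/\ set_inj a theta,
      measurable_fun a theta,
      forall A, measurable A -> A `<=` a -> measurable (theta @` A) &
      forall A, measurable A -> A `<=` a ->
        (mu A = 0%E <-> mu (theta @` A) = 0%E)].

(* The version of the notion in which alpha is only a partition mod mu and
   theta only matters on the union of alpha; it is the one that applies to the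
   induced map of an embedded structure. *)
Definition markov_map_mod (R : realType) (d : measure_display)
    (X : measurableType d) (mu : probability X R) (theta : X -> X)
    (alpha : set (set X)) : Prop :=
  [/\ standard_space R X,
      [/\ countable alpha,
          forall a, alpha a -> (0 < mu a)%E &
          partition_mod mu alpha id [set: X]],
      forall a, alpha a -> nonsingular_bijection_on mu theta a,
      forall a b, alpha a -> alpha b ->
        mu (a `&` theta @` b) = 0%E \/ mu (a `&` ~` (theta @` b)) = 0%E &
      forall A, measurable A ->
        exists2 A',
          <<s [set B | exists w : seq (set X),
                 [/\ (0 < size w)%N, (forall a, a \in w -> alpha a) &
                     B = cylinder theta w]] >> A' &
          mu (A `+` A') = 0%E].

Definition markov_map (R : realType) (d : measure_display)
    (X : measurableType d) (mu : probability X R) (theta : X -> X)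
    (alpha : set (set X)) : Prop :=
  partition alpha id [set: X] /\ markov_map_mod mu theta alpha.

Definition invariant_measure (R : realType) (d : measure_display)
    (X : measurableType d) (mu : probability X R) (theta : X -> X) : Prop :=
  forall A, measurable A -> mu (theta @^-1` A) = mu A.

(* W^n for n >= 1 (and the empty set for n = 0) *)
Definition admissible (R : realType) (d : measure_display)
    (X : measurableType d) (mu : probability X R) (theta : X -> X)
    (alpha : set (set X)) (n : nat) : set (seq (set X)) :=
  [set w | [/\ (0 < n)%N, size w = n, (forall a, a \in w -> alpha a) &
     forall i, (i.+1 < n)%N ->
       mu (nth set0 w i.+1 `\` theta @` nth set0 w i) = 0%E]].

Definition admissible_words (R : realType) (d : measure_display)
    (X : measurableType d) (mu : probability X R) (theta : X -> X)
    (alpha : set (set X)) : set (seq (set X)) :=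
  \bigcup_n admissible mu theta alpha n.

(* phi is a version of phi_w = d(mu o tau_w)/dmu on theta^n([w]), n = |w|.
   For A included in theta^n([w]), the set [w] /\ theta^{-n}(A) is tau_w(A).
   By non-singularity the density is a.e. positive on theta^n([w]), so only
   positive versions are considered; the values of phi outside of theta^n([w])
   are irrelevant. *)
Definition inverse_branch_density (R : realType) (d : measure_display)
    (X : measurableType d) (mu : probability X R) (theta : X -> X)
    (w : seq (set X)) (phi : X -> R) : Prop :=
  let n := size w in
  [/\ measurable_fun [set: X] phi,
      forall x, 0 < phi x &
      forall A, measurable A -> A `<=` iter n theta @` cylinder theta w ->
        mu (cylinder theta w `&` iter n theta @^-1` A) =
        (\int[mu]_(x in A) (phi x)%:E)%E].

(** ** Gibbs-Markov maps *)

(* set0 stands for an undefined symbol. *)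
Definition itinerary (X : Type) (theta : X -> X) (alpha : set (set X)) (x : X)
    (i : nat) : set X :=
  xget set0 [set a | alpha a /\ a (iter i theta x)].

(* d_r, with value 0 for points with the same itinerary *)
Definition itinerary_dist (R : realType) (X : Type) (r : R) (theta : X -> X)
    (alpha : set (set X)) (x y : X) : R :=
  let differ := fun i : nat =>
    `[< itinerary theta alpha x i <> itinerary theta alpha y i >] in
  if pselect (exists i, differ i) is left ex then r ^+ ex_minn ex else 0.

(* Gibbs-Markov map with full branches, for the given parameter r of d_r *)
Definition gibbs_markov_full (R : realType) (d : measure_display)
    (X : measurableType d) (mu : probability X R) (theta : X -> X)
    (alpha : set (set X)) (r : R) : Prop :=
  [/\ markov_map_mod mu theta alpha,
      forall a, alpha a -> mu (~` (theta @` a)) = 0%E,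
      0 < r < 1 &
      exists2 C : R, 0 < C &
        forall w, admissible_words mu theta alpha w ->
        exists2 phi, inverse_branch_density mu theta w phi &
        exists2 N, mu.-negligible N &
          forall x y, ~ N x -> ~ N y ->
            `|ln (phi x) - ln (phi y)| <= C * itinerary_dist r theta alpha x y].

(** ** Embedded Gibbs-Markov structures *)

(* eta(x) := eta(u) for x in [u]; junk value (that of the empty word) outside
   of the union of the [u], u in beta. *)
Definition return_time (X : Type) (theta : X -> X) (beta : set (seq (set X)))
    (eta : seq (set X) -> nat) (x : X) : nat :=
  eta (xget [::] [set u | beta u /\ cylinder theta u x]).

Definition induced_map (X : Type) (theta : X -> X) (beta : set (seq (set X)))
    (eta : seq (set X) -> nat) (x : X) : X :=
  iter (return_time theta beta eta x) theta x.

Definition base_partition (X : Type) (theta : X -> X)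
    (beta : set (seq (set X))) : set (set X) :=
  [set cylinder theta u | u in beta].

Definition embedded_gibbs_markov (R : realType) (d : measure_display)
    (X : measurableType d) (mu : probability X R) (theta : X -> X)
    (alpha : set (set X)) (Omega : set X) (beta : set (seq (set X)))
    (eta : seq (set X) -> nat) (r : R) : Prop :=
  [/\ exists F : set (set X),
        [/\ finite_set F, F `<=` alpha & Omega = \bigcup_(a in F) a],
      beta `<=` admissible_words mu theta alpha,
      partition_mod mu beta (cylinder theta) Omega &
      exists2 nu : probability X R,
        (forall A, measurable A ->
           nu A = (((fine (mu Omega))^-1)%:E * mu (A `&` Omega))%E) &
        gibbs_markov_full nu (induced_map theta beta eta)
          (base_partition theta beta) r].

Definition adequate (R : realType) (d : measure_display)
    (X : measurableType d) (mu : probability X R) (theta : X -> X)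
    (alpha : set (set X)) (Omega : set X) (beta : set (seq (set X)))
    (eta : seq (set X) -> nat) (r : R) : Prop :=
  let d_sigma := itinerary_dist r (induced_map theta beta eta)
                   (base_partition theta beta) in
  let etax := return_time theta beta eta in
  (exists2 C : nat -> R, (fun n => C n / n%:R) @ \oo --> (0 : R) &
     forall n w, admissible mu theta alpha n w ->
     exists2 phi, inverse_branch_density mu theta w phi &
     forall a, alpha a -> cylinder theta (rcons w a) !=set0 ->
       cylinder theta w `<=` Omega -> a `<=` Omega ->
       forall x y, a x -> a y ->
         `|ln (phi x) - ln (phi y)| <= C n * d_sigma x y) /\
  (* None is the value +oo of eta^dagger. *)
  (exists2 etad : X -> option nat,
     {ae mu, forall x, Omega x -> etad x <> None} &
     {ae mu, forall x, Omega x ->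
        forall l, (l < etax x)%N -> Omega (iter l theta x) ->
        forall k, etad (iter l theta x) = Some k -> (etax x - l <= k)%N}).

(* The parameter r of d_sigma in the definition of adequacy is the one of the
   Gibbs-Markov property of the induced map. *)
Definition adequately_embedded (R : realType) (d : measure_display)
    (X : measurableType d) (mu : probability X R) (theta : X -> X)
    (alpha : set (set X)) (Omega : set X) (beta : set (seq (set X)))
    (eta : seq (set X) -> nat) : Prop :=
  exists2 r : R, embedded_gibbs_markov mu theta alpha Omega beta eta r &
    adequate mu theta alpha Omega beta eta r.

Definition limsup_root (R : realType) (u : nat -> \bar R) : \bar R :=
  limn_esup (fun n => (u n `^ (n%:R^-1))%E).

Definition exponential_tails (R : realType) (d : measure_display)
    (X : measurableType d) (mu : probability X R) (theta : X -> X)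
    (Omega : set X) (beta : set (seq (set X)))
    (eta : seq (set X) -> nat) : Prop :=
  (limsup_root (fun n =>
     mu [set x | Omega x /\ return_time theta beta eta x = n]) < 1)%E.

(** ** Extensions by cosets *)

Definition subgroup (G : groupType) (H : set G) : Prop :=
  group_closed (mem H).

Definition rtranslate (G : groupType) (v : set G) (g : G) : set G :=
  [set (x * g)%g | x in v].

Definition right_coset (G : groupType) (H : set G) (g : G) : set G :=
  rtranslate H g.

Definition right_cosets (G : groupType) (H : set G) : set (set G) :=
  range (right_coset H).

Definition normal_core (G : groupType) (H : set G) : set G :=
  \bigcap_(g in [set: G]) [set (g * x * g^-1)%g | x in H].

(* (x, Kg) |-> (theta(x), K g gamma_x), for any subgroup K of G: this is T for
   K = H and T_0 for K = H_0. *)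
Definition coset_extension (X : Type) (G : groupType) (theta : X -> X)
    (gamma : X -> G) (p : X * set G) : X * set G :=
  (theta p.1, rtranslate p.2 (gamma p.1)).

(* product of mu and of the counting measure on V *)
Definition prod_counting (R : realType) (d : measure_display)
    (X : measurableType d) (mu : probability X R) (G : groupType)
    (V : set (set G)) (S : set (X * set G)) : \bar R :=
  \esum_(v in V) mu [set x | S (x, v)].

Definition topologically_transitive (R : realType) (d : measure_display)
    (X : measurableType d) (mu : probability X R) (theta : X -> X)
    (alpha : set (set X)) (G : groupType) (gamma : X -> G)
    (K : set G) : Prop :=
  forall a b g h, alpha a -> alpha b ->
    exists2 n, (0 < n)%N &
      (0 < prod_counting mu (right_cosets K)
             ((iter n (coset_extension theta gamma) @`
                 (a `*` [set right_coset K g])) `&`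
              (b `*` [set right_coset K h])))%E.

(* gamma_x gamma_{theta(x)} ... gamma_{theta^{n-1}(x)} *)
Definition cocycle (X : Type) (G : groupType) (theta : X -> X)
    (gamma : X -> G) (n : nat) (x : X) : G :=
  (\prod_(i < n) gamma (iter i theta x))%g.

Definition return_rate (R : realType) (d : measure_display)
    (X : measurableType d) (mu : probability X R) (theta : X -> X)
    (G : groupType) (gamma : X -> G) (Omega : set X) (o : set G) : \bar R :=
  limsup_root (fun n =>
    mu [set x | [/\ Omega x, Omega (iter n theta x) &
                    rtranslate o (cocycle theta gamma n x) = o]]).

(** ** Amenability of the Schreier graph *)

Definition schreier_edges (G : groupType) (H gens : set G) :
    set (set G * set G) :=
  [set e | exists g h, gens h /\ e = (right_coset H g, right_coset H (g * h)%g)].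

Definition edge_probability (R : realType) (d : measure_display)
    (X : measurableType d) (mu : probability X R) (G : groupType)
    (gamma : X -> G) (e : set G * set G) : \bar R :=
  mu [set x | rtranslate e.1 (gamma x) = e.2].

Definition edge_boundary (R : realType) (d : measure_display)
    (X : measurableType d) (mu : probability X R) (G : groupType)
    (gamma : X -> G) (H : set G) (eps : R) (K : set (set G)) : set (set G) :=
  [set v | K v /\ exists e,
     [/\ schreier_edges H (range gamma) e, e.1 = v, ~ K e.2 &
         (eps%:E < edge_probability mu gamma e)%E]].

Definition isoperimetric_constant (R : realType) (d : measure_display)
    (X : measurableType d) (mu : probability X R) (G : groupType)
    (gamma : X -> G) (H : set G) (eps : R) : R :=
  inf [set q : R | exists K : set (set G),
         [/\ K `<=` right_cosets H, finite_set K, K !=set0 &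
             q = #|` fset_set (edge_boundary mu gamma H eps K)|%:R /
                 #|` fset_set K|%:R]].

Definition schreier_amenable (R : realType) (d : measure_display)
    (X : measurableType d) (mu : probability X R) (G : groupType)
    (gamma : X -> G) (H : set G) : Prop :=
  isoperimetric_constant mu gamma H @ 0^'+ --> (0 : R).

(* Main.v *)
(* If every finite set K of vertices has at least dx |K| boundary vertices, averages
   over translations contract the l2-norm on V. The induced map sigma is Gibbs-Markov
   with full branches, so its branches push measures with log-Lipschitz
   density to such measures, from which a fixed multiple of nu splits off; on that
   part the increments of the cocycle can be resampled. Together with the
   contraction this shows that the probability that the cocycle over sigma moves a
   vertex v to o decays exponentially in sigma-time, uniformly in v.
   The contraction needs several group elements reached in the same number of
   steps: by transitivity the values of the cocycle along loops form a semigroup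
   that meets every translate gQ of one finite set Q, hence a subgroup of finite index,
   on which the expansion persists. Exponential tails, invariance of mu and the
   subexponential distortion in (a) carry the decay over to theta-time, so that
   the return rate is less than 1. If eta vanishes on some word, Omega is an atom
   and V is finite, which is trivially amenable. *)

Require Import Defs.
From mathcomp Require Import all_boot all_order all_algebra.
From mathcomp Require Import finmap.
From mathcomp Require Import all_classical all_reals all_analysis measurable_realfun.
From mathcomp Require Import ring lra zify.

Set Implicit Arguments.
Unset Strict Implicit.
Unset Printing Implicit Defensive.

Import Order.TTheory GRing.Theory Num.Theory.
Import numFieldNormedType.Exports.

Local Open Scope classical_set_scope.
Local Open Scope ring_scope.

(** * l2-norms and expansion on the coset space *)

Section FiniteSums.
Context {R : realType} {T : choiceType}.
Implicit Types f g : T -> R.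

Definition fsupp f := finite_set [set x | f x != 0].

Definition fsum f : R := \sum_(x \in [set: T]) f x.

Lemma fsuppP f : fsupp f <-> exists K : {fset T}, forall x, x \notin K -> f x = 0.
Proof.
split=> [ff|[K K0]].
  exists (fset_set [set x | f x != 0]) => x; rewrite in_fset_set// notin_setE /=.
  by move=> /negP; rewrite negbK => /eqP.
apply: (sub_finite_set _ (finite_fset K)) => x /= fx.
by apply: contraNT fx => /K0 ->.
Qed.

Lemma fsumE f (K : {fset T}) :
  (forall x, x \notin K -> f x = 0) -> fsum f = \sum_(x <- K) f x.
Proof.
move=> f0; rewrite fsbig_seq ?fset_uniq// /fsum.
by rewrite -(fsbig_widen [set` K] [set: T])//= => x [_ /negP]; exact: f0.
Qed.

Lemma fsupp2 f g : fsupp f -> fsupp g ->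
  exists K : {fset T}, forall x, x \notin K -> f x = 0 /\ g x = 0.
Proof.
move=> /fsuppP[A A0] /fsuppP[B B0]; exists (A `|` B)%fset => x.
by rewrite in_fsetU negb_or => /andP[/A0 -> /B0 ->].
Qed.

Lemma fsuppW f g : (forall x, f x = 0 -> g x = 0) -> fsupp f -> fsupp g.
Proof.
by move=> fg /fsuppP[K K0]; apply/fsuppP; exists K => x /K0 /fg.
Qed.

Lemma fsuppD f g : fsupp f -> fsupp g -> fsupp (fun x => f x + g x).
Proof.
move=> ff fg; have [K K0] := fsupp2 ff fg.
by apply/fsuppP; exists K => x /K0[-> ->]; rewrite addr0.
Qed.

Lemma fsuppZ c f : fsupp f -> fsupp (fun x => c * f x).
Proof. by apply: fsuppW => x ->; rewrite mulr0. Qed.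

Lemma fsupp_sum (I : Type) (s : seq I) (F : I -> T -> R) :
  (forall i, fsupp (F i)) -> fsupp (fun x => \sum_(i <- s) F i x).
Proof.
move=> fF; elim: s => [|i s IH].
  by apply/fsuppP; exists fset0 => x _; rewrite big_nil.
have -> : (fun x => \sum_(j <- i :: s) F j x) = fun x => F i x + \sum_(j <- s) F j x.
  by apply/funext => x; rewrite big_cons.
exact: fsuppD.
Qed.

Lemma fsumD f g : fsupp f -> fsupp g ->
  fsum (fun x => f x + g x) = fsum f + fsum g.
Proof.
move=> ff fg; have [K K0] := fsupp2 ff fg.
have -> : fsum f = \sum_(x <- K) f x by apply: fsumE => x /K0[].
have -> : fsum g = \sum_(x <- K) g x by apply: fsumE => x /K0[].
by rewrite -big_split; apply: fsumE => x /K0[-> ->]; rewrite addr0.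
Qed.

Lemma fsumZ c f : fsum (fun x => c * f x) = c * fsum f.
Proof. by rewrite /fsum mulr_fsumr. Qed.

Lemma fsum0 : fsum (fun _ => 0) = 0.
Proof. exact: fsbig1. Qed.

Lemma eq_fsum f g : f =1 g -> fsum f = fsum g.
Proof. by move=> /funext ->. Qed.

Lemma fsum_sum (I : Type) (s : seq I) (F : I -> T -> R) :
  (forall i, fsupp (F i)) ->
  fsum (fun x => \sum_(i <- s) F i x) = \sum_(i <- s) fsum (F i).
Proof.
move=> fF; elim: s => [|i s IH].
  by rewrite big_nil -[RHS]fsum0; apply: eq_fsum => x; rewrite big_nil.
rewrite big_cons -IH -fsumD//; last exact: fsupp_sum.
by apply: eq_fsum => x; rewrite big_cons.
Qed.

Lemma ler_fsum f g : fsupp f -> fsupp g -> (forall x, f x <= g x) ->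
  fsum f <= fsum g.
Proof.
move=> ff fg le_fg; have [K K0] := fsupp2 ff fg.
have -> : fsum f = \sum_(x <- K) f x by apply: fsumE => x /K0[].
have -> : fsum g = \sum_(x <- K) g x by apply: fsumE => x /K0[].
exact: ler_sum.
Qed.

Lemma fsum_ge0 f : (forall x, 0 <= f x) -> 0 <= fsum f.
Proof. by move=> f0; apply: fsumr_ge0. Qed.

Lemma ler_fsum1 f x : fsupp f -> (forall x, 0 <= f x) -> f x <= fsum f.
Proof.
move=> /fsuppP[K K0] f0.
have [xK|/K0 ->] := boolP (x \in K); last exact: fsum_ge0.
by rewrite (fsumE K0) (big_fsetD1 x)//= lerDl sumr_ge0.
Qed.

Lemma reindex_fsum (h h' : T -> T) f : cancel h h' -> cancel h' h ->
  fsum (fun x => f (h x)) = fsum f.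
Proof.
by move=> hK h'K; rewrite /fsum [RHS](reindex_fsbigT h)//; exists h'.
Qed.

Lemma fsupp_comp (h h' : T -> T) f : cancel h' h -> cancel h h' ->
  fsupp f -> fsupp (fun x => f (h x)).
Proof.
move=> h'K hK /fsuppP[K K0]; apply/fsuppP.
exists [fset h' x | x in K]%fset => x xK; apply: K0.
by apply: contra xK => hxK; apply/imfsetP; exists (h x) => //; rewrite hK.
Qed.

End FiniteSums.

Section Translation.
Context {G : groupType}.
Implicit Types (v : set G) (g h : G).

Lemma rtranslateM v g h : rtranslate (rtranslate v g) h = rtranslate v (g * h)%g.
Proof.
apply/seteqP; split => [_ [_ [x vx <-] <-]|_ [x vx <-]].
  by exists x => //; rewrite mulgA.
by exists (x * g)%g; [exists x|rewrite mulgA].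
Qed.

Lemma rtranslate1 v : rtranslate v 1%g = v.
Proof.
apply/seteqP; split => [_ [x vx <-]|x vx]; first by rewrite mulg1.
by exists x => //; rewrite mulg1.
Qed.

Lemma rtranslateK v g : rtranslate (rtranslate v g) g^-1%g = v.
Proof. by rewrite rtranslateM mulgV rtranslate1. Qed.

Lemma rtranslateVK v g : rtranslate (rtranslate v g^-1%g) g = v.
Proof. by rewrite rtranslateM mulVg rtranslate1. Qed.

Lemma right_cosets_translate (H : set G) v g :
  right_cosets H v -> right_cosets H (rtranslate v g).
Proof. by move=> [h _ <-]; exists (h * g)%g => //; rewrite /right_coset rtranslateM. Qed.

End Translation.

Section SquareNorm.
Context {R : realType} {G : groupType}.
Variable H : set G.
Implicit Types (xi : set G -> R) (g h : G) (v : set G).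

Definition nsq xi : R := fsum (fun v => xi v ^+ 2).

Definition trans g xi : set G -> R := fun v => xi (rtranslate v g^-1%g).

Definition vec xi := [/\ fsupp xi, forall v, 0 <= xi v &
  forall v, ~ right_cosets H v -> xi v = 0].

Lemma fsupp_sqr xi : fsupp xi -> fsupp (fun v => xi v ^+ 2).
Proof. by apply: fsuppW => v ->; rewrite expr0n. Qed.

Lemma nsq_ge0 xi : 0 <= nsq xi.
Proof. by apply: fsum_ge0 => v; rewrite sqr_ge0. Qed.

Lemma nsq_trans g xi : nsq (trans g xi) = nsq xi.
Proof.
apply: (reindex_fsum (h := fun v => rtranslate v g^-1%g) (h' := fun v => rtranslate v g)
  (fun v => xi v ^+ 2)) => v; first exact: rtranslateVK.
exact: rtranslateK.
Qed.

Lemma transM g h xi : trans g (trans h xi) = trans (h * g)%g xi.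
Proof. by apply/funext => v; rewrite /trans rtranslateM invgM. Qed.

Lemma trans1 xi : trans 1%g xi = xi.
Proof. by apply/funext => v; rewrite /trans invg1 rtranslate1. Qed.

Lemma fsupp_trans g xi : fsupp xi -> fsupp (trans g xi).
Proof.
apply: (fsupp_comp (h' := fun v => rtranslate v g)) => v.
  exact: rtranslateK.
exact: rtranslateVK.
Qed.

Lemma vec_trans g xi : vec xi -> vec (trans g xi).
Proof.
move=> [ff f0 fV]; split=> [|v|v Vv]; [exact: fsupp_trans|exact: f0|].
apply: fV => /(@right_cosets_translate _ _ _ g); rewrite rtranslateVK; exact: Vv.
Qed.

Lemma vecD xi zeta : vec xi -> vec zeta -> vec (fun v => xi v + zeta v).
Proof.
move=> [f1 p1 V1] [f2 p2 V2]; split=> [|v|v Vv]; first exact: fsuppD.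
  by rewrite addr_ge0.
by rewrite V1// V2// addr0.
Qed.

Lemma vec0 : vec (fun _ => 0).
Proof. by split=> //; apply/fsuppP; exists fset0. Qed.

Lemma vecZ c xi : 0 <= c -> vec xi -> vec (fun v => c * xi v).
Proof.
move=> c0 [f1 p1 V1]; split=> [|v|v Vv]; first exact: fsuppZ.
  by rewrite mulr_ge0.
by rewrite V1// mulr0.
Qed.

Lemma vec_sum (I : Type) (s : seq I) (F : I -> set G -> R) :
  (forall i, vec (F i)) -> vec (fun v => \sum_(i <- s) F i v).
Proof.
move=> vF; elim: s => [|i s IH].
  have -> : (fun v => \sum_(i <- [::]) F i v) = fun=> 0; last exact: vec0.
  by apply/funext => v; rewrite big_nil.
have -> : (fun v => \sum_(j <- i :: s) F j v) = fun v => F i v + \sum_(j <- s) F j v.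
  by apply/funext => v; rewrite big_cons.
exact: (vecD (vF i) IH).
Qed.

Lemma le_nsq xi zeta : fsupp xi -> fsupp zeta ->
  (forall v, 0 <= xi v <= zeta v) -> nsq xi <= nsq zeta.
Proof.
move=> f1 f2 le; apply: ler_fsum => [||v]; [exact: fsupp_sqr..|].
by have /andP[a b] := le v; rewrite ler_pXn2r ?nnegrE// (le_trans a).
Qed.

Lemma fsuppB (xi zeta : set G -> R) : fsupp xi -> fsupp zeta ->
  fsupp (fun v => xi v - zeta v).
Proof.
move=> f1 f2; apply: fsuppW (fsuppD f1 (fsuppZ (-1) f2)) => v.
by rewrite mulN1r.
Qed.

End SquareNorm.

Section WeightedSquares.
Context {R : realType} {I : eqType}.
Variables (s : seq I) (p : I -> R).
Hypothesis p0 : forall i, i \in s -> 0 <= p i.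

(* Lagrange's identity, of which only the terms (a, b) and (b, a) are kept. *)
Lemma sqr_wsum_le (x : I -> R) a b : uniq s -> a \in s -> b \in s ->
  (\sum_(i <- s) p i * x i) ^+ 2 + p a * p b * (x a - x b) ^+ 2 <=
  (\sum_(i <- s) p i) * \sum_(i <- s) p i * x i ^+ 2.
Proof.
move=> us sa sb.
have D : \sum_(i <- s) \sum_(j <- s) p i * p j * (x i - x j) ^+ 2 =
   2 * ((\sum_(i <- s) p i) * (\sum_(i <- s) p i * x i ^+ 2)
     - (\sum_(i <- s) p i * x i) ^+ 2).
  have -> : \sum_(i <- s) \sum_(j <- s) p i * p j * (x i - x j) ^+ 2 =
     \sum_(i <- s) \sum_(j <- s) (p i * x i ^+ 2) * p j +
     \sum_(i <- s) \sum_(j <- s) p i * (p j * x j ^+ 2) +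
     - 2 * \sum_(i <- s) \sum_(j <- s) (p i * x i) * (p j * x j).
    rewrite mulr_sumr -!big_split /=; apply: eq_bigr => i _.
    by rewrite mulr_sumr -!big_split /=; apply: eq_bigr => j _; ring.
  under eq_bigr do rewrite -mulr_sumr.
  under [X in _ + X + _]eq_bigr do rewrite -mulr_sumr.
  under [X in _ + _ * X]eq_bigr do rewrite -mulr_sumr.
  by rewrite -!mulr_suml; ring.
have T0 i j : i \in s -> j \in s -> 0 <= p i * p j * (x i - x j) ^+ 2.
  by move=> si sj; rewrite mulr_ge0 ?sqr_ge0// mulr_ge0// p0.
have row i j : i \in s -> j \in s -> p i * p j * (x i - x j) ^+ 2 <=
    \sum_(j <- s) p i * p j * (x i - x j) ^+ 2.
  move=> si sj; rewrite (big_rem j)//= lerDl big_seq sumr_ge0// => k /mem_rem ks.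
  exact: T0.
have [->|ab] := eqVneq a b.
  rewrite subrr expr0n mulr0 addr0 -subr_ge0 -(pmulr_rge0 _ (@ltr0Sn R 1)) -D.
  by rewrite big_seq sumr_ge0// => i si; rewrite big_seq sumr_ge0// => j sj; exact: T0.
have two (F : I -> R) : (forall i, i \in s -> 0 <= F i) ->
    F a + F b <= \sum_(i <- s) F i.
  move=> F0; rewrite (big_rem a)//= lerD2l (big_rem b)/=; last first.
    by rewrite (mem_rem_uniq _ us) inE eq_sym ab.
  by rewrite lerDl big_seq sumr_ge0// => k /mem_rem /mem_rem ks; exact: F0.
have := two (fun i => \sum_(j <- s) p i * p j * (x i - x j) ^+ 2).
rewrite D => /(_ _)/wrap[i si|]; first by rewrite big_seq sumr_ge0// => j sj; exact: T0.
have := row a b sa sb; have := row b a sb sa.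
have -> : p b * p a * (x b - x a) ^+ 2 = p a * p b * (x a - x b) ^+ 2 by ring.
lra.
Qed.
End WeightedSquares.

Section SquareNorms.
Context {R : realType} {G : groupType}.

Lemma nsq_wsum_le (I : choiceType) (s : seq I) (p : I -> R)
    (F : I -> set G -> R) a b :
  (forall i, i \in s -> 0 <= p i) -> (forall i, fsupp (F i)) ->
  uniq s -> a \in s -> b \in s ->
  nsq (fun v => \sum_(i <- s) p i * F i v) +
    p a * p b * nsq (fun v => F a v - F b v) <=
  (\sum_(i <- s) p i) * \sum_(i <- s) p i * nsq (F i).
Proof.
move=> p0 fF us sa sb.
have fF2 i : fsupp (fun v => p i * F i v ^+ 2) by apply/fsuppZ/fsupp_sqr.
have fab : fsupp (fun v => (F a v - F b v) ^+ 2) by exact/fsupp_sqr/fsuppB.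
have fs : fsupp (fun v => (\sum_(i <- s) p i * F i v) ^+ 2).
  by apply: fsupp_sqr; apply: fsupp_sum => i; exact: fsuppZ.
have -> : \sum_(i <- s) p i * nsq (F i) =
    fsum (fun v => \sum_(i <- s) p i * F i v ^+ 2).
  by rewrite fsum_sum//; apply: eq_bigr => i _; rewrite fsumZ.
rewrite /nsq -!fsumZ -fsumD//; last exact: fsuppZ.
apply: ler_fsum => [||v]; last exact: sqr_wsum_le.
  by apply: fsuppD => //; exact: fsuppZ.
by apply: fsuppZ; exact: fsupp_sum.
Qed.

Lemma nsq_sum_le (I : choiceType) (s : seq I) (F : I -> set G -> R) :
  (forall i, fsupp (F i)) -> uniq s ->
  nsq (fun v => \sum_(i <- s) F i v) <= (size s)%:R * \sum_(i <- s) nsq (F i).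
Proof.
case: s => [|a s] fF us.
  rewrite big_nil mulr0 /nsq (@eq_fsum _ _ _ (fun=> 0)) ?fsum0// => v.
  by rewrite big_nil expr0n.
have aS : a \in a :: s by rewrite mem_head.
have := @nsq_wsum_le _ (a :: s) (fun=> 1) F a a (fun _ _ => ler01) fF us aS aS.
rewrite (_ : \sum_(i <- a :: s) (1 : R) = (size (a :: s))%:R); last first.
  by rewrite -sum1_size natr_sum.
under eq_bigr do rewrite mul1r.
rewrite (_ : (fun v => _) = (fun v => \sum_(i <- a :: s) F i v)); last first.
  by apply/funext => v; apply: eq_bigr => i _; rewrite mul1r.
by apply: le_trans; rewrite lerDl !mul1r nsq_ge0.
Qed.

(* The minorant removed at each step is a multiple of the indicator
   function of the current superlevel set, to which the isoperimetric
   inequality applies. *)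
Lemma layer_cake (H : set G) (gs : seq G) (d : R) : 0 < d ->
  (forall K : {fset (set G)}, K != fset0 ->
     (forall v, v \in K -> right_cosets H v) ->
     d * #|` K|%:R <=
     #|` [fset v in K | has (fun h => rtranslate v h \notin K) gs]%fset|%:R) ->
  forall (K : {fset (set G)}) (f : set G -> R),
    (forall v, v \in K -> right_cosets H v) ->
    (forall v, 0 <= f v) -> (forall v, v \notin K -> f v = 0) ->
    d * \sum_(v <- K) f v <=
    \sum_(v <- K) \sum_(h <- gs) Num.max (f v - f (rtranslate v h)) 0.
Proof.
move=> d0 iso K; have [n] := ubnP #|` K|; elim: n K => // n IH K Kn f KV f0 fK.
have [->|K0] := eqVneq K fset0; first by rewrite !big_seq_fset0 mulr0.
have [v0 v0K min0] : exists2 v0, v0 \in K & forall v, v \in K -> f v0 <= f v.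
  have [a aK] := fset0Pn _ K0.
  have [/= b _ bP] := @arg_minP _ _ K (FSetSub aK) xpredT (fun v => f (val v)) isT.
  exists (val b); first exact: valP.
  by move=> v vK; exact: (bP (FSetSub vK)).
set t := f v0.
pose f' v := if v \in K then f v - t else 0.
pose K' := [fset v in K | f v != t]%fset.
have K'K : {subset K' <= K} by move=> v; rewrite !inE => /andP[].
have f'0 v : 0 <= f' v by rewrite /f'; case: ifP => // vK; rewrite subr_ge0 min0.
have f'K v : v \notin K' -> f' v = 0.
  rewrite /f' !inE; case: ifP => // vK /=; rewrite negbK => /eqP ->.
  by rewrite subrr.
have card' : (#|` K'| < n)%N.
  apply: leq_trans (Kn : #|` K| <= n)%N; apply: fproper_ltn_card.
  rewrite fproperE; apply/andP; split; first exact/fsubsetP.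
  by apply/fsubsetPn; exists v0; rewrite // !inE eqxx andbF.
have := IH K' card' f' (fun v vK => KV v (K'K v vK)) f'0 f'K.
have sumK (F : set G -> R) : (forall v, v \notin K' -> F v = 0) ->
    \sum_(v <- K') F v = \sum_(v <- K) F v.
  move=> F0; rewrite (big_fset_incl _ (B := K))//; first exact/fsubsetP.
  by move=> v _; exact: F0.
rewrite !sumK//; last first.
  move=> v vK; apply: big1 => h _; apply/max_idPr; rewrite (f'K v)//.
  by rewrite subr_le0.
move=> IH'.
have step v : v \in K -> \sum_(h <- gs) Num.max (f' v - f' (rtranslate v h)) 0 +
    t * (has (fun h => rtranslate v h \notin K) gs)%:R <=
    \sum_(h <- gs) Num.max (f v - f (rtranslate v h)) 0.
  move=> vK; have t0 : 0 <= t by exact: f0.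
  have -> : \sum_(h <- gs) Num.max (f v - f (rtranslate v h)) 0 =
     \sum_(h <- gs) Num.max (f' v - f' (rtranslate v h)) 0 +
     t * \sum_(h <- gs) (rtranslate v h \notin K)%:R.
    rewrite mulr_sumr -big_split; apply: eq_bigr => h _ /=.
    rewrite /f' vK; case: ifPn => [vhK|/fK ->] /=.
      by rewrite mulr0 addr0; congr (Num.max _ _); ring.
    rewrite mulr1 !subr0 !max_l ?subr_ge0 ?min0//; ring.
  rewrite lerD2l ler_wpM2l//; elim: gs {IH iso IH'} => [|h s IHs] /=.
    by rewrite big_nil.
  rewrite big_cons; case: (rtranslate v h \in K) => /=; first by rewrite add0r.
  by rewrite lerDl sumr_ge0.
have fE : \sum_(v <- K) f v = \sum_(v <- K) f' v + t * #|` K|%:R.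
  rewrite card_fset_sum1 natr_sum mulr_sumr -big_split /= big_seq [RHS]big_seq.
  by apply: eq_bigr => v vK; rewrite /f' vK mulr1 subrK.
have bE : #|` [fset v in K | has (fun h => rtranslate v h \notin K) gs]%fset|%:R =
    \sum_(v <- K) (has (fun h => rtranslate v h \notin K) gs)%:R :> R.
  rewrite card_fset_sum1 natr_sum -big_fset_condE big_mkcond /=.
  by apply: eq_bigr => v _; case: (has _ _).
apply: (@le_trans _ _ (\sum_(v <- K)
    (\sum_(h <- gs) Num.max (f' v - f' (rtranslate v h)) 0 +
    t * (has (fun h => rtranslate v h \notin K) gs)%:R))).
  rewrite fE mulrDr big_split /= lerD// -mulr_sumr -bE mulrCA.
  by rewrite ler_wpM2l ?iso//; exact: f0.
by rewrite big_seq [leRHS]big_seq; apply: ler_sum => v; exact: step.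
Qed.

End SquareNorms.

Section Expansion.
Context {R : realType} {G : groupType}.
Variables (H : set G) (gs : seq G).

Definition expanding (d : R) := forall K : {fset (set G)}, K != fset0 ->
  (forall v, v \in K -> right_cosets H v) ->
  d * #|` K|%:R <=
  #|` [fset v in K | has (fun h => rtranslate v h \notin K) gs]%fset|%:R.

Lemma expanding_laplacian d : 0 < d -> expanding d ->
  exists2 c : R, 0 < c & forall xi : set G -> R, vec H xi ->
    c * nsq xi <= \sum_(h <- gs) nsq (fun v => trans h xi v - xi v).
Proof.
move=> d0 iso; pose k : R := (size gs).+1%:R; have k0 : 0 < k by rewrite ltr0n.
pose b := d / (8 * k); have b0 : 0 < b by rewrite divr_gt0// mulr_gt0.
exists (2 * b * d); first by apply: mulr_gt0 => //; apply: mulr_gt0.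
move=> xi [fxi xi0 xiV].
have [K K0] := (fsuppP xi).1 fxi.
have KV0 : exists K' : {fset (set G)},
    (forall v, v \in K' -> right_cosets H v) /\ (forall v, v \notin K' -> xi v = 0).
  exists [fset v in K | xi v != 0]%fset; split=> v; rewrite !inE /=.
    by move=> /andP[_ /eqP]; apply: contra_notP => /xiV.
  by rewrite negb_and negbK => /orP[/K0 //|/eqP].
have {K K0 KV0} [K [KV K0]] := KV0.
have K20 v : v \notin K -> xi v ^+ 2 = 0 by move=> /K0 ->; rewrite expr0n.
have := layer_cake d0 iso KV (fun v => sqr_ge0 (xi v)) K20.
rewrite -(fsumE K20) -/(nsq xi) => cake.
pose D h := nsq (fun v => trans h xi v - xi v).
have DE h : D h = nsq (fun v => xi v - xi (rtranslate v h)).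
  rewrite /D -[RHS](nsq_trans h); apply: eq_fsum => v.
  by rewrite /trans rtranslateVK.
have fh h : fsupp (fun v => xi (rtranslate v h)).
  apply: (fsupp_comp (h' := fun v => rtranslate v h^-1%g)) fxi => v.
    exact: rtranslateVK.
  exact: rtranslateK.
have Nh h : nsq (fun v => xi (rtranslate v h)) = nsq xi.
  rewrite -[LHS](nsq_trans h); apply: eq_fsum => v.
  by rewrite /trans rtranslateVK.
have amgm (x y : R) : Num.max (x ^+ 2 - y ^+ 2) 0 <=
    (4 * b)^-1 * (x - y) ^+ 2 + (2 * b) * (x ^+ 2 + y ^+ 2).
  set r := (4 * b)^-1; have r0 : 0 < r by rewrite invr_gt0 mulr_gt0.
  have rb : 4 * (r * b) = 1.
    by rewrite mulrCA -[r]invrK /r invrK mulVf// gt_eqF// mulr_gt0.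
  have sq : 0 <= r * (x - y - 2 * b * (x + y)) ^+ 2 by rewrite mulr_ge0 ?sqr_ge0// ltW.
  have sE : r * (x - y - 2 * b * (x + y)) ^+ 2 =
     r * (x - y) ^+ 2 - (4 * (r * b)) * (x ^+ 2 - y ^+ 2) + (4 * (r * b)) * b * (x + y) ^+ 2.
    ring.
  have : 0 <= b * (x - y) ^+ 2 by rewrite mulr_ge0 ?sqr_ge0// ltW.
  have : 0 <= r * (x - y) ^+ 2 by rewrite mulr_ge0 ?sqr_ge0// ltW.
  have : 0 <= b * (x + y) ^+ 2 by rewrite mulr_ge0 ?sqr_ge0// ltW.
  rewrite rb !mul1r in sE; rewrite ge_max => A B C; apply/andP; split; nra.
have bound : \sum_(v <- K) \sum_(h <- gs) Num.max (xi v ^+ 2 - xi (rtranslate v h) ^+ 2) 0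
    <= \sum_(h <- gs) ((4 * b)^-1 * D h + 2 * b * (nsq xi + nsq xi)).
  rewrite exchange_big; apply: ler_sum => h _ /=.
  have -> : (4 * b)^-1 * D h + 2 * b * (nsq xi + nsq xi) =
      fsum (fun v => (4 * b)^-1 * (xi v - xi (rtranslate v h)) ^+ 2 +
                     2 * b * (xi v ^+ 2 + xi (rtranslate v h) ^+ 2)).
    rewrite fsumD; last 2 first.
    - by apply/fsuppZ/fsupp_sqr/fsuppB.
    - by apply/fsuppZ/fsuppD; exact: fsupp_sqr.
    rewrite !fsumZ fsumD; [|exact: fsupp_sqr..].
    by congr (_ * _ + _ * (_ + _)); [exact: DE|exact/esym/Nh].
  have F0 v : v \notin K -> Num.max (xi v ^+ 2 - xi (rtranslate v h) ^+ 2) 0 = 0.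
    by move=> /K20 ->; apply/max_idPr; rewrite sub0r oppr_le0 sqr_ge0.
  rewrite -(fsumE F0); apply: ler_fsum => [||v]; last exact: amgm.
    by apply/fsuppP; exists K.
  apply: fsuppD; first by apply/fsuppZ/fsupp_sqr/fsuppB.
  by apply/fsuppZ/fsuppD; exact: fsupp_sqr.
have {bound} := le_trans cake bound.
rewrite big_split -mulr_sumr /=.
have -> : \sum_(h <- gs) 2 * b * (nsq xi + nsq xi) = 4 * b * (size gs)%:R * nsq xi.
  move: (nsq xi) => N; rewrite -sum1_size natr_sum [in RHS]mulr_sumr [in RHS]mulr_suml.
  by apply: eq_bigr => h _; ring.
have le_k : 4 * b * (size gs)%:R * nsq xi <= 4 * b * k * nsq xi.
  by rewrite ler_wpM2r ?nsq_ge0// ler_wpM2l ?ler_nat// mulr_ge0// ltW.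
have bk : 4 * b * k = d / 2.
  by rewrite /b; field; rewrite gt_eqF.
set S := \sum_(h <- gs) D h => le1.
have {le1 le_k} le2 : d / 2 * nsq xi <= (4 * b)^-1 * S by rewrite bk in le_k; lra.
have := ler_wpM2l (ltW (mulr_gt0 (ltr0Sn R 3) b0)) le2.
have b4 : 4 * b != 0 by rewrite mulf_neq0 ?pnatr_eq0// gt_eqF.
rewrite (mulVKf b4); apply: le_trans.
by rewrite le_eqVlt; apply/orP; left; apply/eqP; field.
Qed.

End Expansion.

Lemma sum_const_seq (R : realType) (I : Type) (s : seq I) (x : R) :
  \sum_(i <- s) x = (size s)%:R * x.
Proof. by rewrite big_const_seq count_predT iter_addr addr0 mulr_natl. Qed.

Section Semigroups.
Context {G : groupType}.

(* Choosing q' with q^-1 q' in E for each q produces, by pigeonhole, a cycle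
   q, .., q, whose product is the identity. *)
Lemma cocompact_semigroup_id (E : set G) (Q : seq G) :
  (forall x y, E x -> E y -> E (x * y)%g) ->
  (forall g, exists2 q, q \in Q & E (g * q)%g) -> E 1%g.
Proof.
move=> EM EQ; pose f q := xget 1%g [set q' | q' \in Q /\ E (q^-1 * q')%g].
have fP q : f q \in Q /\ E (q^-1 * f q)%g.
  have [q' q'Q Eq'] := EQ (q^-1)%g.
  by apply: (@xgetPex _ 1%g [set q' | q' \in Q /\ E (q^-1 * q')%g]); exists q'.
have iterE n m q : E ((iter n f q)^-1 * iter (n + m.+1) f q)%g.
  elim: m => [|m IH]; first by rewrite addn1 iterS; have [] := fP (iter n f q).
  rewrite addnS iterS; have [_] := fP (iter (n + m.+1) f q).
  by move=> /(EM _ _ IH); rewrite -mulgA mulVKg.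
have [q0 _ _] := EQ 1%g.
have : ~~ uniq [seq iter n.+1 f q0 | n <- iota 0 (size Q).+1].
  apply/negP => U; have := uniq_leq_size (s2 := Q) U.
  rewrite size_map size_iota ltnn; suff sub : forall x,
    x \in [seq iter n.+1 f q0 | n <- iota 0 (size Q).+1] -> x \in Q by move=> /(_ sub).
  by move=> x /mapP[n _ ->]; have [] := fP (iter n f q0).
move=> /(uniqPn 1%g)[i [j [ij]]]; rewrite size_map size_iota => jn.
rewrite !(nth_map 0%N) ?size_iota ?(ltn_trans ij)// !nth_iota ?(ltn_trans ij)//.
rewrite !add0n => ijE; have := iterE i.+1 (j - i.+1)%N q0.
by rewrite addnS subnKC// -ijE mulVg.
Qed.

Lemma cocompact_semigroup_inv (E : set G) (Q : seq G) :
  (forall x y, E x -> E y -> E (x * y)%g) ->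
  (forall g, exists2 q, q \in Q & E (g * q)%g) -> forall x, E x -> E x^-1%g.
Proof.
move=> EM EQ x Ex.
have := @cocompact_semigroup_id [set y | E (x^-1 * y)%g] Q; rewrite /= mulg1.
apply=> [y z Ey Ez|g].
  have := EM _ _ (EM _ _ Ey Ex) Ez; by rewrite -!mulgA mulVKg.
by have [q qQ] := EQ (x^-1 * g)%g; exists q => //; rewrite /= mulgA.
Qed.

End Semigroups.

Section FiniteIndex.
Context {R : realType} {G : groupType}.

(* E has finite index, so that the sum F of the translates of xi by coset
   representatives is moved by some generator; as generators permute the
   cosets, xi is moved by one of finitely many elements of E. *)
Lemma expanding_semigroup (H : set G) (gs : seq G) (d : R) (E : set G)
    (Q : seq G) : 0 < d -> expanding H gs d ->
  (forall x y, E x -> E y -> E (x * y)%g) ->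
  (forall g, exists2 q, q \in Q & E (g * q)%g) ->
  exists2 c : R, 0 < c & exists2 L : seq G, (forall e, e \in L -> E e) &
    forall xi : set G -> R, vec H xi -> exists2 e, e \in L &
      c * nsq xi <= nsq (fun v => trans e xi v - xi v).
Proof.
move=> d0 exp EM EQ.
have EV := cocompact_semigroup_inv EM EQ.
pose rep g := nth 1%g [seq q^-1%g | q <- Q]
   (find (fun r => `[< E (g * r^-1)%g >]) [seq q^-1%g | q <- Q]).
have has_rep g : has (fun r => `[< E (g * r^-1)%g >]) [seq q^-1%g | q <- Q].
  have [q qQ Eq] := EQ g; apply/hasP; exists (q^-1)%g; first exact: map_f.
  by apply/asboolP; rewrite invgK.
have repE g : E (g * (rep g)^-1)%g.
  by apply/asboolP; exact: (nth_find 1%g (has_rep g)).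
have rep_eq g h : E (g * h^-1)%g -> rep g = rep h.
  move=> Egh; rewrite /rep; congr nth; apply: eq_find => r; apply/asboolP/asboolP.
    by move=> /(EM _ _ (EV _ Egh)); rewrite invgM invgK -mulgA mulKg.
  by move=> /(EM _ _ Egh); rewrite -mulgA mulKg.
pose r := undup [seq rep q^-1%g | q <- Q].
have rep_r g : rep g \in r.
  rewrite mem_undup; apply/mapP; exists (rep g)^-1%g; last first.
    by rewrite invgK; apply: rep_eq; exact: repE.
  have : rep g \in [seq q^-1%g | q <- Q] by rewrite mem_nth// -has_find.
  by move=> /mapP[q qQ ->]; rewrite invgK.
have repK x : x \in r -> rep x = x.
  rewrite mem_undup => /mapP[q _ ->]; apply: rep_eq.
  by rewrite -[X in E X]invgK; apply: EV; rewrite invgM invgK; exact: repE.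
have inj h : {in r &, injective (fun x => rep (x * h)%g)}.
  move=> x y xr yr /= repxy; rewrite -(repK x)// -(repK y)//; apply: rep_eq.
  have := EM _ _ (repE (x * h)%g) (EV _ (repE (y * h)%g)).
  by rewrite repxy invgM invgK mulgA mulgVK invgM mulgA mulgK.
have permr h : perm_eq [seq rep (x * h)%g | x <- r] r.
  have U : uniq [seq rep (x * h)%g | x <- r] by rewrite map_inj_in_uniq ?undup_uniq//; exact: inj.
  apply: uniq_perm => //; first exact: undup_uniq.
  have sub : {subset [seq rep (x * h)%g | x <- r] <= r} by move=> _ /mapP[x _ ->].
  by have [] := uniq_min_size U sub; rewrite ?size_map.
have [c c0 lap] := expanding_laplacian d0 exp.
pose e h x := (x * h * (rep (x * h))^-1)%g.
pose m : R := (size r)%:R.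
have m0 : 0 < m.
  by rewrite ltr0n -has_predT; apply/hasP; exists (rep 1%g).
pose k : R := (size gs).+1%:R; have k0 : 0 < k by rewrite ltr0n.
exists (c / (k * m ^+ 2)); first by rewrite divr_gt0// mulr_gt0// exprn_gt0.
exists [seq e h x | h <- gs, x <- r].
  by move=> _ /allpairsP[[h x] [_ _ ->]]; exact: repE.
move=> xi vxi; have [fxi xi0 xiV] := vxi.
apply: contrapT => nex.
have small h x : h \in gs -> x \in r ->
    nsq (fun v => trans (e h x) xi v - xi v) < c / (k * m ^+ 2) * nsq xi.
  move=> hgs xr; rewrite ltNge; apply/negP => le; apply: nex.
  by exists (e h x) => //; apply/allpairsP; exists (h, x).
pose F v := \sum_(x <- r) trans x xi v.
have vF : vec H F by apply: vec_sum => x; exact: vec_trans.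
have NF : nsq xi <= nsq F.
  rewrite -(nsq_trans (rep 1%g) xi); apply: le_nsq => [||v].
  - exact: fsupp_trans.
  - by case: vF.
  rewrite /trans xi0 /F (big_rem (rep 1%g))//= lerDl sumr_ge0// => x _; exact: xi0.
have [h0 h0gs] : exists h, h \in gs.
  apply: contrapT => ngs.
  have K0 : [fset right_coset H 1%g]%fset != fset0.
    by apply/fset0Pn; exists (right_coset H 1%g); rewrite inE.
  have := exp _ K0; rewrite leNgt => /(_ _)/negP; apply.
    by move=> v; rewrite inE => /eqP ->; exists 1%g.
  rewrite cardfs1 mulr1 (_ : [fset v in _ | _]%fset = fset0) ?cardfs0//.
  apply/eqP; rewrite -fsubset0; apply/fsubsetP => v; rewrite !inE /= => /andP[_].
  by move=> /hasP[h hgs _]; case: ngs; exists h.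
have N0 : 0 < nsq xi.
  rewrite lt_neqAle nsq_ge0 andbT; apply/eqP => N0.
  by have := small h0 (rep 1%g) h0gs (rep_r _); rewrite -N0 mulr0 ltNge nsq_ge0.
have := lap F vF; apply/negP; rewrite -ltNge.
have dF h : h \in gs -> nsq (fun v => trans h F v - F v) <= c / k * nsq xi.
  move=> hgs.
  have -> : (fun v => trans h F v - F v) =
     fun v => \sum_(x <- r) trans (rep (x * h)%g) (fun w => trans (e h x) xi w - xi w) v.
    apply/funext => v.
    rewrite [X in _ - X](_ : _ = \sum_(x <- r) trans (rep (x * h)%g) xi v); last first.
      by rewrite /F -(perm_big _ (permr h))/= big_map.
    rewrite /trans /F -sumrB; apply: eq_bigr => x _; congr (_ - _).
    have /(congr1 (@^~ v)) := transM h x xi; rewrite /trans => ->.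
    have /(congr1 (@^~ v)) := transM (rep (x * h)%g) (e h x) xi; rewrite /trans => ->.
    by rewrite /e mulgVK.
  have ff x : fsupp (trans (rep (x * h)%g) (fun w => trans (e h x) xi w - xi w)).
    by apply/fsupp_trans/fsuppB => //; exact: fsupp_trans.
  apply: (le_trans (nsq_sum_le ff (undup_uniq _))).
  apply: (@le_trans _ _ (m * \sum_(x <- r) c / (k * m ^+ 2) * nsq xi)).
    apply: ler_wpM2l; first exact: ltW.
    rewrite big_seq [leRHS]big_seq; apply: ler_sum => x xr.
    by rewrite nsq_trans ltW// small.
  rewrite sum_const_seq -/m le_eqVlt; apply/orP; left; apply/eqP.
  by field; rewrite !gt_eqF.
apply: (@le_lt_trans _ _ (\sum_(h <- gs) c / k * nsq xi)).
  by rewrite big_seq [leRHS]big_seq; apply: ler_sum => h; exact: dF.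
rewrite sum_const_seq; apply: (@lt_le_trans _ _ (c * nsq xi)).
  rewrite mulrA ltr_pM2r// mulrCA gtr_pMr// ltr_pdivrMr ?mul1r ?ltr_nat//.
by rewrite ler_pM2l.
Qed.

End FiniteIndex.

(** * Charges with log-Lipschitz density *)

Section Charges.
Context {R : realType} {d : measure_display} {X : measurableType d}.
Variable m : probability X R.
Implicit Types (p q : set X -> R) (A B C N : set X).

Definition charge_on_measurable p :=
  (forall A, measurable A -> 0 <= p A) /\
  (forall A B, measurable A -> measurable B -> A `&` B = set0 ->
     p (A `|` B) = p A + p B).

Definition pr A : R := fine (m A).

Lemma prE A : measurable A -> m A = (pr A)%:E.
Proof. by move=> mA; rewrite /pr fineK// fin_num_measure. Qed.

Lemma pr_charge : charge_on_measurable pr.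
Proof.
split=> [A mA|A B mA mB AB]; first by rewrite /pr fine_ge0.
by rewrite /pr measureU// fineD// fin_num_measure.
Qed.

Lemma prT : pr setT = 1.
Proof. by rewrite /pr probability_setT. Qed.

Lemma pr_le1 A : measurable A -> pr A <= 1.
Proof. by move=> mA; rewrite -lee_fin -prE// probability_le1. Qed.

Section OneCharge.
Variable p : set X -> R.
Hypothesis chp : charge_on_measurable p.

Lemma charge_set0 : p set0 = 0.
Proof.
have := chp.2 _ _ measurable0 measurable0 (setI0 _); rewrite setU0 => /eqP.
by rewrite -subr_eq subrr eq_sym => /eqP.
Qed.

Lemma charge_setID A B : measurable A -> measurable B -> p A = p (A `&` B) + p (A `\` B).
Proof.
move=> mA mB; rewrite -chp.2 ?setUIDK//; [exact: measurableI|exact: measurableD|].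
by rewrite setDE setIACA setICr setI0.
Qed.

Lemma le_charge A B : measurable A -> measurable B -> A `<=` B -> p A <= p B.
Proof.
move=> mA mB AB; rewrite (charge_setID mB mA) (setIidr AB) lerDl chp.1//.
exact: measurableD.
Qed.

Lemma charge_le_sum (I : eqType) (s : seq I) (B : I -> set X) A C :
  measurable A -> measurable C -> (forall i, i \in s -> measurable (B i)) ->
  (forall x, A x -> (exists2 i, i \in s & B i x) \/ C x) ->
  p A <= \sum_(i <- s) p (A `&` B i) + p C.
Proof.
elim: s A => [|i s IH] A mA mC mB cov.
  rewrite big_nil add0r; apply: le_charge => // x /cov[[i]|//].
  by rewrite in_nil.
have mBi : measurable (B i) by apply: mB; rewrite mem_head.
have mBs j : j \in s -> measurable (B j) by move=> js; apply: mB; rewrite inE js orbT.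
rewrite big_cons (charge_setID mA mBi) -addrA lerD2l.
apply: le_trans (IH _ (measurableD mA mBi) mC mBs _) _.
  move=> x [Ax nBi]; have [[j]|] := cov x Ax; last by right.
  by rewrite inE => /predU1P[->//|js Bj]; left; exists j.
rewrite lerD2r [leLHS]big_seq [leRHS]big_seq; apply: ler_sum => j js.
apply: le_charge; [apply: measurableI => //; [exact: measurableD|exact: mBs]| |].
  by apply: measurableI => //; exact: mBs.
by move=> x [[]].
Qed.

Lemma charge_sum_le (I : eqType) (s : seq I) (B : I -> set X) A :
  measurable A -> (forall i, i \in s -> measurable (B i)) -> uniq s ->
  (forall i j, i \in s -> j \in s -> i != j -> B i `&` B j = set0) ->
  \sum_(i <- s) p (A `&` B i) <= p A.
Proof.
elim: s A => [|i s IH] A mA mB us dB; first by rewrite big_nil chp.1.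
have mBi : measurable (B i) by apply: mB; rewrite mem_head.
have mBs j : j \in s -> measurable (B j) by move=> js; apply: mB; rewrite inE js orbT.
move: us => /= /andP[nis us].
rewrite big_cons (charge_setID mA mBi) lerD2l.
apply: le_trans (IH _ (measurableD mA mBi) mBs us _); last first.
  by move=> j k js ks; apply: dB; rewrite inE ?js ?ks orbT.
rewrite [leLHS]big_seq [leRHS]big_seq; apply: ler_sum => j js.
suff -> : A `&` B j = (A `\` B i) `&` B j by [].
apply/seteqP; split=> [x [Ax Bj]|x [[]]//]; split=> //; split=> // Bi.
have ij : i != j by apply: contraNneq nis => ->.
have := dB i j (mem_head _ _) _ ij; rewrite inE js orbT => /(_ isT) /seteqP[/(_ x)].
by move=> /(_ (conj Bi Bj)).
Qed.

End OneCharge.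

Definition push_charge (s : X -> X) (Z : set X) p A := p (Z `&` s @^-1` A).

Lemma push_charge_charge (s : X -> X) Z p : measurable_fun setT s -> measurable Z ->
  charge_on_measurable p -> charge_on_measurable (push_charge s Z p).
Proof.
move=> ms mZ chp; have mpre A : measurable A -> measurable (Z `&` s @^-1` A).
  by move=> mA; apply: measurableI => //; rewrite -[X in measurable X]setTI; exact: ms.
split=> [A mA|A B mA mB AB]; first exact/chp.1/mpre.
rewrite /push_charge preimage_setU setIUr chp.2//; [exact: mpre|exact: mpre|].
by rewrite setIACA -preimage_setI AB preimage_set0 setI0.
Qed.

Variables (Y : Type) (it : X -> nat -> Y) (r : R).
Hypothesis r01 : 0 < r < 1.

Definition agree n A B := forall x y i, A x -> B y -> (i < n)%N -> it x i = it y i.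

(* The density of p with respect to m is log-Lipschitz with constant c. *)
Definition regular c p := charge_on_measurable p /\
  forall n A B, measurable A -> measurable B -> agree n A B ->
    p A * pr B <= expR (c * r ^+ n) * (p B * pr A).

Lemma agree0 A B : agree 0 A B. Proof. by []. Qed.

Lemma regularW c c' p : c <= c' -> regular c p -> regular c' p.
Proof.
move=> cc' [chp reg]; split=> // n A B mA mB agr.
apply: le_trans (reg n A B mA mB agr) _; rewrite ler_wpM2r//.
  by rewrite mulr_ge0// ?chp.1// pr_charge.1.
by rewrite ler_expR ler_wpM2r// exprn_ge0// ltW//; case/andP: r01.
Qed.

Lemma pr_regular c : 0 <= c -> regular c pr.
Proof.
move=> c0; split=> [|n A B mA mB _]; first exact: pr_charge.
rewrite mulrC ler_peMl ?mulr_ge0 ?pr_charge.1// -expR0 ler_expR mulr_ge0//.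
by rewrite exprn_ge0// ltW//; case/andP: r01.
Qed.

Lemma regular_ub c p A : regular c p -> measurable A ->
  p A <= expR c * p setT * pr A.
Proof.
move=> [chp reg] mA; have := reg 0 A setT mA measurableT (@agree0 _ _).
by rewrite prT mulr1 expr0 mulr1 mulrA.
Qed.

Lemma regular_lb c p A : regular c p -> measurable A ->
  expR (- c) * p setT * pr A <= p A.
Proof.
move=> [chp reg] mA; have := reg 0 setT A measurableT mA (@agree0 _ _).
by rewrite prT mulr1 expr0 mulr1 -mulrA expRN ler_pdivrMl ?expR_gt0.
Qed.

Lemma regular_null c p A : regular c p -> measurable A -> m A = 0%E -> p A = 0.
Proof.
move=> rp mA A0; have := regular_ub rp mA; rewrite /pr A0 mulr0 => pA.
by apply/eqP; rewrite eq_le pA rp.1.1.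
Qed.

Definition split_weight (c c' : R) := (c' - c) / (c' * expR c' * expR c).

Lemma split_weight_gt0 c c' : 0 <= c -> c < c' -> 0 < split_weight c c'.
Proof.
move=> c0 cc'; rewrite divr_gt0 ?subr_gt0// !mulr_gt0 ?expR_gt0//.
exact: le_lt_trans cc'.
Qed.

Lemma split_weight_le c c' : 0 <= c -> c < c' -> split_weight c c' <= expR (- c).
Proof.
move=> c0 cc'; have c'0 : 0 < c' by exact: le_lt_trans cc'.
rewrite /split_weight expRN invfM mulrA ler_piMl ?invr_ge0 ?expR_ge0//.
rewrite ler_pdivrMr ?mul1r ?mulr_gt0 ?expR_gt0//.
have : 1 <= expR c' by rewrite -expR0 ler_expR ltW.
nra.
Qed.

(* Removing a small multiple of m from q only costs the gap between c and c'. *)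
Lemma regular_split c c' q : 0 <= c -> c < c' -> regular c q ->
  regular c' (fun A => q A - split_weight c c' * q setT * pr A).
Proof.
move=> c0 cc' rq; have c'0 : 0 < c' by exact: le_lt_trans cc'.
have [chq reg] := rq; set e := split_weight c c'.
have e0 : 0 < e by exact: split_weight_gt0.
have qT0 : 0 <= q setT by apply: chq.1.
split; first split=> [A mA|A B mA mB AB].
- rewrite subr_ge0; apply: le_trans (regular_lb rq mA).
  by rewrite !ler_wpM2r ?pr_charge.1 ?split_weight_le.
- by rewrite chq.2// pr_charge.2//; ring.
move=> n A B mA mB agr; set s := r ^+ n.
have s01 : 0 <= s <= 1.
  have /andP[r0 r1] := r01.
  by rewrite exprn_ge0 ?exprn_ile1// ltW.
have [s0 s1] := andP s01.
have mA0 : 0 <= pr A by apply: pr_charge.1.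
have mB0 : 0 <= pr B by apply: pr_charge.1.
have qB := regular_lb rq mB.
have main : e * (expR (c' * s) - 1) <= (expR (c' * s) - expR (c * s)) * expR (- c).
  have up : expR (c' * s) - 1 <= c' * s * expR c'.
    have := expR_ge1Dx (- (c' * s)); rewrite expRN => h.
    have E0 := expR_gt0 (c' * s).
    have : expR (c' * s) * (1 + - (c' * s)) <= 1 by rewrite -ler_pdivlMl// mulr1.
    have : expR (c' * s) <= expR c' by rewrite ler_expR ler_piMr// ltW.
    have : 0 <= c' * s by rewrite mulr_ge0// ltW.
    nra.
  have low : (c' - c) * s <= expR (c' * s) - expR (c * s).
    have -> : expR (c' * s) = expR (c * s) * expR ((c' - c) * s).
      by rewrite -expRD; congr expR; ring.
    have := expR_ge1Dx ((c' - c) * s).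
    have : 1 <= expR (c * s) by rewrite -expR0 ler_expR mulr_ge0.
    have : 0 <= (c' - c) * s by rewrite mulr_ge0// subr_ge0 ltW.
    nra.
  apply: (@le_trans _ _ (e * (c' * s * expR c'))); first by rewrite ler_pM2l.
  have -> : e * (c' * s * expR c') = (c' - c) * s * expR (- c).
    by rewrite /e /split_weight expRN; field; rewrite !gt_eqF ?expR_gt0.
  by rewrite ler_wpM2r ?expR_ge0.
have regAB := reg n A B mA mB agr; rewrite -/s in regAB.
have := ler_wpM2r (mulr_ge0 (mulr_ge0 qT0 mB0) mA0) main.
have : 0 <= (expR (c' * s) - expR (c * s)) * pr A * (q B - expR (- c) * q setT * pr B).
  rewrite !mulr_ge0 ?subr_ge0// ler_expR ler_wpM2r// ltW//.
nra.
Qed.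

End Charges.

Section OneStep.
Context {R : realType} {d : measure_display} {X : measurableType d}.
Context {G : groupType} {W : choiceType} {Y : Type}.
Variables (m : probability X R) (H : set G) (o : set G).
Variables (it : X -> nat -> Y) (r c1 c2 : R).
Variables (letters : seq (set X)) (J : set W) (Z : W -> set X) (fw : W -> set X).
Variables (s : X -> X) (kappa : X -> G) (gw : W -> set X -> G).
Hypothesis r01 : 0 < r < 1.
Hypothesis c10 : 0 <= c1.
Hypothesis c12 : c1 < c2.
Hypothesis uletters : uniq letters.
Hypothesis mletters : forall a, a \in letters -> measurable a.
Hypothesis dletters : forall a b, a \in letters -> b \in letters -> a != b ->
  a `&` b = set0.
Hypothesis cletters : exists2 N, measurable N /\ m N = 0%E &
  forall x, (exists2 a, a \in letters & a x) \/ N x.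
Hypothesis mZ : forall w, J w -> measurable (Z w).
Hypothesis dZ : forall w w', J w -> J w' -> w != w' -> Z w `&` Z w' = set0.
Hypothesis fwP : forall w, J w -> fw w \in letters /\ Z w `<=` fw w.
Hypothesis ms : measurable_fun setT s.
Hypothesis pushJ : forall p w, J w -> regular m it r c2 p ->
  regular m it r c1 (push_charge s (Z w) p).
Hypothesis gwP : forall w b, J w -> b \in letters ->
  exists2 N, measurable N /\ m N = 0%E &
    forall x, Z w x -> b (s x) -> kappa x = gw w b \/ N x.
Hypothesis approx : forall (W1 : seq W) (e : R), (forall w, w \in W1 -> J w) -> 0 < e ->
  exists W0 : seq W, [/\ uniq W0, forall w, w \in W0 -> J w, {subset W1 <= W0} &
    exists2 C, measurable C /\ pr m C < e &
    forall x, (exists2 w, w \in W0 & Z w x) \/ C x].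

Definition hits (K : X -> G) v := [set x | rtranslate v (K x) = o].

Definition norm_bound S (K : X -> G) := forall p a xi x,
  regular m it r c2 p -> a \in letters -> vec H xi -> 0 <= x -> nsq xi <= x ^+ 2 ->
  fsum (fun v => xi v * p (a `&` hits K v)) <= S * p a * x.

Lemma norm_bound1 K : (forall v, measurable (hits K v)) -> norm_bound 1 K.
Proof.
move=> mK p a xi x rp aL [fxi xi0 _] x0 xix.
have [D D0] := (fsuppP xi).1 fxi.
rewrite (fsumE (K := D)); last by move=> v /D0 ->; rewrite mul0r.
have ma := mletters aL.
apply: (@le_trans _ _ (\sum_(v <- D) x * p (a `&` hits K v))).
  apply: ler_sum => v _; apply: ler_wpM2r; first by apply: rp.1.1; exact: measurableI.
  rewrite -ler_sqr ?nnegrE//; apply: le_trans xix.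
  by apply: (ler_fsum1 v (fsupp_sqr fxi)) => w; exact: sqr_ge0.
rewrite -mulr_sumr mul1r mulrC ler_wpM2r//.
apply: charge_sum_le => //; first exact: rp.1.
move=> v w vD wD vw; apply/seteqP; split=> // y [/= yv yw]; move/eqP: vw; apply.
by rewrite -[v](rtranslateK _ (K y)) yv -yw rtranslateK.
Qed.

Variables (dl c0 : R) (b0 : set X).
Hypothesis dl01 : 0 < dl <= 1.
Hypothesis c00 : 0 < c0.
Hypothesis b0L : b0 \in letters.
Hypothesis spread : forall a, a \in letters -> exists W1 : seq W,
  [/\ forall w, w \in W1 -> [/\ J w, fw w = a & c0 <= pr m (Z w)] &
   forall xi : set G -> R, vec H xi -> exists w1 w2, [/\ w1 \in W1, w2 \in W1 &
     dl * nsq xi <= nsq (fun v => trans (gw w1 b0) xi v - trans (gw w2 b0) xi v)]].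

Let eps := split_weight c1 c2.
Let c3 := Num.min 1 (expR (- c2) * c0).
Let eta := c3 ^+ 2 * dl / 2.

Definition contraction_rate := 1 - eps * eta * pr m b0.

Let c3_01 : 0 < c3 <= 1.
Proof. by rewrite lt_min ltr01 mulr_gt0 ?expR_gt0// ge_min lexx. Qed.

Let eta01 : 0 < eta <= 1.
Proof.
have /andP[a b] := c3_01; have /andP[e f] := dl01.
have : c3 ^+ 2 * dl <= 1.
  apply: mulr_ile1 => //; [exact/exprn_ge0/ltW|exact: ltW|].
  by apply: exprn_ile1 => //; exact: ltW.
have : 0 < c3 ^+ 2 * dl by rewrite mulr_gt0// exprn_gt0.
by rewrite /eta => *; apply/andP; split; lra.
Qed.

Let eps01 : 0 < eps <= 1.
Proof.
rewrite split_weight_gt0//=; apply: le_trans (split_weight_le c10 c12) _.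
by rewrite -expR0 ler_expR oppr_le0.
Qed.

Lemma contraction_rate01 : 0 < pr m b0 -> 0 <= contraction_rate < 1.
Proof.
move=> b0p; have /andP[e0 e1] := eps01; have /andP[n0 n1] := eta01.
have b1 : pr m b0 <= 1 by apply: pr_le1; exact: mletters.
have en : 0 < eps * eta <= 1.
  by rewrite mulr_gt0//= mulr_ile1// ltW.
case/andP: en => en0 en1; rewrite /contraction_rate; apply/andP; split.
  by rewrite subr_ge0 mulr_ile1// ltW.
by rewrite gtrBl mulr_gt0.
Qed.

Section Bound.
Variables (S : R) (K : X -> G).
Hypothesis S0 : 0 <= S.
Hypothesis mK : forall v, measurable (hits K v).
Let K' x := (kappa x * K (s x))%g.
Hypothesis mK' : forall v, measurable (hits K' v).
Hypothesis normK : norm_bound S K.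

Let mpre A : measurable A -> measurable (s @^-1` A).
Proof. by move=> mA; rewrite -[X in measurable X]setTI; exact: ms. Qed.

Let q p w A := push_charge s (Z w) p A - eps * p (Z w) * pr m A.

Let q_regular p w : J w -> regular m it r c2 p -> regular m it r c2 (q p w).
Proof.
move=> Jw rp; have := regular_split r01 c10 c12 (pushJ Jw rp).
by rewrite /q /push_charge preimage_setT setIT.
Qed.

Let piece p w b v : J w -> b \in letters -> regular m it r c2 p ->
  p (Z w `&` hits K' v `&` s @^-1` b) <=
  push_charge s (Z w) p (b `&` hits K (rtranslate v (gw w b))).
Proof.
move=> Jw bL rp; have [N [mN N0] NP] := gwP Jw bL.
have mb := mletters bL; have mZw := mZ Jw.
have mB : measurable (Z w `&` s @^-1` (b `&` hits K (rtranslate v (gw w b)))).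
  by apply: measurableI => //; apply/mpre/measurableI.
rewrite /push_charge -[leRHS]addr0 -(regular_null rp mN N0).
apply: le_trans (charge_le_sum rp.1 (s := [:: tt])
  (B := fun=> Z w `&` s @^-1` (b `&` hits K (rtranslate v (gw w b)))) _ mN _ _) _.
- by apply: measurableI; [exact: measurableI|exact: mpre].
- by [].
- move=> x [[Zx hx] bx]; have [kx|] := NP x Zx bx; last by right.
  left; exists tt; rewrite ?mem_head//; split=> //; split=> //.
  by rewrite /hits /= rtranslateM -kx.
rewrite big_seq1 lerD2r; apply: le_charge rp.1 _ _ _ _ _ => //.
by apply: measurableI => //; apply: measurableI; [exact: measurableI|exact: mpre].
Qed.

Let decompose p a W0 C v : regular m it r c2 p -> a \in letters ->
  (forall w, w \in W0 -> J w) -> measurable C ->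
  (forall x, (exists2 w, w \in W0 & Z w x) \/ C x) ->
  p (a `&` hits K' v) <= \sum_(w <- W0 | fw w == a) \sum_(b <- letters)
    push_charge s (Z w) p (b `&` hits K (rtranslate v (gw w b))) + p C.
Proof.
move=> rp aL W0J mC cov; have ma := mletters aL; have [N [mN N0] NP] := cletters.
have mA : measurable (a `&` hits K' v) by exact: measurableI.
apply: le_trans (charge_le_sum rp.1 (s := W0) (B := Z) mA mC _ _) _ => [w /W0J/mZ//|x _|].
  exact: cov.
rewrite lerD2r [leRHS]big_mkcond/= [leLHS]big_seq [leRHS]big_seq.
apply: ler_sum => w /W0J Jw; have [fL Zf] := fwP Jw; case: eqVneq => [fa|fa]; last first.
  suff -> : a `&` hits K' v `&` Z w = set0 by rewrite (charge_set0 rp.1).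
  apply/seteqP; split=> // x [[ax _] /Zf fx]; have := dletters fL aL fa.
  by move=> /seteqP[/(_ x)] /(_ (conj fx ax)).
apply: (@le_trans _ _ (p (Z w `&` hits K' v))).
  have mZw := mZ Jw; apply: le_charge rp.1 _ _ _ _ _; do ?exact: measurableI.
  by move=> x [[]].
have mZh : measurable (Z w `&` hits K' v) by apply: measurableI => //; exact: mZ.
have mZN : measurable (Z w `&` s @^-1` N) by apply: measurableI; [exact: mZ|exact: mpre].
apply: le_trans (charge_le_sum rp.1 (s := letters) (B := fun b => s @^-1` b) mZh mZN _ _) _.
- by move=> b /mletters /mpre.
- by move=> x [Zx _]; have [[b bL bx]|] := NP (s x); [left; exists b|right].
have -> : p (Z w `&` s @^-1` N) = 0 by exact: (regular_null (pushJ Jw rp) mN N0).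
rewrite addr0 [leLHS]big_seq [leRHS]big_seq; apply: ler_sum => b bL; exact: piece.
Qed.

Lemma norm_bound_step : 0 < pr m b0 -> norm_bound (contraction_rate * S) K'.
Proof.
move=> b0p p a xi x rp aL vxi x0 xix; have ma := mletters aL.
have [fxi xi0 _] := vxi; have chp := rp.1.
have pT0 : 0 <= p setT by apply: chp.1.
have /andP[e0 e1] := eps01; have /andP[n0 n1] := eta01.
have /andP[l0 l1] := contraction_rate01 b0p.
have sxi0 : 0 <= fsum xi by exact: fsum_ge0.
apply/ler_addgt0Pr => e e_gt0.
pose e' := e / (1 + fsum xi * (expR c2 * p setT)).
have den : 0 < 1 + fsum xi * (expR c2 * p setT).
  by rewrite ltr_pwDl// !mulr_ge0// expR_ge0.
have e'0 : 0 < e' by rewrite divr_gt0.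
have [W1 [W1P W1s]] := spread aL.
have [W0 [uW0 W0J W10 [C [mC Ce] cov]]] := approx (fun w wW1 => let: And3 h _ _ := W1P w wW1 in h) e'0.
pose V := [seq w <- W0 | fw w == a].
have VJ w : w \in V -> J w by rewrite mem_filter => /andP[_ /W0J].
have uV : uniq V by exact: filter_uniq.
pose P := \sum_(w <- V) p (Z w).
have pZ0 w : w \in V -> 0 <= p (Z w) by move=> /VJ/mZ; exact: chp.1.
have P0 : 0 <= P by rewrite /P big_seq sumr_ge0.
have Pa : P <= p a.
  apply: le_trans (charge_sum_le chp ma (B := Z) _ uV _); last 2 first.
  - by move=> w /VJ/mZ.
  - by move=> w w' /VJ Jw /VJ Jw'; exact: dZ.
  rewrite /P [leLHS]big_seq [leRHS]big_seq; apply: ler_sum => w wV.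
  rewrite setIidr//; have [_] := fwP (VJ w wV).
  by move: wV; rewrite mem_filter => /andP[/eqP ->].
pose T w b v := push_charge s (Z w) p (b `&` hits K (rtranslate v (gw w b))).
pose pw w := if w \in V then p (Z w) else 0.
have pwE w : w \in V -> pw w = p (Z w) by rewrite /pw => ->.
have pw0 w : 0 <= pw w by rewrite /pw; case: ifP => // /pZ0.
have PE : P = \sum_(w <- V) pw w.
  by rewrite /P [LHS]big_seq [RHS]big_seq; apply: eq_bigr => w /pwE.
pose xib b v := \sum_(w <- V) pw w * trans (gw w b) xi v.
have ftr g (F : set G -> R) : fsupp (fun v => trans g xi v * F v).
  by apply: fsuppW (fsupp_trans g fxi) => v ->; rewrite mul0r.
have fxT w b : fsupp (fun v => xi v * T w b v).
  by apply: fsuppW fxi => v ->; rewrite mul0r.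
have chm := pr_charge m.
have TE w b : w \in V -> b \in letters -> fsum (fun v => xi v * T w b v) <=
    eps * (p (Z w) * fsum (fun v => trans (gw w b) xi v * pr m (b `&` hits K v))) +
    S * q p w b * x.
  move=> wV bL; have Jw := VJ w wV.
  have -> : fsum (fun v => xi v * T w b v) =
     fsum (fun v => trans (gw w b) xi v * push_charge s (Z w) p (b `&` hits K v)).
    rewrite -[RHS](reindex_fsum (h := fun v => rtranslate v (gw w b))
      (h' := fun v => rtranslate v (gw w b)^-1%g)).
    - by apply: eq_fsum => v; rewrite /trans rtranslateK.
    - by move=> v; rewrite rtranslateK.
    - by move=> v; rewrite rtranslateVK.
  have -> : fsum (fun v => trans (gw w b) xi v * push_charge s (Z w) p (b `&` hits K v)) =
     fsum (fun v => eps * p (Z w) * (trans (gw w b) xi v * pr m (b `&` hits K v)) +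
       trans (gw w b) xi v * q p w (b `&` hits K v)).
    by apply: eq_fsum => v; rewrite /q; ring.
  rewrite fsumD//; last by apply: fsuppZ.
  rewrite fsumZ mulrA lerD2l; apply: normK => //.
  - exact: q_regular.
  - exact: vec_trans.
  - by rewrite nsq_trans.
have qsum w : w \in V -> \sum_(b <- letters) q p w b <= (1 - eps) * p (Z w).
  move=> wV; have rq := q_regular (VJ w wV) rp.
  apply: (@le_trans _ _ (q p w setT)).
    have -> : \sum_(b <- letters) q p w b = \sum_(b <- letters) q p w (setT `&` id b).
      by apply: eq_bigr => b _; rewrite setTI.
    exact: (charge_sum_le (B := id) rq.1 measurableT mletters uletters dletters).
  by rewrite /q /push_charge preimage_setT setIT prT le_eqVlt; apply/orP; left; apply/eqP; ring.
have vxib b : vec H (xib b) by apply: vec_sum => w; exact/vecZ/vec_trans.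
have [w1 [w2 [w1W w2W w12]]] := W1s xi vxi.
have W1V w : w \in W1 -> w \in V.
  by move=> wW1; have [_ fwa _] := W1P w wW1; rewrite mem_filter fwa eqxx W10.
have nx b w w' : w \in V -> w' \in V -> nsq (xib b) + pw w * pw w' *
    nsq (fun v => trans (gw w b) xi v - trans (gw w' b) xi v) <= P ^+ 2 * nsq xi.
  move=> wV w'V; apply: le_trans (nsq_wsum_le (F := fun w => trans (gw w b) xi)
    (fun w _ => pw0 w) (fun w => fsupp_trans _ fxi) uV wV w'V) _.
  under [in X in _ * X <= _]eq_bigr do rewrite nsq_trans.
  by rewrite -mulr_suml -PE mulrA.
have nxib b : nsq (xib b) <= (P * x) ^+ 2.
  have w1V := W1V _ w1W; have := nx b w1 w1 w1V w1V.
  have := mulr_ge0 (mulr_ge0 (pw0 w1) (pw0 w1))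
    (nsq_ge0 (fun v => trans (gw w1 b) xi v - trans (gw w1 b) xi v)).
  have := ler_wpM2l (sqr_ge0 P) xix; rewrite exprMn; lra.
have nxib0 : nsq (xib b0) <= (P * (1 - eta) * x) ^+ 2.
  have w1V := W1V _ w1W; have w2V := W1V _ w2W; have := nx b0 w1 w2 w1V w2V.
  have /andP[c30 c31] := c3_01; have /andP[d0 d1] := dl01.
  have low w : w \in W1 -> c3 * P <= pw w.
    move=> wW1; have [Jw _ c0w] := W1P w wW1; rewrite pwE ?W1V//.
    have pTP : P <= p setT by apply: le_trans Pa _; apply: le_charge.
    apply: le_trans (regular_lb rp (mZ Jw)); apply: (@le_trans _ _ (expR (- c2) * c0 * p setT)).
      by apply: ler_pM => //; [exact: ltW|rewrite ge_min lexx orbT].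
    rewrite mulrAC; apply: ler_wpM2l => //.
    by rewrite mulr_ge0// expR_ge0.
  have N0 := nsq_ge0 xi.
  have lowP : (c3 * P) ^+ 2 <= pw w1 * pw w2.
    by rewrite expr2; apply: ler_pM; rewrite ?low// mulr_ge0// ltW.
  have := ler_pM (sqr_ge0 _) (mulr_ge0 (ltW d0) N0) lowP w12.
  have -> : (c3 * P) ^+ 2 * (dl * nsq xi) = 2 * eta * (P ^+ 2 * nsq xi).
    by rewrite /eta; field.
  move=> A B; apply: (@le_trans _ _ ((1 - 2 * eta) * (P ^+ 2 * nsq xi))); first by lra.
  have Q0 : 0 <= P ^+ 2 * nsq xi by rewrite mulr_ge0// sqr_ge0.
  apply: (@le_trans _ _ ((1 - eta) ^+ 2 * (P ^+ 2 * nsq xi))).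
    by rewrite ler_wpM2r//; nra.
  have -> : (P * (1 - eta) * x) ^+ 2 = (1 - eta) ^+ 2 * (P ^+ 2 * x ^+ 2) by ring.
  by rewrite !ler_wpM2l ?sqr_ge0.
have mterm b : b \in letters -> fsum (fun v => xib b v * pr m (b `&` hits K v)) <=
    S * (pr m b * (1 - eta * (b == b0)%:R)) * (P * x).
  move=> bL; have pmr := pr_regular m it r01 (ltW (le_lt_trans c10 c12)).
  have [->|bb0] := eqVneq b b0.
    apply: le_trans (normK pmr b0L (vxib b0) _ nxib0) _.
      by rewrite !mulr_ge0// subr_ge0.
    by rewrite mulr1 le_eqVlt; apply/orP; left; apply/eqP; ring.
  apply: le_trans (normK pmr bL (vxib b) _ (nxib b)) _; first by rewrite mulr_ge0.
  by rewrite mulr0 subr0 mulr1.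
have fT : fsupp (fun v => \sum_(w <- V) \sum_(b <- letters) xi v * T w b v).
  by apply: fsupp_sum => w; apply: fsupp_sum.
have step1 : fsum (fun v => xi v * p (a `&` hits K' v)) <=
    \sum_(w <- V) \sum_(b <- letters) fsum (fun v => xi v * T w b v) + fsum xi * p C.
  rewrite (eq_bigr (fun w => fsum (fun v => \sum_(b <- letters) xi v * T w b v))); last first.
    by move=> w _; rewrite fsum_sum.
  rewrite -fsum_sum => [|w]; last exact: fsupp_sum.
  rewrite mulrC -fsumZ -fsumD//; last exact: fsuppZ.
  apply: ler_fsum => [||v].
  - by apply: fsuppW fxi => v ->; rewrite mul0r.
  - by apply: fsuppD => //; exact: fsuppZ.
  have -> : \sum_(w <- V) \sum_(b <- letters) xi v * T w b v + p C * xi v =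
     xi v * (\sum_(w <- V) \sum_(b <- letters) T w b v + p C).
    rewrite mulrDr mulr_sumr [p C * _]mulrC; congr (_ + _).
    by apply: eq_bigr => w _; rewrite mulr_sumr.
  by rewrite ler_wpM2l// /V big_filter; exact: decompose.
have step2 : \sum_(w <- V) \sum_(b <- letters) fsum (fun v => xi v * T w b v) <=
   eps * (\sum_(b <- letters) fsum (fun v => xib b v * pr m (b `&` hits K v))) +
   S * x * ((1 - eps) * P).
  apply: (@le_trans _ _ (\sum_(w <- V) (\sum_(b <- letters) eps * (p (Z w) *
     fsum (fun v => trans (gw w b) xi v * pr m (b `&` hits K v))) +
     S * x * ((1 - eps) * p (Z w))))).
    rewrite [leLHS]big_seq [leRHS]big_seq; apply: ler_sum => w wV.
    apply: (@le_trans _ _ (\sum_(b <- letters) (eps * (p (Z w) *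
       fsum (fun v => trans (gw w b) xi v * pr m (b `&` hits K v))) + S * q p w b * x))).
      rewrite [leLHS]big_seq [leRHS]big_seq; apply: ler_sum => b bL; exact: TE.
    rewrite big_split lerD2l /=; under eq_bigr do rewrite mulrAC.
    by rewrite -mulr_sumr ler_wpM2l ?mulr_ge0// qsum.
  rewrite big_split -!mulr_sumr lerD2r exchange_big mulr_sumr /= le_eqVlt; apply/orP; left.
  apply/eqP; apply: eq_bigr => b _; rewrite -mulr_sumr; congr (_ * _).
  rewrite (eq_fsum (g := fun v => \sum_(w <- V) pw w * (trans (gw w b) xi v * pr m (b `&` hits K v)))).
    rewrite fsum_sum; last by move=> w; exact: fsuppZ.
    rewrite [LHS]big_seq [RHS]big_seq; apply: eq_bigr => w wV.
    by rewrite fsumZ pwE.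
  by move=> v; rewrite /xib mulr_suml; apply: eq_bigr => w _; rewrite mulrA.
have step3 : \sum_(b <- letters) fsum (fun v => xib b v * pr m (b `&` hits K v)) <=
    S * (P * x) * (1 - eta * pr m b0).
  apply: (@le_trans _ _ (\sum_(b <- letters) S * (pr m b * (1 - eta * (b == b0)%:R)) * (P * x))).
    rewrite [leLHS]big_seq [leRHS]big_seq; apply: ler_sum => b; exact: mterm.
  rewrite -mulr_suml -mulr_sumr [leRHS]mulrAC ler_wpM2r ?mulr_ge0// ler_wpM2l//.
  have -> : \sum_(b <- letters) pr m b * (1 - eta * (b == b0)%:R) =
     \sum_(b <- letters) pr m b - eta * pr m b0.
    have -> : eta * pr m b0 = \sum_(b <- letters) eta * pr m b * (b == b0)%:R.
      rewrite (bigD1_seq b0)//= eqxx mulr1 big1 ?addr0// => b /negPf ->.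
      by rewrite mulr0.
    by rewrite -sumrB; apply: eq_bigr => b _; ring.
  rewrite lerD2r -(prT m).
  have -> : \sum_(b <- letters) pr m b = \sum_(b <- letters) pr m (setT `&` id b).
    by apply: eq_bigr => b _; rewrite setTI.
  exact: (charge_sum_le (B := id) chm measurableT mletters uletters dletters).
have step4 : fsum xi * p C <= e.
  have pC := regular_ub rp mC; have pC0 : 0 <= pr m C by exact: chm.1.
  apply: (@le_trans _ _ (fsum xi * (expR c2 * p setT * e'))).
    rewrite ler_wpM2l//; apply: le_trans pC _.
    by apply: ler_wpM2l; [apply: mulr_ge0 => //; exact: expR_ge0|exact: ltW].
  rewrite /e'; set Q := fsum xi * _ in den *.
  have -> : fsum xi * (expR c2 * p setT * (e / (1 + Q))) = e * (Q / (1 + Q)).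
    by rewrite /Q; ring.
  by rewrite -[leRHS]mulr1 ler_pM2l// ler_pdivrMr// mul1r lerDr.
have Px : 0 <= S * (P * x) by rewrite !mulr_ge0.
have lamS : contraction_rate * S * P * x <= contraction_rate * S * p a * x.
  by apply: ler_wpM2r => //; apply: ler_wpM2l => //; exact: mulr_ge0.
apply: (le_trans step1); apply: (le_trans (lerD step2 step4)); rewrite lerD2r.
apply: le_trans lamS; apply: (@le_trans _ _
  (eps * (S * (P * x) * (1 - eta * pr m b0)) + S * x * ((1 - eps) * P))).
  by rewrite lerD2r; apply: ler_wpM2l => //; exact: ltW.
rewrite le_eqVlt; apply/orP; left; apply/eqP.
by rewrite /contraction_rate -/eps -/eta; ring.
Qed.

End Bound.
End OneStep.

(** * Markov maps *)

Section CountableCovers.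
Context {R : realType} {d : measure_display} {X : measurableType d}.
Variable mu : probability X R.

Lemma countable_bigcup_nat (T : Type) (J : set T) (F : T -> set X) :
  countable J -> exists F' : nat -> set X,
    (forall n, F' n = set0 \/ exists2 j, J j & F' n = F j) /\
    \bigcup_(j in J) F j = \bigcup_n F' n.
Proof.
move=> /countable_injP[f finj].
exists (fun n => \bigcup_(j in J `&` f @^-1` [set n]) F j); split=> [n|]; last first.
  apply/seteqP; split=> [x [j Jj Fjx]|x [n _ [j [Jj _] Fjx]]]; last by exists j.
  by exists (f j) => //; exists j.
have [[j [Jj fj]]|nj] := pselect (exists j, J j /\ f j = n); last first.
  left; apply/seteqP; split=> // x [j [Jj fj] _]; apply: nj; by exists j.
right; exists j => //; apply/seteqP; split=> [x [k [Jk fk]]|x Fx]; last by exists j.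
by rewrite (finj k j) ?inE// fj.
Qed.

Lemma measurable_bigcup_countable (T : Type) (J : set T) (F : T -> set X) :
  countable J -> (forall j, J j -> measurable (F j)) ->
  measurable (\bigcup_(j in J) F j).
Proof.
move=> cJ mF; have [F' [F'P ->]] := countable_bigcup_nat F cJ.
apply: bigcup_measurable => n _; have [->|[j Jj ->]] := F'P n; last exact: mF.
exact: measurable0.
Qed.

Lemma negligible_bigcup_countable (T : Type) (J : set T) (F : T -> set X) :
  countable J -> (forall j, J j -> mu.-negligible (F j)) ->
  mu.-negligible (\bigcup_(j in J) F j).
Proof.
move=> cJ nF; have [F' [F'P ->]] := countable_bigcup_nat F cJ.
apply: negligible_bigcup => n; have [->|[j Jj ->]] := F'P n; last exact: nF.
exact: negligible_set0.
Qed.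

Lemma finite_subcover (T : choiceType) (J : set T) (F : T -> set X) (A N : set X)
    (W1 : seq T) (e : R) :
  countable J -> (forall j, J j -> measurable (F j)) -> mu.-negligible N ->
  measurable A -> (forall x, A x -> (exists2 j, J j & F j x) \/ N x) ->
  (forall j, j \in W1 -> J j) -> 0 < e ->
  exists W0 : seq T, [/\ uniq W0, forall w, w \in W0 -> J w, {subset W1 <= W0} &
    exists2 C, measurable C /\ pr mu C < e &
      forall x, A x -> (exists2 w, w \in W0 & F w x) \/ C x].
Proof.
move=> cJ mF nN mA cov W1J e0; have /countable_injP[f finj] := cJ.
pose Jn n := J `&` [set j | (f j < n)%N].
pose C n := A `\` \bigcup_(j in Jn n) F j.
have cJn n : countable (Jn n) by apply: sub_countable cJ; apply: subset_card_le => j [].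
have mC n : measurable (C n).
  by apply: measurableD => //; apply: measurable_bigcup_countable => // j [Jj _]; exact: mF.
have C0 : mu (\bigcap_n C n) = 0%E.
  apply/negligibleP; first exact: bigcap_measurable.
  apply: negligibleS nN => x Cx; have [[j Jj Fjx]|//] := cov x (Cx 0%N I).1.
  by case: (Cx (f j).+1 I) => _; case; exists j => //; split=> //=.
have ndC : nonincreasing_seq C.
  apply/nonincreasing_seqP => n; apply/subsetPset => x [Ax Cx]; split=> // -[j [Jj fj] Fjx].
  by apply: Cx; exists j => //; split=> //=; rewrite ltnS ltnW.
have cvC : mu (C n) @[n --> \oo] --> (0%R)%:E.
  have -> : (0%R)%:E = mu (\bigcap_n C n) by rewrite C0.
  apply: nonincreasing_cvg_mu => //.
  - by rewrite (le_lt_trans (probability_le1 _ _))// ltry.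
  - exact: bigcap_measurable.
have [n Cn] : exists n, pr mu (C n) < e.
  have /fine_cvg/cvgrPdist_lt /(_ e e0) [n _ /(_ n (leqnn n))] := cvC.
  rewrite /= sub0r normrN ger0_norm; first by exists n.
  by rewrite fine_ge0.
have fJn k : finite_set (Jn k).
  elim: k => [|k IH]; first by apply: sub_finite_set (finite_set0 _) => j [_] /=; rewrite ltn0.
  have [[i [Ji fi]]|ni] := pselect (exists i, J i /\ f i = k).
    have fin : finite_set (Jn k `|` [set i]) by rewrite finite_setU; split.
    apply: sub_finite_set fin => j [Jj /=]; rewrite ltnS leq_eqVlt.
    case/predU1P => [fj|]; last by left.
    by right; apply: finj; rewrite ?inE// fj.
  apply: sub_finite_set IH => j [Jj /=]; rewrite ltnS leq_eqVlt.
  by case/predU1P => [fj|//]; case: ni; exists j.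
exists (undup (W1 ++ fset_set (Jn n))); split.
- exact: undup_uniq.
- move=> w; rewrite mem_undup mem_cat => /orP[/W1J //|].
  by rewrite in_fset_set// inE => -[].
- by move=> w wW1; rewrite mem_undup mem_cat wW1.
exists (C n) => // x Ax; have [|nx] := pselect ((\bigcup_(j in Jn n) F j) x); last by right.
case=> j Jnj Fjx; left; exists j => //; rewrite mem_undup mem_cat in_fset_set//.
by rewrite mem_set ?orbT.
Qed.

Lemma le_pr_pieces (T : choiceType) (J : set T) (F : T -> set X) (N A B : set X) (K : R) :
  countable J -> (forall j, J j -> measurable (F j)) -> mu.-negligible N ->
  trivIset J F ->
  (forall x, A x -> (exists2 j, J j & F j x) \/ N x) ->
  measurable A -> measurable B -> 0 <= K ->
  (forall j, J j -> pr mu (A `&` F j) <= K * pr mu (B `&` F j)) ->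
  pr mu A <= K * pr mu B.
Proof.
move=> cJ mF nN tF cov mA mB K0 le; apply/ler_addgt0Pr => e e0.
have [W0 [uW0 W0J _ [C [mC Ce] cov0]]] :=
  finite_subcover (W1 := [::]) cJ mF nN mA cov (fun j h => False_ind _ (notF h)) e0.
have ch := pr_charge mu.
have mW w : w \in W0 -> measurable (F w) by move=> /W0J/mF.
apply: le_trans (charge_le_sum ch mA mC mW cov0) _.
apply: lerD; last exact: ltW.
apply: (@le_trans _ _ (K * \sum_(w <- W0) pr mu (B `&` F w))).
  rewrite mulr_sumr [leLHS]big_seq [leRHS]big_seq; apply: ler_sum => w /W0J; exact: le.
apply: ler_wpM2l => //; apply: charge_sum_le => // i j /W0J Ji /W0J Jj ij.
apply/seteqP; split=> // x [Fi Fj]; move/eqP: ij; apply.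
by apply: tF => //; exists x.
Qed.

End CountableCovers.

Section MarkovMap.
Context {R : realType} {d : measure_display} {X : measurableType d}.
Variables (mu : probability X R) (theta : X -> X) (alpha : set (set X)).
Hypothesis MM : markov_map mu theta alpha.
Hypothesis IM : invariant_measure mu theta.

Let countable_alpha : countable alpha.
Proof. by have [_ [_ [cnt _ _] _ _ _]] := MM. Qed.

Lemma alpha_pos a : alpha a -> (0 < mu a)%E.
Proof. by have [_ [_ [_ h _] _ _ _]] := MM; exact: h. Qed.

Lemma alpha_measurable a : alpha a -> measurable a.
Proof. by have [_ [_ [_ _ [h _ _]] _ _ _]] := MM; move=> /h[]. Qed.

Lemma alpha_eq a b x : alpha a -> alpha b -> a x -> b x -> a = b.
Proof.
have [[_ tr _] _] := MM => aa ab ax bx.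
by apply: tr => //; exists x.
Qed.

Lemma alpha_cover x : exists2 a, alpha a & a x.
Proof.
have [[cov _ _] _] := MM; have : [set: X] x by [].
by rewrite -cov => -[a aa ax]; exists a.
Qed.

Let alpha_bigcup (A : set X) : A = \bigcup_(a in alpha) (a `&` A).
Proof.
apply/seteqP; split=> [x Ax|x [a _ []//]].
by have [a aa ax] := alpha_cover x; exists a.
Qed.

Lemma theta_measurable : measurable_fun setT theta.
Proof.
move=> _ A mA; rewrite setTI (alpha_bigcup (theta @^-1` A)).
apply: measurable_bigcup_countable => // a aa.
have [_ [_ _ ns _ _]] := MM; have [_ mf _ _] := ns a aa.
by apply: mf => //; exact: alpha_measurable.
Qed.

Lemma iter_measurable n : measurable_fun setT (iter n theta).
Proof.
elim: n => [|n IH]; first exact: measurable_id.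
by apply: (measurableT_comp theta_measurable IH).
Qed.

Lemma measurable_preimage_iter n A : measurable A -> measurable (iter n theta @^-1` A).
Proof. by move=> mA; rewrite -[X in measurable X]setTI; exact: iter_measurable. Qed.

Lemma measure_preimage_iter n A : measurable A -> mu (iter n theta @^-1` A) = mu A.
Proof.
elim: n A => [//|n IH] A mA; rewrite -(IM mA) -(IH (theta @^-1` A))//.
exact: (measurable_preimage_iter 1 mA).
Qed.

Lemma negligible_preimage_iter n N : mu.-negligible N ->
  mu.-negligible (iter n theta @^-1` N).
Proof.
move=> [A [mA A0 NA]]; exists (iter n theta @^-1` A); split.
- exact: measurable_preimage_iter.
- by rewrite measure_preimage_iter.
- by move=> x; exact: NA.
Qed.

Lemma image_iterS n A : iter n.+1 theta @` A = iter n theta @` (theta @` A).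
Proof.
by rewrite image_comp; apply: eq_imagel => x _ /=; rewrite -iterSr.
Qed.

Lemma measurable_image_iter n A : measurable A -> measurable (iter n theta @` A).
Proof.
elim: n A => [|n IH] A mA; first by rewrite image_id.
rewrite image_iterS; apply: IH; rewrite (alpha_bigcup A) image_bigcup.
apply: measurable_bigcup_countable => // a aa.
have [_ [_ _ ns _ _]] := MM; have [_ _ mi _] := ns a aa.
by apply: mi; [apply: measurableI => //; exact: alpha_measurable|move=> x []].
Qed.

Lemma negligible_image_iter n N : mu.-negligible N ->
  mu.-negligible (iter n theta @` N).
Proof.
elim: n N => [|n IH] N nN; first by rewrite image_id.
rewrite image_iterS; apply: IH; have [A [mA A0 NA]] := nN.
have sub : theta @` N `<=` theta @` A by move=> _ [x Nx <-]; exists x => //; exact: NA.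
apply: (negligibleS sub); rewrite (alpha_bigcup A) image_bigcup.
apply: negligible_bigcup_countable => // a aa.
have [_ [_ _ ns _ _]] := MM; have [_ _ mi nul] := ns a aa.
have maA : measurable (a `&` A) by apply: measurableI => //; exact: alpha_measurable.
have aAa : a `&` A `<=` a by move=> x [].
apply/negligibleP; first exact: mi.
apply/(nul _ maA aAa); apply: subset_measure0 A0 => //; by move=> x [].
Qed.

Lemma cylinder_rcons w c : cylinder theta (rcons w c) =
  cylinder theta w `&` iter (size w) theta @^-1` c.
Proof.
apply/seteqP; split=> [x wx|x [wx cx] k].
  split=> [k kw|]; last first.
    by have := wx (size w); rewrite size_rcons ltnSn nth_rcons ltnn eqxx; apply.
  by have := wx k; rewrite size_rcons ltnS ltnW// nth_rcons kw; apply.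
rewrite size_rcons ltnS leq_eqVlt nth_rcons => /predU1P[->|kw].
  by rewrite ltnn eqxx.
by rewrite kw; exact: wx.
Qed.

Lemma cylinder_nil : cylinder theta [::] = setT.
Proof. by apply/seteqP; split. Qed.

Lemma measurable_cylinder w : (forall a, a \in w -> alpha a) ->
  measurable (cylinder theta w).
Proof.
elim/last_ind: w => [_|w c IH wa]; first by rewrite cylinder_nil.
rewrite cylinder_rcons; apply: measurableI.
  by apply: IH => a aw; apply: wa; rewrite mem_rcons inE aw orbT.
apply: measurable_preimage_iter; apply: alpha_measurable; apply: wa.
by rewrite mem_rcons mem_head.
Qed.

Lemma image_cylinder_rcons w c :
  iter (size w).+1 theta @` cylinder theta (rcons w c) =
  theta @` (iter (size w) theta @` cylinder theta w `&` c).
Proof.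
rewrite cylinder_rcons; apply/seteqP; split=> [_ [x [wx cx] <-]|_ [_ [[x wx <-] cx] <-]].
  by exists (iter (size w) theta x) => //; split=> //; exists x.
by exists x.
Qed.

Lemma image_cylinder_dichotomy w b : (forall a, a \in w -> alpha a) -> alpha b ->
  mu.-negligible (b `&` iter (size w) theta @` cylinder theta w) \/
  mu.-negligible (b `\` iter (size w) theta @` cylinder theta w).
Proof.
elim/last_ind: w b => [|w c IH] b wa ab.
  right; rewrite cylinder_nil image_id setDT; exact: negligible_set0.
have ac : alpha c by apply: wa; rewrite mem_rcons mem_head.
have wa' a : a \in w -> alpha a by move=> aw; apply: wa; rewrite mem_rcons inE aw orbT.
rewrite size_rcons image_cylinder_rcons.
set E := iter (size w) theta @` cylinder theta w; have [nE|nE] := IH c wa' ac.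
  left; apply: negligibleS (negligible_image_iter 1 nE) => x [_ [y [Ey cy] <-]].
  by exists y.
have [_ [_ _ _ dich _]] := MM; have mc := alpha_measurable ac; have mb := alpha_measurable ab.
have mtc : measurable (theta @` c) by exact: (measurable_image_iter 1 mc).
have [n0|n0] := dich _ _ ab ac.
  left; exists (b `&` theta @` c); split; [exact: measurableI|exact: n0|].
  by move=> x [bx [y [Ey cy] yx]]; split=> //; exists y.
have nB : mu.-negligible (b `&` ~` (theta @` c)).
  exists (b `&` ~` (theta @` c)); split; [|exact: n0|by []].
  by apply: measurableI => //; exact: measurableC.
right; apply: negligibleS (negligibleU nB (negligible_image_iter 1 nE)).
move=> x [bx nx]; have [[y cy yx]|ntc] := pselect ((theta @` c) x); last by left; split.
by right; exists y => //; split=> // Ey; apply: nx; exists y.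
Qed.

Lemma cylinder_admissible w : (forall a, a \in w -> alpha a) ->
  ~ mu.-negligible (cylinder theta w) -> (0 < size w)%N ->
  admissible mu theta alpha (size w) w.
Proof.
move=> wa nw w0; split=> // i iw; apply: contrapT => np; apply: nw.
have ai : alpha (nth set0 w i) by apply: wa; rewrite mem_nth// ltnW.
have ai1 : alpha (nth set0 w i.+1) by apply: wa; rewrite mem_nth.
have [_ [_ _ _ dich _]] := MM.
have [n0|//] := dich _ _ ai1 ai.
have mi := alpha_measurable ai1.
have mti : measurable (theta @` nth set0 w i).
  exact: (measurable_image_iter 1 (alpha_measurable ai)).
have nn : mu.-negligible (nth set0 w i.+1 `&` theta @` nth set0 w i).
  by exists (nth set0 w i.+1 `&` theta @` nth set0 w i); split=> //; exact: measurableI.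
apply: negligibleS (negligible_preimage_iter i.+1 nn) => y wy; split.
  exact: (wy i.+1 iw).
by exists (iter i theta y) => //; exact: (wy i (ltnW iw)).
Qed.

End MarkovMap.

(** * The induced system *)

Lemma itinerary_dist_le (R : realType) (X : Type) (r : R) (theta : X -> X)
    (alpha : set (set X)) (x y : X) n : 0 < r < 1 ->
  (forall i, (i < n)%N -> itinerary theta alpha x i = itinerary theta alpha y i) ->
  itinerary_dist r theta alpha x y <= r ^+ n.
Proof.
move=> /andP[r0 r1] same; rewrite /itinerary_dist; case: pselect => [ex|_]; last first.
  exact/exprn_ge0/ltW.
case: ex_minnP => i /asboolP di _; apply: ler_wiXn2l => //; try exact: ltW.
by rewrite leqNgt; apply/negP => /same.
Qed.

Lemma itinerary_dist_ge0 (R : realType) (X : Type) (r : R) (theta : X -> X)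
    (alpha : set (set X)) (x y : X) : 0 < r < 1 ->
  0 <= itinerary_dist r theta alpha x y.
Proof.
move=> /andP[r0 r1]; rewrite /itinerary_dist; case: pselect => // ex.
exact/exprn_ge0/ltW.
Qed.

Section Density.
Context {R : realType} {d : measure_display} {X : measurableType d}.
Variable m : probability X R.

Lemma density_ratio (phi : X -> R) (A B : set X) (fA fB K : R) :
  measurable_fun setT phi -> (forall x, 0 < phi x) -> measurable A -> measurable B ->
  (\int[m]_(x in A) (phi x)%:E)%E = fA%:E -> (\int[m]_(x in B) (phi x)%:E)%E = fB%:E ->
  0 <= K -> (forall x y, A x -> B y -> phi x <= K * phi y) ->
  fA * pr m B <= K * (fB * pr m A).
Proof.
move=> mphi phi0 mA mB iA iB K0 le.
have mE D : measurable D -> measurable_fun D (fun x => (phi x)%:E).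
  by move=> mD; apply/measurable_EFinP; apply: measurable_funS mphi.
have A0 : 0 <= pr m A by exact: (pr_charge m).1.
have fAy y : B y -> fA <= K * phi y * pr m A.
  move=> By; rewrite -lee_fin -iA EFinM -prE// -integral_cst//.
  apply: ge0_le_integral => //.
  - by move=> x _; rewrite lee_fin ltW.
  - exact: mE.
  - by move=> x Ax; rewrite lee_fin le.
rewrite -lee_fin EFinM -prE// -integral_cst//.
apply: (@le_trans _ _ (\int[m]_(x in B) ((K * pr m A)%:E * (phi x)%:E))%E).
  apply: ge0_le_integral => //.
  - by move=> y By; rewrite -iA; apply: integral_ge0 => x _; rewrite lee_fin ltW.
  - by apply: measurable_funeM; exact: mE.
  - by move=> y By; rewrite -EFinM lee_fin mulrAC; exact: fAy.
rewrite ge0_integralZl//; first last.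
- by rewrite lee_fin mulr_ge0.
- by move=> x _; rewrite lee_fin ltW.
- exact: mE.
by rewrite iB -EFinM lee_fin mulrA mulrAC.
Qed.

End Density.

Record induced_system (R : realType) (d : measure_display) (X : measurableType d)
    (mu nu : probability X R) (theta : X -> X) (alpha : set (set X))
    (Omega : set X) (F : set (set X)) (beta : set (seq (set X)))
    (eta : seq (set X) -> nat) (r : R) : Prop := InducedSystem {
  is_MM : markov_map mu theta alpha;
  is_IM : invariant_measure mu theta;
  is_Ffin : finite_set F;
  is_Fal : F `<=` alpha;
  is_OmE : Omega = \bigcup_(a in F) a;
  is_badm : beta `<=` admissible_words mu theta alpha;
  is_bpart : partition_mod mu beta (cylinder theta) Omega;
  is_nuE : forall A, measurable A ->
    nu A = (((fine (mu Omega))^-1)%:E * mu (A `&` Omega))%E;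
  is_GM : gibbs_markov_full nu (induced_map theta beta eta)
    (base_partition theta beta) r }.

Section InducedMap.
Context {R : realType} {d : measure_display} {X : measurableType d}.
Variables (mu nu : probability X R) (theta : X -> X) (alpha : set (set X)).
Variables (Omega : set X) (F : set (set X)) (beta : set (seq (set X))).
Variables (eta : seq (set X) -> nat) (r : R).
Hypothesis IS : induced_system mu nu theta alpha Omega F beta eta r.
Local Notation sigma := (induced_map theta beta eta).
Local Notation bp := (base_partition theta beta).
Let MM := is_MM IS.
Let IM := is_IM IS.
Let Ffin := is_Ffin IS.
Let Fal := is_Fal IS.
Let OmE := is_OmE IS.
Let badm := is_badm IS.
Let bpart := is_bpart IS.
Let nuE := is_nuE IS.
Let GM := is_GM IS.

Lemma Omega_measurable : measurable Omega.
Proof.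
rewrite OmE; apply: measurable_bigcup_countable.
  exact: finite_set_countable.
by move=> a /Fal; exact: (alpha_measurable MM).
Qed.

Lemma Omega_pos : 0 < pr mu Omega.
Proof.
have mO := Omega_measurable.
rewrite lt_neqAle (pr_charge mu).1// andbT; apply/eqP => O0.
have := nuE measurableT; rewrite probability_setT setTI (prE mu mO) -O0 mule0.
by move=> /eqP; rewrite onee_eq0.
Qed.

Lemma pr_nuE A : measurable A -> pr nu A = (pr mu Omega)^-1 * pr mu (A `&` Omega).
Proof.
move=> mA; have mO := Omega_measurable.
by rewrite {1}/pr nuE// (prE mu (measurableI _ _ mA mO)) -EFinM.
Qed.

Lemma negligible_nu N : nu.-negligible N <-> mu.-negligible (N `&` Omega).
Proof.
have mO := Omega_measurable; have Op := Omega_pos; split=> [[A [mA A0 NA]]|[A [mA A0 NA]]].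
  exists (A `&` Omega); split; [exact: measurableI| |by move=> x [/NA]].
  have mAO := measurableI _ _ mA mO.
  have /eqP := pr_nuE mA; rewrite {1}/pr A0 eq_sym mulf_eq0 invr_eq0 gt_eqF//= => /eqP.
  by rewrite (prE mu mAO) => ->.
exists (A `|` ~` Omega); split; first by apply: measurableU => //; exact: measurableC.
  rewrite nuE; last by apply: measurableU => //; exact: measurableC.
  rewrite setIUl setICl setU0 (_ : mu (A `&` Omega) = 0%E) ?mule0//.
  by apply: (subset_measure0 _ mA _ A0); [exact: measurableI|move=> x []].
by move=> x Nx; have [Ox|] := pselect (Omega x); [left; apply: NA|right].
Qed.

Lemma negligible_mu_nu N : mu.-negligible N -> nu.-negligible N.
Proof. by move=> nN; apply/negligible_nu; apply: negligibleS nN => x []. Qed.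

Lemma beta_word u : beta u ->
  [/\ (0 < size u)%N, forall a, a \in u -> alpha a & admissible mu theta alpha (size u) u].
Proof. by move=> /badm[n _] adm; have [n0 -> ua _] := adm. Qed.

Lemma beta_measurable u : beta u -> measurable (cylinder theta u).
Proof. by move=> /beta_word[_ ua _]; exact: (measurable_cylinder MM). Qed.

Lemma beta_pos u : beta u -> (0 < nu (cylinder theta u))%E.
Proof. by move=> bu; have [[_ [_ h _] _ _ _] _ _ _] := GM; apply: h; exists u. Qed.

Lemma beta_not_negligible u : beta u -> ~ mu.-negligible (cylinder theta u).
Proof.
move=> bu /negligible_mu_nu /negligibleP => /(_ (beta_measurable bu)) n0.
by have := beta_pos bu; rewrite n0 ltxx.
Qed.

Lemma beta_disjoint u u' x : beta u -> beta u' ->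
  cylinder theta u x -> cylinder theta u' x -> u = u'.
Proof.
wlog le_uu' : u u' / (size u <= size u')%N => [hw bu bu' ux u'x|].
  have [le|/ltnW le] := leqP (size u) (size u'); first exact: hw.
  by apply/esym; exact: hw.
move=> bu bu' ux u'x; apply: contrapT => neq.
have [_ ua _] := beta_word bu; have [_ ua' _] := beta_word bu'.
have nthE k : (k < size u)%N -> nth set0 u k = nth set0 u' k.
  move=> ku; have ku' := leq_trans ku le_uu'.
  apply: (alpha_eq MM) (ux k ku) (u'x k ku'); [exact/ua/mem_nth|exact/ua'/mem_nth].
have sub : cylinder theta u' `<=` cylinder theta u.
  by move=> y yu' k ku; rewrite nthE//; apply: yu'; exact: leq_trans le_uu'.
have [_ h _] := bpart; have := h u u' bu bu' neq; rewrite setIidr// => n0.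
by apply: (beta_not_negligible bu'); apply/negligibleP => //; exact: beta_measurable.
Qed.

Lemma beta_Omega u : beta u -> F (head set0 u) /\ cylinder theta u `<=` head set0 u.
Proof.
move=> bu; have [u0 ua _] := beta_word bu.
have sub : cylinder theta u `<=` head set0 u by move=> x /(_ 0%N u0); rewrite nth0.
split=> //; apply: contrapT => nF; apply: (beta_not_negligible bu).
have [/(_ u bu)[mc n0] _ _] := bpart.
apply/negligibleP => //; rewrite -[RHS]n0; congr (mu _); apply/seteqP.
split=> [x ux|x []//]; split=> //; rewrite OmE => -[a Fa ax]; apply: nF.
rewrite (_ : head set0 u = a)//; apply: (alpha_eq MM) (sub x ux) ax; last exact: Fal.
by rewrite -nth0; exact/ua/mem_nth.
Qed.

Lemma F_Omega a : F a -> a `<=` Omega.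
Proof. by move=> Fa x ax; rewrite OmE; exists a. Qed.

Lemma cylinder_beta_Omega u : beta u -> cylinder theta u `<=` Omega.
Proof. by move=> /beta_Omega[Fu sub] x /sub; exact: F_Omega. Qed.

Lemma beta_countable : countable beta.
Proof.
have [[_ [cb _ _] _ _ _] _ _ _] := GM.
have /countable_injP[f finj] := cb; apply/countable_injP.
exists (f \o cylinder theta) => u u' /set_mem bu /set_mem bu' /= E.
have cE : cylinder theta u = cylinder theta u'.
  by apply: finj => //; apply/mem_set; [exists u|exists u'].
have [x ux] : exists x, cylinder theta u x.
  apply/not_existsP => /= n0; apply: (beta_not_negligible bu).
  by rewrite (_ : cylinder theta u = set0); [exact: negligible_set0|apply/seteqP; split].
by apply: (beta_disjoint (x := x)) => //; rewrite -cE.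
Qed.

Lemma return_timeE u x : beta u -> cylinder theta u x ->
  return_time theta beta eta x = eta u.
Proof.
move=> bu ux; rewrite /return_time; congr eta.
have := @xgetPex _ [::] [set u | beta u /\ cylinder theta u x] (ex_intro _ u (conj bu ux)).
by move=> [bv vx]; exact: beta_disjoint vx ux.
Qed.

Lemma sigmaE u x : beta u -> cylinder theta u x -> sigma x = iter (eta u) theta x.
Proof. by move=> bu ux; rewrite /induced_map (return_timeE bu ux). Qed.

Lemma itinerary0E u x : beta u -> cylinder theta u x ->
  itinerary sigma bp x 0 = cylinder theta u.
Proof.
move=> bu ux; rewrite /itinerary /=.
have := @xgetPex _ set0 [set a | bp a /\ a x]
  (ex_intro _ (cylinder theta u) (conj (ex_intro2 _ _ u bu erefl) ux)).
by move=> [[v bv <-] vx]; rewrite (beta_disjoint bv bu vx ux).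
Qed.

Definition domain := \bigcup_(u in beta) cylinder theta u.

Lemma domain_measurable : measurable domain.
Proof. by apply: measurable_bigcup_countable beta_countable _ => u; exact: beta_measurable. Qed.

Lemma domain_conegligible : nu.-negligible (~` domain).
Proof.
apply/negligible_nu; have [_ _ n0] := bpart.
exists (Omega `\` domain); split=> //; last by move=> x [].
by apply: measurableD; [exact: Omega_measurable|exact: domain_measurable].
Qed.

Lemma sigma_measurable : measurable_fun setT sigma.
Proof.
move=> _ A mA; rewrite setTI.
have -> : sigma @^-1` A = \bigcup_(u in beta) (cylinder theta u `&` iter (eta u) theta @^-1` A)
   `|` (iter (eta [::]) theta @^-1` A `\` domain).
  apply/seteqP; split=> [x Ax|x [[u bu [ux]]|[Ax nD]]].
  - have [[u bu ux]|nD] := pselect (domain x).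
      by left; exists u => //; split=> //; rewrite /preimage /= -(sigmaE bu ux).
    right; split=> //; move: Ax; rewrite /preimage /induced_map /return_time /=.
    by rewrite xgetPN// => u [bu ux]; apply: nD; exists u.
  - by rewrite /preimage /= (sigmaE bu ux).
  - rewrite /preimage /= /induced_map /return_time.
    by rewrite xgetPN// => u [bu ux]; apply: nD; exists u.
apply: measurableU.
  apply: measurable_bigcup_countable beta_countable _ => u bu.
  apply: measurableI; first exact: beta_measurable.
  exact: (measurable_preimage_iter MM).
by apply: measurableD; [exact: (measurable_preimage_iter MM)|exact: domain_measurable].
Qed.

Lemma measurable_preimage_sigma A : measurable A -> measurable (sigma @^-1` A).
Proof. by move=> mA; rewrite -[X in measurable X]setTI; exact: sigma_measurable. Qed.

Lemma negligible_preimage_sigma N : nu.-negligible N -> nu.-negligible (sigma @^-1` N).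
Proof.
move=> [A [mA A0 NA]].
apply: (negligibleS (A := \bigcup_(u in beta) (cylinder theta u `&` sigma @^-1` A)
  `|` ~` domain)).
  move=> x /NA Ax; have [[u bu ux]|nD] := pselect (domain x); last by right.
  by left; exists u.
apply: negligibleU domain_conegligible; apply: negligible_bigcup_countable beta_countable _ => u bu.
have [[_ _ ns _ _] _ _ _] := GM; have [_ _ mi nul] := ns _ (ex_intro2 _ _ u bu erefl).
have mB : measurable (cylinder theta u `&` sigma @^-1` A).
  by apply: measurableI; [exact: beta_measurable|exact: measurable_preimage_sigma].
have sB : cylinder theta u `&` sigma @^-1` A `<=` cylinder theta u by move=> x [].
apply/negligibleP => //; apply/(nul _ mB sB).
by apply: subset_measure0 A0 => //; [exact: mi|move=> _ [x [_ Ax] <-]].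
Qed.

End InducedMap.

Section InducedSystem.
Context {R : realType} {d : measure_display} {X : measurableType d}.
Variables (mu nu : probability X R) (theta : X -> X) (alpha : set (set X)).
Variables (Omega : set X) (F : set (set X)) (beta : set (seq (set X))).
Variables (eta : seq (set X) -> nat) (r : R).
Hypothesis IS : induced_system mu nu theta alpha Omega F beta eta r.
Local Notation sigma := (induced_map theta beta eta).
Local Notation bp := (base_partition theta beta).
Local Notation it := (itinerary sigma bp).
Local Notation cyl := (cylinder theta).

Lemma metric_ratio01 : 0 < r < 1.
Proof. by have [_ _ h _] := is_GM IS. Qed.

Lemma pr_eq_negligible (A B : set X) : measurable A -> measurable B ->
  nu.-negligible (A `\` B) -> nu.-negligible (B `\` A) -> pr nu A = pr nu B.
Proof.
move=> mA mB nAB nBA; have ch := pr_charge nu.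
rewrite (charge_setID ch mA mB) (charge_setID ch mB mA) setIC; congr (_ + _).
have zero (N : set X) : measurable N -> nu.-negligible N -> pr nu N = 0.
  by move=> mN /negligibleP => /(_ mN); rewrite /pr => ->.
by rewrite !zero//; exact: measurableD.
Qed.

Lemma branch_measurable u A : beta u -> measurable A ->
  measurable (cyl u `&` sigma @^-1` A).
Proof.
move=> bu mA; apply: measurableI; first exact: (beta_measurable IS).
exact: (measurable_preimage_sigma IS).
Qed.

Lemma branch_distortion : exists2 C : R, 0 < C &
  forall u A B n, beta u -> measurable A -> measurable B -> agree it n A B ->
    pr nu (cyl u `&` sigma @^-1` A) * pr nu B <=
    expR (C * r ^+ n) * (pr nu (cyl u `&` sigma @^-1` B) * pr nu A).
Proof.
have [[_ _ ns _ _] full r01' [C C0 CP]] := is_GM IS; exists C => //.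
move=> u A B n bu mA mB agr.
have bpu : bp (cyl u) by exists u.
have [phi [mphi phi0 int] [N [N' [mN' N'0 NN']] lip]] : exists2 phi,
   inverse_branch_density nu sigma [:: cyl u] phi &
   exists2 N, nu.-negligible N & forall x y, ~ N x -> ~ N y ->
     `|ln (phi x) - ln (phi y)| <= C * itinerary_dist r sigma bp x y.
  apply: CP; exists 1%N => //; split=> // a.
  by rewrite inE => /eqP ->.
have cyl1 : cylinder sigma [:: cyl u] = cyl u.
  by apply/seteqP; split=> [x /(_ 0%N isT)//|x ux [|k]].
pose I := sigma @` cyl u.
have [inj mf mi nul] := ns _ bpu.
have mI : measurable I by apply: mi => //; exact: (beta_measurable IS).
have nI : nu.-negligible (~` I).
  by apply/negligibleP; [exact: measurableC|exact: full].
have nN' : nu.-negligible N' by exists N'; split.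
pose S D := (D `&` I) `\` N'.
have mS D : measurable D -> measurable (S D).
  by move=> mD; apply: measurableD => //; exact: measurableI.
have prS D : measurable D -> pr nu D = pr nu (S D).
  move=> mD; apply: pr_eq_negligible => //; first exact: mS.
    apply: negligibleS (negligibleU nI nN') => x [Dx nS].
    have [Ix|nIx] := pselect (I x); last by left.
    by right; apply: contrapT => nN; apply: nS.
  by apply: negligibleS (negligible_set0 _) => x [[[]]].
have fS D : measurable D ->
    pr nu (cyl u `&` sigma @^-1` D) = pr nu (cyl u `&` sigma @^-1` (S D)).
  move=> mD; apply: pr_eq_negligible; [exact: branch_measurable|apply: branch_measurable => //; exact: mS| |].
    apply: negligibleS (negligible_preimage_sigma IS nN') => x [[ux Dx] nS].
    by apply: contrapT => nN; apply: nS; split=> //; split=> //; split=> //; exists x.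
  by apply: negligibleS (negligible_set0 _) => x [[ux [[Dx _] _]]]; case.
have intS D : measurable D ->
    (\int[nu]_(x in S D) (phi x)%:E)%E = (pr nu (cyl u `&` sigma @^-1` (S D)))%:E.
  move=> mD; rewrite -prE; last by apply: branch_measurable => //; exact: mS.
  rewrite -int ?cyl1//=; first exact: mS.
  by move=> x [[_]].
rewrite (prS B)// (prS A)// (fS A)// (fS B)//.
apply: (density_ratio mphi phi0 (mS _ mA) (mS _ mB) (intS _ mA) (intS _ mB)).
  exact: expR_ge0.
move=> x y [[Ax _] nx] [[By _] ny].
have := lip x y (fun h => nx (NN' _ h)) (fun h => ny (NN' _ h)).
have le_r : itinerary_dist r sigma bp x y <= r ^+ n.
  by apply: itinerary_dist_le => // i; exact: agr.
have := ler_wpM2l (ltW C0) le_r.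
move=> h1 h2; rewrite -[phi x]lnK ?posrE// -[phi y in leRHS]lnK ?posrE// -expRD ler_expR.
have := ler_norm (ln (phi x) - ln (phi y)); lra.
Qed.

Lemma agree_branch u n A B : beta u -> agree it n A B ->
  agree it n.+1 (cyl u `&` sigma @^-1` A) (cyl u `&` sigma @^-1` B).
Proof.
move=> bu agr x y [|i] [ux Ax] [uy By] ik.
  by rewrite (itinerary0E IS bu ux) (itinerary0E IS bu uy).
by rewrite /itinerary !iterSr; exact: (agr (sigma x) (sigma y) i Ax By).
Qed.

(* The constant c r + C < c is gained because a branch contracts the metric by r. *)
Lemma push_regular C : 0 < C -> (forall u A B n, beta u -> measurable A ->
    measurable B -> agree it n A B ->
    pr nu (cyl u `&` sigma @^-1` A) * pr nu B <=
    expR (C * r ^+ n) * (pr nu (cyl u `&` sigma @^-1` B) * pr nu A)) ->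
  forall c p u, beta u -> regular nu it r c p ->
    regular nu it r (c * r + C) (push_charge sigma (cyl u) p).
Proof.
move=> C0 dist c p u bu rp; have [chp reg] := rp.
have mu' := beta_measurable IS bu.
split; first exact: (push_charge_charge (sigma_measurable IS) mu' chp).
move=> n A B mA mB agr; rewrite /push_charge.
set A' := cyl u `&` _; set B' := cyl u `&` sigma @^-1` B.
have mA' : measurable A' by exact: branch_measurable.
have mB' : measurable B' by exact: branch_measurable.
have [chn _] := pr_charge nu.
have [A'0|A'0] := eqVneq (pr nu A') 0.
  rewrite (regular_null rp mA'); last by rewrite (prE nu mA') A'0.
  by rewrite mul0r !mulr_ge0 ?expR_ge0 ?chp.1 ?chn.
have [B'0|B'0] := eqVneq (pr nu B') 0.
  have agrT : agree it 0 setT B by move=> x y i _ _; rewrite ltn0.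
  have := dist u setT B 0%N bu measurableT mB agrT; rewrite -/B' B'0 mul0r mulr0.
  rewrite preimage_setT setIT => le0.
  have upos : 0 < pr nu (cyl u).
    by have := beta_pos IS bu; rewrite (prE nu mu').
  have -> : pr nu B = 0.
    apply/eqP; rewrite eq_le chn// andbT.
    by rewrite -(pmulr_rle0 _ upos).
  by rewrite mulr0 !mulr_ge0 ?expR_ge0 ?chp.1 ?chn.
have A'p : 0 < pr nu A' by rewrite lt_neqAle eq_sym A'0 chn.
have B'p : 0 < pr nu B' by rewrite lt_neqAle eq_sym B'0 chn.
rewrite -(ler_pM2r (mulr_gt0 A'p B'p)).
have h1 := reg n.+1 A' B' mA' mB' (agree_branch bu agr).
have h2 := dist u A B n bu mA mB agr; rewrite -/A' -/B' in h2.
have := ler_pM (mulr_ge0 (chp.1 _ mA') (ltW B'p))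
  (mulr_ge0 (ltW A'p) (chn _ mB)) h1 h2.
rewrite [X in X <= _](_ : _ = p A' * pr nu B * (pr nu A' * pr nu B')); last by ring.
move=> /le_trans; apply; rewrite le_eqVlt; apply/orP; left; apply/eqP.
have -> : (c * r + C) * r ^+ n = c * r ^+ n.+1 + C * r ^+ n by rewrite exprS; ring.
by rewrite expRD; move: (expR _) (expR _) => e1 e2; ring.
Qed.

End InducedSystem.

(** * The cocycle over the induced map *)

Section Cocycles.
Context {X : Type} {G : groupType}.
Implicit Types (T : X -> X) (g : X -> G).

Lemma cocycle0 T g x : cocycle T g 0 x = 1%g.
Proof. by rewrite /cocycle big_ord0. Qed.

Lemma cocycleS T g n x : cocycle T g n.+1 x = (g x * cocycle T g n (T x))%g.
Proof.
rewrite /cocycle big_ord_recl /=; congr (_ * _)%g; apply: eq_bigr => i _.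
by rewrite -iterSr.
Qed.

Lemma cocycleD T g n m x :
  cocycle T g (n + m) x = (cocycle T g n x * cocycle T g m (iter n T x))%g.
Proof.
elim: n x => [|n IH] x; first by rewrite cocycle0 mul1g.
by rewrite addSn !cocycleS IH mulgA -iterSr.
Qed.

End Cocycles.

Section MeasurableGroupMaps.
Context {d : measure_display} {X : measurableType d} {G : groupType}.
Hypothesis cG : countable [set: G].

Definition group_measurable (K : X -> G) := forall S : set G, measurable (K @^-1` S).

Lemma group_measurable1 : group_measurable (fun=> 1%g).
Proof.
move=> S; have [S1|nS1] := pselect (S 1%g).
  by rewrite (_ : _ @^-1` _ = setT)//; apply/seteqP; split.
by rewrite (_ : _ @^-1` _ = set0)//; apply/seteqP; split.
Qed.

Lemma group_measurableM K L : group_measurable K -> group_measurable L ->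
  group_measurable (fun x => (K x * L x)%g).
Proof.
move=> mK mL S.
have -> : (fun x => (K x * L x)%g) @^-1` S =
    \bigcup_(g in setT) ((K @^-1` [set g]) `&` (L @^-1` [set h | S (g * h)%g])).
  by apply/seteqP; split=> [x Sx|x [g _ [<-]]//]; exists (K x).
by apply: measurable_bigcup_countable => // g _; exact: measurableI.
Qed.

Lemma group_measurable_comp K T : measurable_fun setT T -> group_measurable K ->
  group_measurable (fun x => K (T x)).
Proof. by move=> mT mK S; have := mT measurableT _ (mK S); rewrite setTI. Qed.

Lemma group_measurable_cocycle T K n : measurable_fun setT T ->
  group_measurable K -> group_measurable (cocycle T K n).
Proof.
move=> mT mK; elim: n => [|n IH].
  have -> : cocycle T K 0 = fun=> 1%g by apply/funext => x; rewrite cocycle0.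
  exact: group_measurable1.
have -> : cocycle T K n.+1 = fun x => (K x * cocycle T K n (T x))%g.
  by apply/funext => x; rewrite cocycleS.
by apply: group_measurableM => //; exact: group_measurable_comp.
Qed.

End MeasurableGroupMaps.

Section Words.
Context {R : realType} {d : measure_display} {X : measurableType d}.

Definition words (T : choiceType) (A : set T) (n : nat) : set (seq T) :=
  [set w | size w = n /\ forall a, a \in w -> A a].

Lemma countable_words (T : choiceType) (A : set T) n : countable A -> countable (words A n).
Proof.
move=> /countable_injP[f finj]; apply/countable_injP.
exists (fun w => choice.pickle (map f w)) => w w' /set_mem[_ wA] /set_mem[_ wA'].
move=> /(pcan_inj choice.pickleK) E.
have injf : {in [pred a | `[< A a >]] &, injective f}.
  by move=> a b /asboolP Aa /asboolP Ab; apply: finj; exact/mem_set.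
by apply: (inj_in_map injf) E; apply/allP => a ?; apply/asboolP; [exact: wA|exact: wA'].
Qed.

Variables (mu : probability X R) (theta : X -> X) (alpha : set (set X)).
Hypothesis MM : markov_map mu theta alpha.

Lemma words_countable n : countable (words alpha n).
Proof. by have [_ [_ [ca _ _] _ _ _]] := MM; exact: countable_words. Qed.

Lemma word_of n x : exists2 w, words alpha n w & cylinder theta w x.
Proof.
pose L y := s2val (cid2 (alpha_cover MM y)).
exists (mkseq (fun i => L (iter i theta x)) n).
  split=> [|a /mapP[i _ ->]]; first by rewrite size_mkseq.
  by rewrite /L; case: (cid2 _).
move=> k; rewrite size_mkseq => kn; rewrite nth_mkseq//.
by rewrite /L; case: (cid2 _).
Qed.

Lemma words_eq n w w' x : words alpha n w -> words alpha n w' ->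
  cylinder theta w x -> cylinder theta w' x -> w = w'.
Proof.
move=> [sw wa] [sw' wa'] wx wx'; apply: (@eq_from_nth _ set0) => [|i iw].
  by rewrite sw sw'.
have iw' : (i < size w')%N by rewrite sw' -sw.
apply: (alpha_eq MM) (wx i iw) (wx' i iw'); [exact/wa/mem_nth|exact/wa'/mem_nth].
Qed.

End Words.

Section InducedCocycle.
Context {R : realType} {d : measure_display} {X : measurableType d}.
Context {G : groupType}.
Variables (mu nu : probability X R) (theta : X -> X) (alpha : set (set X)).
Variables (Omega : set X) (F : set (set X)) (beta : set (seq (set X))).
Variables (eta : seq (set X) -> nat) (r : R) (gamma : X -> G).
Hypothesis IS : induced_system mu nu theta alpha Omega F beta eta r.
Hypothesis cG : countable [set: G].
Hypothesis gconst : forall a x y, alpha a -> a x -> a y -> gamma x = gamma y.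
Local Notation sigma := (induced_map theta beta eta).
Local Notation etax := (return_time theta beta eta).
Local Notation cyl := (cylinder theta).

Lemma gamma_measurable : group_measurable gamma.
Proof.
move=> S; have [_ [_ [ca _ _] _ _ _]] := is_MM IS.
have -> : gamma @^-1` S = \bigcup_(a in alpha `&` [set a | exists2 x, a x & S (gamma x)]) a.
  apply/seteqP; split=> [x Sx|x [a [aa [y ay Sy]] ax]]; last first.
    by rewrite /preimage /= (gconst aa ax ay).
  by have [a aa ax] := alpha_cover (is_MM IS) x; exists a => //; split=> //; exists x.
apply: measurable_bigcup_countable => [|a [aa _]]; last exact: (alpha_measurable (is_MM IS)).
by apply: sub_countable ca; apply: subset_card_le => a [].
Qed.

Lemma cocycle_cylinder w x y n : (forall a, a \in w -> alpha a) -> (n <= size w)%N ->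
  cyl w x -> cyl w y -> cocycle theta gamma n x = cocycle theta gamma n y.
Proof.
move=> wa nw wx wy; rewrite /cocycle; apply: eq_bigr => i _.
have iw : (i < size w)%N by exact: leq_trans nw.
by apply: (gconst _ (wx i iw) (wy i iw)); exact/wa/mem_nth.
Qed.

Definition kappa x := cocycle theta gamma (etax x) x.

Definition etak k x := (\sum_(i < k) etax (iter i sigma x))%N.

Lemma etak0 x : etak 0 x = 0%N.
Proof. by rewrite /etak big_ord0. Qed.

Lemma etakS k x : etak k.+1 x = (etax x + etak k (sigma x))%N.
Proof.
rewrite /etak big_ord_recl /=; congr (_ + _)%N; apply: eq_bigr => i _.
by rewrite -iterSr.
Qed.

Lemma etak_recr k x : etak k.+1 x = (etak k x + etax (iter k sigma x))%N.
Proof. by rewrite /etak big_ord_recr. Qed.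

Lemma iter_sigmaE k x : iter k sigma x = iter (etak k x) theta x.
Proof.
elim: k x => [|k IH] x; first by rewrite etak0.
by rewrite iterSr IH etakS addnC iterD.
Qed.

Lemma cocycle_kappa k x : cocycle sigma kappa k x = cocycle theta gamma (etak k x) x.
Proof.
elim: k x => [|k IH] x; first by rewrite etak0 !cocycle0.
by rewrite cocycleS IH etakS cocycleD.
Qed.

Lemma etax_measurable n : measurable (etax @^-1` [set n]).
Proof.
have -> : etax @^-1` [set n] = \bigcup_(u in beta `&` [set u | eta u = n]) cyl u `|`
    (if eta [::] == n then ~` domain theta beta else set0).
  apply/seteqP; split=> [x /= xn|x].
    have [[u bu ux]|nD] := pselect (domain theta beta x).
      by left; exists u => //; split=> //=; rewrite -xn (return_timeE IS bu ux).
    right; move: xn; rewrite /return_time xgetPN.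
      by move=> ->; rewrite eqxx.
    by move=> u [bu ux]; apply: nD; exists u.
  case=> [[u [bu <-] ux]|]; first exact: (return_timeE IS bu ux).
  case: eqP => // <- nD; rewrite /preimage /= /return_time xgetPN//.
  by move=> u [bu ux]; apply: nD; exists u.
apply: measurableU; last first.
  by case: ifP => // _; apply: measurableC; exact: (domain_measurable IS).
apply: measurable_bigcup_countable => [|u [bu _]]; last exact: (beta_measurable IS).
by apply: sub_countable (beta_countable IS); apply: subset_card_le => u [].
Qed.

Lemma kappa_measurable : group_measurable kappa.
Proof.
move=> S; have -> : kappa @^-1` S =
    \bigcup_n (etax @^-1` [set n] `&` cocycle theta gamma n @^-1` S).
  by apply/seteqP; split=> [x Sx|x [n _ [/= xn Sx]]]; [exists (etax x)|rewrite /preimage /= /kappa xn].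
apply: bigcup_measurable => n _; apply: measurableI; first exact: etax_measurable.
apply: group_measurable_cocycle => //; last exact: gamma_measurable.
exact: (theta_measurable (is_MM IS)).
Qed.

(* The length of u may be smaller than eta u; then kappa is only constant on
   the part of [u] that sigma maps to a given element of alpha. *)
Lemma kappa_branch u b : beta u -> F b ->
  exists g : G, mu.-negligible [set x | [/\ cyl u x, b (sigma x) & kappa x <> g]].
Proof.
move=> bu Fb; set n := eta u.
have [u0 ua _] := beta_word IS bu; have ab := is_Fal IS Fb.
have MM := is_MM IS; have IM := is_IM IS.
have kE x : cyl u x -> kappa x = cocycle theta gamma n x.
  by move=> ux; rewrite /kappa (return_timeE IS bu ux).
have sE x : cyl u x -> sigma x = iter n theta x by exact: (sigmaE IS bu).
have [nu_ | un] := ltnP n (size u).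
  have [[x ux]|nx] := pselect (exists x, cyl u x); last first.
    exists 1%g; apply: negligibleS (negligible_set0 _) => x [ux _ _].
    by apply: nx; exists x.
  exists (cocycle theta gamma n x); apply: negligibleS (negligible_set0 _) => y [uy _].
  by rewrite kE//; apply; exact: cocycle_cylinder ua (ltnW nu_) uy ux.
pose piece w := [set x | [/\ cyl u x, cyl w x & b (iter n theta x)]].
have cover x : exists2 w, words alpha n w & cyl w x by exact: (word_of MM).
have [[w [sw wa] nw]|nw] := pselect (exists2 w, words alpha n w & ~ mu.-negligible (piece w)); last first.
  exists 1%g; apply: (negligibleS (A := \bigcup_(w in words alpha n) piece w)).
    move=> x [ux bx _]; have [w ww wx] := cover x.
    by exists w => //; split=> //; rewrite -sE.
  apply: negligible_bigcup_countable (words_countable MM n) _ => w ww.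
  by apply: contrapT => np; apply: nw; exists w.
have [x0 [ux0 wx0 _]] : exists x, piece w x.
  apply/not_existsP => /= n0; apply: nw; rewrite (_ : piece w = set0).
    exact: negligible_set0.
  by apply/seteqP; split.
have sub : cyl w `<=` cyl u.
  move=> y wy k ku; have kw : (k < size w)%N by rewrite sw; exact: leq_trans un.
  rewrite (_ : nth set0 u k = nth set0 w k); first exact: wy.
  apply: (alpha_eq MM) (ux0 k ku) (wx0 k kw); [exact/ua/mem_nth|exact/wa/mem_nth].
exists (cocycle theta gamma n x0).
have [n0|n0] := image_cylinder_dichotomy MM wa ab.
  exfalso; apply: nw; apply: negligibleS (negligible_preimage_iter MM IM n n0).
  by move=> x [ux wx bx]; split=> //; exists x; rewrite ?sw.
apply: negligibleS (negligible_preimage_iter MM IM n n0) => x [ux bx kx].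
split; first by rewrite -sE.
case=> y wy; rewrite sw => yx; apply: kx.
have [[_ _ ns _ _] _ _ _] := is_GM IS.
have [inj _ _ _] := ns _ (ex_intro2 _ _ u bu erefl).
have -> : x = y.
  apply: inj; [exact/mem_set|exact/mem_set/sub|].
  by rewrite (sE _ ux) (sE _ (sub _ wy)) yx.
rewrite (kE _ (sub _ wy)).
by apply: (cocycle_cylinder (w := w)) => //; rewrite sw.
Qed.

End InducedCocycle.

Section InducedWords.
Context {R : realType} {d : measure_display} {X : measurableType d}.
Context {G : groupType}.
Variables (mu nu : probability X R) (theta : X -> X) (alpha : set (set X)).
Variables (Omega : set X) (F : set (set X)) (beta : set (seq (set X))).
Variables (eta : seq (set X) -> nat) (r : R) (gamma : X -> G).
Hypothesis IS : induced_system mu nu theta alpha Omega F beta eta r.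
Hypothesis cG : countable [set: G].
Hypothesis gconst : forall a x y, alpha a -> a x -> a y -> gamma x = gamma y.
Local Notation sigma := (induced_map theta beta eta).
Local Notation bp := (base_partition theta beta).
Local Notation it := (itinerary sigma bp).
Local Notation cyl := (cylinder theta).
Local Notation kap := (kappa theta beta eta gamma).
Implicit Types w : seq (seq (set X)).

Fixpoint wcyl w : set X :=
  if w is u :: w' then cyl u `&` sigma @^-1` (wcyl w') else setT.

Lemma wcyl_measurable w : (forall u, u \in w -> beta u) -> measurable (wcyl w).
Proof.
elim: w => [_|u w IH wb] /=; first exact: measurableT.
apply: (branch_measurable IS); first by apply: wb; rewrite mem_head.
by apply: IH => v vw; apply: wb; rewrite inE vw orbT.
Qed.

Lemma iter_sigma_measurable k : measurable_fun setT (iter k sigma).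
Proof.
elim: k => [|k IH]; first exact: measurable_id.
exact: (measurableT_comp (sigma_measurable IS) IH).
Qed.

Lemma measurable_preimage_iter_sigma k A : measurable A -> measurable (iter k sigma @^-1` A).
Proof. by move=> mA; rewrite -[X in measurable X]setTI; exact: iter_sigma_measurable. Qed.

Lemma negligible_preimage_iter_sigma k N : nu.-negligible N ->
  nu.-negligible (iter k sigma @^-1` N).
Proof.
elim: k N => [//|k IH] N nN.
by have := IH _ (negligible_preimage_sigma IS nN).
Qed.

Lemma wcyl_eq k w w' x : words beta k w -> words beta k w' ->
  wcyl w x -> wcyl w' x -> w = w'.
Proof.
elim: k w w' x => [|k IH] [|u w] [|u' w'] x [//= sw wb] [//= sw' wb'].
move: sw sw' => [sw] [sw'] [ux wx] [u'x w'x].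
have -> : u = u'.
  by apply: (beta_disjoint IS) ux u'x; [apply: wb|apply: wb']; rewrite mem_head.
congr (_ :: _); apply: (IH _ _ (sigma x)) => //; split=> // v vw.
  by apply: wb; rewrite inE vw orbT.
by apply: wb'; rewrite inE vw orbT.
Qed.

Lemma wcyl_cover k : nu.-negligible (~` \bigcup_(w in words beta k) wcyl w).
Proof.
elim: k => [|k IH].
  by apply: negligibleS (negligible_set0 _) => x; apply; exists [::].
apply: negligibleS (negligibleU (domain_conegligible IS) (negligible_preimage_sigma IS IH)).
move=> x nx; have [[u bu ux]|] := pselect (domain theta beta x); last by left.
right=> -[w [sw wb] wx]; apply: nx; exists (u :: w); last by split.
split=> [/=|v]; first by rewrite sw.
by rewrite inE => /predU1P[->|/wb].
Qed.

Definition kappa_value (u : seq (set X)) (b : set X) : G :=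
  xget 1%g [set g | mu.-negligible [set x | [/\ cyl u x, b (sigma x) & kap x <> g]]].

(* kappa_value u c at consecutive letters of w, where c is the first element
   of alpha in the next letter, and b after the last letter. *)
Fixpoint word_value w (b : set X) : G :=
  if w is u :: w' then (kappa_value u (head set0 (head [:: b] w')) * word_value w' b)%g
  else 1%g.

Lemma word_value_cat w u w' b :
  word_value (w ++ u :: w') b = (word_value w (head set0 u) * word_value (u :: w') b)%g.
Proof.
elim: w => [|v w IH] /=; first by rewrite mul1g.
by rewrite -mulgA IH; congr (_ * _)%g; case: w {IH}.
Qed.

Lemma kappa_valueP u b : beta u -> F b ->
  mu.-negligible [set x | [/\ cyl u x, b (sigma x) & kap x <> kappa_value u b]].
Proof.
move=> bu Fb; have [g gP] := kappa_branch IS gconst bu Fb.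
exact: (@xgetPex _ 1%g [set g | mu.-negligible [set x | [/\ cyl u x, b (sigma x) & kap x <> g]]]
  (ex_intro _ g gP)).
Qed.

Lemma word_valueP w b : (forall u, u \in w -> beta u) -> F b ->
  nu.-negligible [set x | [/\ wcyl w x, b (iter (size w) sigma x) &
    cocycle sigma kap (size w) x <> word_value w b]].
Proof.
elim: w => [_|u w IH wb] Fb.
  by apply: negligibleS (negligible_set0 _) => x [_ _]; rewrite cocycle0.
have bu : beta u by apply: wb; rewrite mem_head.
have wb' v : v \in w -> beta v by move=> vw; apply: wb; rewrite inE vw orbT.
set c := head set0 (head [:: b] w).
have Fc : F c.
  rewrite /c; case: (w) wb' => [//|v w'] /= wb'.
  by have [] := beta_Omega IS (wb' v (mem_head _ _)).
have n1 := negligible_mu_nu IS (kappa_valueP bu Fc).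
have n2 := negligible_preimage_sigma IS (IH wb' Fb).
apply: negligibleS (negligibleU n1 n2) => x [/= [ux wx] bx neq].
have cx : c (sigma x).
  rewrite /c; case: (w) wb' wx bx => [//|v w'] /= wb' [vx _] _.
  by have [_] := beta_Omega IS (wb' v (mem_head _ _)); apply.
have [kx|] := pselect (kap x = kappa_value u c); last by left.
right; split=> //; first by rewrite -iterSr.
by move=> E; apply: neq; rewrite cocycleS kx E.
Qed.

Lemma F_pos a : F a -> 0 < pr nu a.
Proof.
move=> Fa; have MM := is_MM IS; have aa := is_Fal IS Fa; have ma := alpha_measurable MM aa.
rewrite (pr_nuE IS ma) setIidl; last exact: (F_Omega IS).
rewrite mulr_gt0 ?invr_gt0 ?(Omega_pos IS)//.
by have := alpha_pos MM aa; rewrite (prE mu ma).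
Qed.

Variable C : R.
Hypothesis C0 : 0 < C.
Hypothesis dist : forall u A B n, beta u -> measurable A -> measurable B ->
  agree it n A B -> pr nu (cyl u `&` sigma @^-1` A) * pr nu B <=
    expR (C * r ^+ n) * (pr nu (cyl u `&` sigma @^-1` B) * pr nu A).

Lemma branch_pos u A : beta u -> measurable A -> 0 < pr nu A ->
  0 < pr nu (cyl u `&` sigma @^-1` A).
Proof.
move=> bu mA A0.
have agrT : agree it 0 setT A by move=> x y i _ _; rewrite ltn0.
have := dist bu measurableT mA agrT; rewrite preimage_setT setIT prT mulr1 expr0 mulr1.
have u0 : 0 < pr nu (cyl u).
  by have := beta_pos IS bu; rewrite (prE nu (beta_measurable IS bu)).
have := mulr_gt0 u0 A0 => h1 h2.
by have := lt_le_trans h1 h2; rewrite pmulr_rgt0 ?expR_gt0.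
Qed.

Lemma wcyl_pos w : (forall u, u \in w -> beta u) -> 0 < pr nu (wcyl w).
Proof.
elim: w => [_|u w IH wb] /=; first by rewrite prT ltr01.
have wb' v : v \in w -> beta v by move=> vw; apply: wb; rewrite inE vw orbT.
by apply: branch_pos; [apply: wb; rewrite mem_head|exact: wcyl_measurable|exact: IH].
Qed.

Let c2 := (C + 1) / (1 - r).
Let c1 := c2 * r + C.

Let c2E : c1 = c2 - 1.
Proof.
have /andP[r0 r1] := metric_ratio01 IS.
by rewrite /c1 /c2; field; rewrite subr_eq0 gt_eqF.
Qed.

Let c20 : 1 <= c2.
Proof.
have /andP[r0 r1] := metric_ratio01 IS.
by rewrite /c2 ler_pdivlMr ?subr_gt0//; have := C0; lra.
Qed.

Lemma push_word_regular k w p : words beta k.+1 w -> regular nu it r c2 p ->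
  regular nu it r c1 (push_charge (iter k.+1 sigma) (wcyl w) p).
Proof.
elim: k w p => [|k IH] [|u w] p [//= [sw] wb] rp.
  have bu : beta u by apply: wb; rewrite mem_head.
  move: wb; rewrite (size0nil sw) => _.
  by have := push_regular IS C0 dist bu rp; rewrite /push_charge /= preimage_setT setIT.
have bu : beta u by apply: wb; rewrite mem_head.
have wb' v : v \in w -> beta v by move=> vw; apply: wb; rewrite inE vw orbT.
have rp' : regular nu it r c2 (push_charge sigma (cyl u) p).
  have h := push_regular IS C0 dist bu rp.
  by apply: (regularW (metric_ratio01 IS) _ h); rewrite -/c1 c2E gerBl.
have := IH w _ (conj sw wb') rp'; congr (regular _ _ _ _ _).
apply/funext => A; rewrite /push_charge; congr p.
rewrite -setIA; congr (_ `&` _); apply/seteqP; split=> x /=; by rewrite -!iterS !iterSr.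
Qed.

Lemma letters_cover : exists2 N, measurable N /\ nu N = 0%E &
  forall x, (exists2 a, a \in fset_set F & a x) \/ N x.
Proof.
exists (~` Omega); last first.
  move=> x; have [|] := pselect (Omega x); last by right.
  rewrite (is_OmE IS) => -[a Fa ax]; left; exists a => //.
  by rewrite in_fset_set ?inE//; exact: (is_Ffin IS).
have mO := Omega_measurable IS; split; first exact: measurableC.
rewrite (is_nuE IS); last exact: measurableC.
by rewrite setICl measure0 mule0.
Qed.

Lemma mem_letters a : a \in fset_set F -> F a.
Proof. by rewrite in_fset_set ?inE//; exact: (is_Ffin IS). Qed.

Lemma wcyl_approx k (W1 : seq (seq (seq (set X)))) (e : R) :
  (forall w, w \in W1 -> words beta k w) -> 0 < e ->
  exists W0, [/\ uniq W0, forall w, w \in W0 -> words beta k w, {subset W1 <= W0} &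
    exists2 C, measurable C /\ pr nu C < e &
    forall x, (exists2 w, w \in W0 & wcyl w x) \/ C x].
Proof.
move=> W1J e0.
have [||||x _|W0 [uW0 W0J sub [D mD cov]]] := finite_subcover (mu := nu) (J := words beta k) (F := wcyl)
  (A := setT) (N := ~` \bigcup_(w in words beta k) wcyl w) _ _ _ _ _ W1J e0.
- exact: (countable_words _ (beta_countable IS)).
- by move=> w [_]; exact: wcyl_measurable.
- exact: wcyl_cover.
- exact: measurableT.
- by have [[w ww wx]|] := pselect ((\bigcup_(w in words beta k) wcyl w) x); [left; exists w|right].
by exists W0; split=> //; exists D => // x; exact: cov.
Qed.

Variables (H : set G) (k : nat) (dl c0 : R) (b0 : set X).
Hypothesis dl01 : 0 < dl <= 1.
Hypothesis c00 : 0 < c0.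
Hypothesis Fb0 : F b0.
Hypothesis spread : forall a, F a -> exists W1 : seq (seq (seq (set X))),
  [/\ forall w, w \in W1 ->
        [/\ words beta k.+1 w, head set0 (head [::] w) = a & c0 <= pr nu (wcyl w)] &
   forall xi : set G -> R, vec H xi -> exists w1 w2, [/\ w1 \in W1, w2 \in W1 &
     dl * nsq xi <=
     nsq (fun v => trans (word_value w1 b0) xi v - trans (word_value w2 b0) xi v)]].

Lemma cocycle_decay : exists2 lam : R, 0 <= lam < 1 &
  forall v o n, right_cosets H v ->
    pr nu [set x | rtranslate v (cocycle sigma kap n x) = o] <= lam ^+ (n %/ k.+1).
Proof.
have MM := is_MM IS.
have mF a : a \in fset_set F -> measurable a.
  by move=> /mem_letters /(is_Fal IS); exact: (alpha_measurable MM).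
have dF a b : a \in fset_set F -> b \in fset_set F -> a != b -> a `&` b = set0.
  move=> /mem_letters /(is_Fal IS) aa /mem_letters /(is_Fal IS) ab /eqP neq.
  by apply/seteqP; split=> // x [ax bx]; apply: neq; exact: (alpha_eq MM aa ab ax bx).
have b0L : b0 \in fset_set F by rewrite in_fset_set ?inE//; exact: (is_Ffin IS).
have c12 : c1 < c2 by rewrite c2E gtrBl.
have c10 : 0 <= c1 by rewrite c2E subr_ge0.
have mco n : group_measurable (cocycle sigma kap n).
  apply: group_measurable_cocycle => //; first exact: (sigma_measurable IS).
  exact: (kappa_measurable IS).
have mZ w : words beta k.+1 w -> measurable (wcyl w) by move=> [_]; exact: wcyl_measurable.
have dZ w w' : words beta k.+1 w -> words beta k.+1 w' -> w != w' -> wcyl w `&` wcyl w' = set0.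
  move=> ww ww' /eqP neq; apply/seteqP; split=> // x [wx w'x]; apply: neq.
  exact: (wcyl_eq ww ww' wx w'x).
have fwP w : words beta k.+1 w -> head set0 (head [::] w) \in fset_set F /\
    wcyl w `<=` head set0 (head [::] w).
  case: w => [[]//|u w] [_ wb] /=.
  have [Fu sub] := beta_Omega IS (wb u (mem_head _ _)).
  split; last by move=> x [/sub].
  by rewrite in_fset_set ?inE//; exact: (is_Ffin IS).
have gwP w b : words beta k.+1 w -> b \in fset_set F ->
    exists2 N, measurable N /\ nu N = 0%E & forall x, wcyl w x -> b (iter k.+1 sigma x) ->
      cocycle sigma kap k.+1 x = word_value w b \/ N x.
  move=> [sw wb] /mem_letters Fb; have [N [mN N0 sub]] := word_valueP wb Fb.
  exists N => // x wx bx; have [|neq] := pselect (cocycle sigma kap k.+1 x = word_value w b).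
    by left.
  by right; apply: sub; rewrite /= sw; split.
have spread' a : a \in fset_set F -> exists W1 : seq (seq (seq (set X))),
  [/\ forall w, w \in W1 ->
        [/\ words beta k.+1 w, head set0 (head [::] w) = a & c0 <= pr nu (wcyl w)] &
   forall xi : set G -> R, vec H xi -> exists w1 w2, [/\ w1 \in W1, w2 \in W1 &
     dl * nsq xi <=
     nsq (fun v => trans (word_value w1 b0) xi v - trans (word_value w2 b0) xi v)]].
  by move=> aF; apply: spread; exact: mem_letters.
have b0p : 0 < pr nu b0 by exact: F_pos.
exists (contraction_rate nu c1 c2 dl c0 b0).
  exact: (contraction_rate01 c10 c12 mF dl01 c00 b0L b0p).
set lam := contraction_rate _ _ _ _ _ _.
have /andP[lam0 lam1] : 0 <= lam < 1.
  exact: (contraction_rate01 c10 c12 mF dl01 c00 b0L b0p).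
move=> v o n Vv.
have mhits j u : measurable (hits o (cocycle sigma kap j) u).
  exact: (mco j [set g | rtranslate u g = o]).
have bound j s : norm_bound nu H o it r c2 (fset_set F) (lam ^+ j)
    (cocycle sigma kap (j * k.+1 + s)).
  elim: j => [|j IH]; first by rewrite expr0; apply: norm_bound1.
  have E : cocycle sigma kap (j.+1 * k.+1 + s) = fun x => (cocycle sigma kap k.+1 x *
      cocycle sigma kap (j * k.+1 + s) (iter k.+1 sigma x))%g.
    by apply/funext => x; rewrite -cocycleD mulSn addnA.
  rewrite E exprS.
  apply: (norm_bound_step (metric_ratio01 IS) c10 c12 (fset_uniq _) mF dF letters_cover mZ dZ fwP
    (iter_sigma_measurable k.+1) (fun p w ww rp => push_word_regular ww rp) gwP
    (@wcyl_approx k.+1) dl01 c00 b0L spread') => //.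
  - exact: exprn_ge0.
  - by move=> u; have := mhits (j.+1 * k.+1 + s)%N u; rewrite E.
rewrite {1}(divn_eq n k.+1).
set j := (n %/ k.+1)%N; set s := (n %% k.+1)%N.
pose xi u : R := (u == v)%:R.
have xi0 u : u \notin [fset v]%fset -> xi u = 0 by rewrite inE /xi => /negPf ->.
have vxi : vec H xi.
  split=> [|u|u nVu]; first by apply/fsuppP; exists [fset v]%fset.
    by rewrite /xi ler0n.
  by rewrite /xi; case: eqP => // uv; rewrite uv in nVu.
have nxi : nsq xi <= 1 ^+ 2.
  rewrite /nsq (fsumE (K := [fset v]%fset)) => [|u /xi0 ->]; last by rewrite expr0n.
  by rewrite big_seq_fset1 /xi eqxx.
have prr := pr_regular nu it (metric_ratio01 IS) (le_trans ler01 c20).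
have ch := pr_charge nu.
have [N [mN N0] cov] := letters_cover.
have := charge_le_sum ch (s := fset_set F) (B := id) (mhits (j * k.+1 + s)%N v) mN mF (fun x _ => cov x).
rewrite (regular_null prr mN N0) addr0 => /le_trans; apply.
apply: (@le_trans _ _ (\sum_(a <- fset_set F) lam ^+ j * pr nu a)).
  rewrite [leLHS]big_seq [leRHS]big_seq; apply: ler_sum => a aF.
  have := bound j s _ _ _ 1 prr aF vxi ler01 nxi.
  rewrite mulr1 (fsumE (K := [fset v]%fset)) => [|u /xi0 ->]; last by rewrite mul0r.
  by rewrite big_seq_fset1 /xi eqxx mul1r setIC.
rewrite -mulr_sumr ler_piMr ?exprn_ge0// -(prT nu).
have -> : \sum_(a <- fset_set F) pr nu a = \sum_(a <- fset_set F) pr nu (setT `&` id a).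
  by apply: eq_bigr => a _; rewrite setTI.
exact: (charge_sum_le (B := id) ch measurableT mF (fset_uniq _) dF).
Qed.

End InducedWords.

(** * Loops and exponential decay in induced time *)

Section SameAction.
Context {G : groupType}.
Variable H : set G.
Hypothesis sH : subgroup H.

Let H1 : H 1%g.
Proof. by have [+ _] := sH; rewrite inE. Qed.

Let HM x y : H x -> H y -> H (x * y)%g.
Proof.
by move=> Hx Hy; have := group_closedM sH (mem_set Hx) (mem_set Hy); rewrite inE.
Qed.

Let HV x : H x -> H x^-1%g.
Proof. by move=> Hx; have := group_closedV sH (mem_set Hx); rewrite inE. Qed.

Definition same_action (g h : G) :=
  forall v, right_cosets H v -> rtranslate v g = rtranslate v h.

Lemma same_actionM g g' h h' : same_action g g' -> same_action h h' ->
  same_action (g * h)%g (g' * h')%g.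
Proof.
move=> gg' hh' v Vv; rewrite -!rtranslateM gg'// hh'//.
exact: right_cosets_translate.
Qed.

Lemma same_action_trans (R : realType) g h (xi : set G -> R) : same_action g h ->
  vec H xi -> trans g xi = trans h xi.
Proof.
move=> gh [_ _ xiV]; apply/funext => v; rewrite /trans.
have [Vv|Vv] := pselect (right_cosets H v).
  congr xi; rewrite -[LHS](rtranslateK _ h) -gh; last exact: right_cosets_translate.
  by rewrite rtranslateVK.
have nV k : ~ right_cosets H (rtranslate v k^-1%g).
  by move=> /(@right_cosets_translate _ _ _ k); rewrite rtranslateVK.
by rewrite !xiV.
Qed.

Lemma normal_core_action g h :
  right_coset (normal_core H) g = right_coset (normal_core H) h -> same_action g h.
Proof.
move=> E; have core1 : normal_core H 1%g by move=> x _; exists 1%g => //; rewrite mulg1 mulgV.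
have : right_coset (normal_core H) g g by exists 1%g => //; rewrite mul1g.
rewrite E => -[c cc cE] _ [x _ <-].
have [y Hy yc] := cc x^-1%g I; rewrite invgK in yc.
have xc : (x * c = y * x)%g by rewrite -yc mulgA mulVKg.
rewrite /right_coset !rtranslateM -cE mulgA xc; apply/seteqP.
split=> [_ [z Hz <-]|_ [z Hz <-]].
  by exists (z * y)%g; [exact: HM|rewrite !mulgA].
by exists (z * y^-1)%g; [apply: HM => //; exact: HV|rewrite !mulgA mulgVK].
Qed.

Lemma same_action_refl g : same_action g g. Proof. by []. Qed.

End SameAction.

Section Returns.
Context {R : realType} {d : measure_display} {X : measurableType d}.
Variables (mu nu : probability X R) (theta : X -> X) (alpha : set (set X)).
Variables (Omega : set X) (F : set (set X)) (beta : set (seq (set X))).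
Variables (eta : seq (set X) -> nat) (r : R).
Hypothesis IS : induced_system mu nu theta alpha Omega F beta eta r.
Local Notation sigma := (induced_map theta beta eta).
Local Notation etax := (return_time theta beta eta).
Local Notation etak := (etak theta beta eta).
Local Notation cyl := (cylinder theta).
Hypothesis eta_pos : forall u, beta u -> (0 < eta u)%N.

(* Measurable substitute for the set of points where eta^dagger > M: the time
   to the next sigma-return is larger than M along some orbit. *)
Definition late M : set X := Omega `&`
  \bigcup_(u in beta) \bigcup_(l in [set l | (M + l < eta u)%N])
    (iter l theta @` cyl u).

Lemma late_measurable M : measurable (late M).
Proof.
apply: measurableI; first exact: (Omega_measurable IS).
apply: measurable_bigcup_countable (beta_countable IS) _ => u bu.
apply: bigcup_measurable => l _.
apply: (measurable_image_iter (is_MM IS)); exact: (beta_measurable IS).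
Qed.

Lemma le_late M M' : (M <= M')%N -> late M' `<=` late M.
Proof.
move=> MM' x [Ox [u bu [l lt ux]]]; split=> //; exists u => //; exists l => //=.
by apply: leq_ltn_trans lt; rewrite leq_add2r.
Qed.

Hypothesis dagger : exists2 etad : X -> option nat,
     {ae mu, forall x, Omega x -> etad x <> None} &
     {ae mu, forall x, Omega x ->
        forall l, (l < etax x)%N -> Omega (iter l theta x) ->
        forall k, etad (iter l theta x) = Some k -> (etax x - l <= k)%N}.

Lemma late_null : mu.-negligible (\bigcap_M late M).
Proof.
have [etad n1 n2] := dagger.
apply: (negligibleS (A := ~` [set x | Omega x -> etad x <> None] `|`
  \bigcup_(l in [set: nat]) (iter l theta @` ~` [set x | Omega x ->
        forall l, (l < etax x)%N -> Omega (iter l theta x) ->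
        forall k, etad (iter l theta x) = Some k -> (etax x - l <= k)%N]))).
  move=> y ly; have [Oy _] := ly 0%N I.
  case ey : (etad y) => [k|]; last by left => h; exact: (h Oy).
  have [_ [u bu [l /= lt [x ux yE]]]] := ly k I.
  right; exists l => //; exists x => // h.
  have xu : etax x = eta u by exact: (return_timeE IS bu ux).
  have := h (cylinder_beta_Omega IS bu ux) l; rewrite xu yE => /(_ _ Oy k ey).
  have lu : (l < eta u)%N by apply: leq_ltn_trans lt; exact: leq_addl.
  by move=> /(_ lu); rewrite leqNgt ltn_subRL addnC lt.
apply: negligibleU; first exact: n1.
apply: negligible_bigcup_countable => // l _.
exact: (negligible_image_iter (is_MM IS) l n2).
Qed.

Lemma late_small : exists M, forall a, F a -> ~ mu.-negligible (a `\` late M).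
Proof.
have one a : F a -> exists M, ~ mu.-negligible (a `\` late M).
  move=> Fa; apply: contrapT => nM.
  have nul : mu.-negligible a.
    apply: (negligibleS (A := \bigcap_M late M `|` \bigcup_(M in [set: nat]) (a `\` late M))).
      move=> x ax; have [lx|nl] := pselect ((\bigcap_M late M) x); first by left.
      right; move/existsNP: nl => [M /not_implyP[_ nl]]; by exists M.
    apply: negligibleU late_null _; apply: negligible_bigcup => M.
    by apply: contrapT => h; apply: nM; exists M.
  have := F_pos IS Fa; have ma := alpha_measurable (is_MM IS) (is_Fal IS Fa).
  move/(negligible_mu_nu IS): nul => /negligibleP => /(_ ma).
  by move=> n0; rewrite /pr n0 /= => h; rewrite ltxx in h.
pose Mf a := if pselect (exists M, ~ mu.-negligible (a `\` late M)) is left ex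
  then projT1 (cid ex) else 0%N.
exists (\max_(a <- fset_set F) Mf a) => a Fa neg.
have : ~ mu.-negligible (a `\` late (Mf a)).
  by rewrite /Mf; case: pselect => [ex|]; [exact: (projT2 (cid ex))|move=> /(_ (one a Fa))].
apply; apply: negligibleS neg => x [ax nl]; split=> // lx; apply: nl.
apply: le_late lx; apply: (@leq_bigmax_seq _ _ xpredT) => //.
by rewrite in_fset_set ?inE//; exact: (is_Ffin IS).
Qed.

Lemma etak_ge k x : (forall i, domain theta beta (iter i sigma x)) -> (k <= etak k x)%N.
Proof.
move=> dom; elim: k => [//|k IH]; rewrite etak_recr -addn1 leq_add//.
by have [u bu ux] := dom k; rewrite (return_timeE IS bu ux) eta_pos.
Qed.

Lemma next_return M x n : (forall i, domain theta beta (iter i sigma x)) ->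
  Omega (iter n theta x) -> ~ late M (iter n theta x) ->
  exists k j, (0 < j <= M)%N /\ etak k.+1 x = (n + j)%N.
Proof.
move=> dom On nl.
have exk : exists k, (n < etak k.+1 x)%N by exists n; exact: etak_ge.
have [k nk mink] := ex_minnP exk.
have kn : (etak k x <= n)%N.
  case: k nk mink => [|k] nk mink; first by rewrite etak0.
  by rewrite leqNgt; apply/negP => /mink; rewrite ltnn.
have [u bu ux] := dom k.
have eu : etax (iter k sigma x) = eta u by exact: (return_timeE IS bu ux).
move: nk; rewrite etak_recr eu => nk.
exists k, (etak k x + eta u - n)%N; split; last by rewrite etak_recr eu; lia.
apply/andP; split; first lia.
rewrite leqNgt; apply/negP => lt; apply: nl; split=> //.
exists u => //; exists (n - etak k x)%N => /=; first lia.
exists (iter k sigma x) => //=.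
by rewrite iter_sigmaE -iterD subnK.
Qed.

End Returns.

Fixpoint products (G : groupType) (gs : seq G) (n : nat) : seq G :=
  if n is n'.+1 then 1%g :: [seq (g * h)%g | g <- gs, h <- products gs n'] else [:: 1%g].

Lemma mem_products (G : groupType) (X : Type) (T : X -> X) (g : X -> G) (gs : seq G) n m x :
  (forall y, g y \in gs) -> (n <= m)%N -> cocycle T g n x \in products gs m.
Proof.
move=> ggs; elim: m n x => [|m IH] [|n] x // nm.
- by rewrite cocycle0 mem_head.
- by rewrite cocycle0 mem_head.
rewrite cocycleS inE; apply/orP; right; apply/allpairsP.
by exists (g x, cocycle T g n (T x)); split=> //=; exact: IH.
Qed.

Lemma uniform_pos (R : realType) (T : eqType) (s : seq T) (f : T -> R) :
  (forall x, x \in s -> 0 < f x) -> exists2 c, 0 < c & forall x, x \in s -> c <= f x.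
Proof.
elim: s => [|a s IH] f0; first by exists 1.
have [|c c0 cP] := IH; first by move=> x xs; apply: f0; rewrite inE xs orbT.
exists (Num.min c (f a)); first by rewrite lt_min c0 f0// mem_head.
move=> x; rewrite inE => /predU1P[->|/cP]; rewrite ge_min ?lexx ?orbT//.
by move=> ->.
Qed.

Section LoopsAndDecay.
Context {R : realType} {d : measure_display} {X : measurableType d}.
Context {G : groupType}.
Variables (mu nu : probability X R) (theta : X -> X) (alpha : set (set X)).
Variables (Omega : set X) (F : set (set X)) (beta : set (seq (set X))).
Variables (eta : seq (set X) -> nat) (r : R) (gamma : X -> G) (H : set G).
Variable gs : seq G.
Hypothesis IS : induced_system mu nu theta alpha Omega F beta eta r.
Hypothesis cG : countable [set: G].
Hypothesis gconst : forall a x y, alpha a -> a x -> a y -> gamma x = gamma y.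
Hypothesis ggs : forall x, gamma x \in gs.
Hypothesis sH : subgroup H.
Hypothesis eta_pos : forall u, beta u -> (0 < eta u)%N.
Hypothesis small : exists M, forall a, F a -> ~ mu.-negligible (a `\` late theta Omega beta eta M).
Hypothesis transT : topologically_transitive mu theta alpha gamma (normal_core H).
Local Notation sigma := (induced_map theta beta eta).
Local Notation cyl := (cylinder theta).
Local Notation kap := (kappa theta beta eta gamma).
Local Notation wcyl := (wcyl theta beta eta).
Local Notation word_value := (word_value mu theta beta eta gamma).
Local Notation kappa_value := (kappa_value mu theta beta eta gamma).
Let MM := is_MM IS.
Let IM := is_IM IS.

Lemma iter_coset_extension n x v :
  iter n (coset_extension theta gamma) (x, v) =
  (iter n theta x, rtranslate v (cocycle theta gamma n x)).
Proof.
elim: n x v => [|n IH] x v; first by rewrite cocycle0 rtranslate1.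
by rewrite !iterSr IH /= cocycleS rtranslateM.
Qed.

Lemma transitive_word a g : alpha a -> exists n w,
  [/\ (0 < n)%N, words alpha n w, mu.-negligible (a `\` iter n theta @` cyl w),
     cyl w `<=` a & forall x, cyl w x -> same_action H (cocycle theta gamma n x) g].
Proof.
move=> aa; have [n n0 pos] := transT 1%g g aa aa.
set K := normal_core H in pos.
pose E := [set x | right_coset K (cocycle theta gamma n x) = right_coset K g].
have mE : measurable E.
  have mc : group_measurable (cocycle theta gamma n).
    apply: group_measurable_cocycle => //; first exact: (theta_measurable MM).
    exact: (gamma_measurable IS gconst).
  exact: (mc [set h | right_coset K h = right_coset K g]).
have ma := alpha_measurable MM aa.
pose Y := a `&` iter n theta @` (a `&` E).
have mY : measurable Y.
  by apply: measurableI => //; apply: (measurable_image_iter MM); exact: measurableI.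
have nY : ~ mu.-negligible Y.
  move=> /negligibleP => /(_ mY) Y0; move: pos; rewrite /prod_counting esum1 ?ltxx// => v Kv.
  rewrite (_ : [set x | _] = Y `&` [set x | v = right_coset K g]).
    have [->|vn] := pselect (v = right_coset K g).
      by rewrite (_ : [set x | _] = setT) ?setIT//; apply/seteqP; split.
    by rewrite (_ : [set x | _] = set0) ?setI0//; apply/seteqP; split.
  apply/seteqP; split=> [y [[[x u] [/= ax ->]]]|y [[ay [x [ax Ex] xy]] /= ->]].
    rewrite iter_coset_extension => -[xy vE] [ay /= vg]; split=> //; split=> //.
    exists x => //; split=> //; rewrite /E /= -vg -vE /right_coset rtranslateM.
    by rewrite mul1g.
  split=> //; exists (x, right_coset K 1%g) => //.
  rewrite iter_coset_extension xy /right_coset rtranslateM mul1g; congr (_, _).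
  exact: Ex.
have [w [ww nw]] : exists w, words alpha n w /\
    ~ mu.-negligible (a `&` iter n theta @` (a `&` E `&` cyl w)).
  apply: contrapT => nex; apply: nY; apply: (negligibleS (A :=
    \bigcup_(w in words alpha n) (a `&` iter n theta @` (a `&` E `&` cyl w)))).
    move=> y [ay [x aEx xy]]; have [w ww wx] := word_of MM n x.
    by exists w => //; split=> //; exists x.
  apply: negligible_bigcup_countable (words_countable MM n) _ => w ww.
  by apply: contrapT => h; apply: nex; exists w.
have [sw wa] := ww.
have [x0 [[ax0 Ex0] wx0]] : exists x, (a `&` E `&` cyl w) x.
  apply/not_existsP => n1; apply: nw; apply: negligibleS (negligible_set0 _).
  by move=> y [_ [x /n1]].
exists n, w; split=> //.
- have [h|] := image_cylinder_dichotomy MM wa aa; last by rewrite sw.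
  exfalso; apply: nw; apply: negligibleS h; rewrite sw => y [ay [x [_ wx] xy]].
  by split=> //; exists x.
- move=> x wx; have n0w : (0 < size w)%N by rewrite sw.
  have -> : a = nth set0 w 0.
    by apply: (alpha_eq MM aa) (ax0) (wx0 0%N n0w); exact/wa/mem_nth.
  exact: (wx 0%N n0w).
move=> x wx; apply: (normal_core_action sH).
by rewrite (cocycle_cylinder gconst wa _ wx wx0)// sw.
Qed.

Lemma typical_points : nu.-negligible (~` [set x | forall k, exists w c,
  [/\ words beta k w, wcyl w x, F c, c (iter k sigma x) &
      cocycle sigma kap k x = word_value w c]]).
Proof.
have nO : nu.-negligible (~` Omega).
  by apply/(negligible_nu IS); rewrite setICl; exact: negligible_set0.
pose bad k := ~` (\bigcup_(w in words beta k) wcyl w) `|` iter k sigma @^-1` (~` Omega) `|`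
  \bigcup_(w in words beta k) \bigcup_(c in F)
   [set x | [/\ wcyl w x, c (iter k sigma x) & cocycle sigma kap k x <> word_value w c]].
apply: (negligibleS (A := \bigcup_(k in [set: nat]) bad k)).
  move=> x nx; apply: contrapT => nb; apply: nx => k.
  have [[w ww wx]|h] := pselect ((\bigcup_(w in words beta k) wcyl w) x); last first.
    by case: nb; exists k => //; left; left.
  have [|h] := pselect (Omega (iter k sigma x)); last first.
    by case: nb; exists k => //; left; right.
  rewrite (is_OmE IS) => -[c Fc cx]; exists w, c; split=> //.
  apply: contrapT => h; case: nb; exists k => //; right; exists w => //.
  by exists c.
apply: negligible_bigcup => k; apply: negligibleU; first apply: negligibleU.
- exact: (wcyl_cover IS).
- exact: (negligible_preimage_iter_sigma IS).
apply: negligible_bigcup_countable (countable_words _ (beta_countable IS)) _ => w [sw wb].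
apply: negligible_bigcup_countable (finite_set_countable (is_Ffin IS)) _ => c Fc.
by rewrite -sw; exact: (word_valueP IS gconst).
Qed.

Lemma typical_domain x : (forall k, exists w c,
  [/\ words beta k w, wcyl w x, F c, c (iter k sigma x) &
      cocycle sigma kap k x = word_value w c]) ->
  forall i, domain theta beta (iter i sigma x).
Proof.
move=> typ i; have [w [_ [[sw wb] wx _ _ _]]] := typ i.+1.
elim: i x w sw wb wx {typ} => [|i IH] x [|u w] //= [sw] wb [ux wx].
  by exists u => //; apply: wb; rewrite mem_head.
rewrite -iterS iterSr; apply: IH wx => // v vw.
by apply: wb; rewrite inE vw orbT.
Qed.

Lemma letter_in c : F c -> exists u, beta u /\ head set0 u = c.
Proof.
move=> Fc; have [x [cx [u bu ux]]] : exists x, c x /\ domain theta beta x.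
  apply: contrapT => nx; have := F_pos IS Fc; have mc := alpha_measurable MM (is_Fal IS Fc).
  have nc : nu.-negligible c.
    by apply: negligibleS (domain_conegligible IS) => x cx dx; apply: nx; exists x.
  move/negligibleP: nc => /(_ mc) n0.
  by rewrite /pr n0 /= ltxx.
exists u; split=> //; have [Fu sub] := beta_Omega IS bu.
by apply: (alpha_eq MM) (sub _ ux) cx; exact: (is_Fal IS).
Qed.

Definition loop a k g := exists w, [/\ words beta k w, (0 < k)%N,
  head set0 (head [::] w) = a & same_action H (word_value w a) g].

Lemma loopM a k l g h : loop a k g -> loop a l h -> loop a (k + l) (g * h)%g.
Proof.
move=> [w [[sw wb] k0 hw wg]] [w' [[sw' wb'] l0 hw' wh]].
exists (w ++ w'); split.
- split; first by rewrite size_cat sw sw'.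
  by move=> u; rewrite mem_cat => /orP[/wb|/wb'].
- by rewrite addn_gt0 k0.
- by case: (w) sw hw => //= k00; rewrite -k00 in k0.
case: w' sw' wb' hw' wh => [|u w'] sw' wb' hu wh; first by rewrite -sw' in l0.
rewrite /= in hu.
rewrite word_value_cat hu; exact: (same_actionM wg wh).
Qed.

Lemma loop_cover a : F a -> exists Q : seq G, forall g,
  exists2 q, q \in Q & exists k, loop a k (g * q)%g.
Proof.
move=> Fa; have [M Msmall] := small; have aa := is_Fal IS Fa.
pose uc c := if pselect (exists u, beta u /\ head set0 u = c) is left ex
  then projT1 (cid ex) else [::].
have ucP c : F c -> beta (uc c) /\ head set0 (uc c) = c.
  move=> Fc; rewrite /uc; case: pselect => [ex|]; first exact: (projT2 (cid ex)).
  by move=> /(_ (letter_in Fc)).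
exists [seq (p * kappa_value (uc c) a)%g | p <- products gs M, c <- fset_set F] => g.
have [n [w [n0 [sw wa] cov wsub wg]]] := transitive_word g aa.
pose P := cyl w `&` iter n theta @^-1` (a `\` late theta Omega beta eta M).
have nP : ~ nu.-negligible P.
  move=> /(negligible_nu IS) nP; apply: (Msmall a Fa).
  apply: (negligibleS (A := iter n theta @` (P `&` Omega) `|` (a `\` iter n theta @` cyl w))).
    move=> y [ay nl]; have [[x wx xy]|ny] := pselect ((iter n theta @` cyl w) y); last by right.
    left; exists x => //; split; last by apply: (F_Omega IS Fa); exact: wsub.
    by split=> //; rewrite /preimage /= xy.
  by apply: negligibleU => //; exact: (negligible_image_iter MM).
have [x [Px typ]] : exists x, P x /\ forall k, exists w c,
  [/\ words beta k w, wcyl w x, F c, c (iter k sigma x) &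
      cocycle sigma kap k x = word_value w c].
  apply: contrapT => nx; apply: nP; apply: negligibleS typical_points => x Px typ.
  by apply: nx; exists x.
have [wx [ay nl]] := Px.
have [k [j [/andP[j0 jM] ek]]] := next_return IS eta_pos (typical_domain typ)
  (F_Omega IS Fa ay) nl.
have [w1 [c [[sw1 w1b] w1x Fc cx E]]] := typ k.+1.
have [buc huc] := ucP c Fc.
exists (cocycle theta gamma j (iter n theta x) * kappa_value (uc c) a)%g.
  apply/allpairsP; exists (cocycle theta gamma j (iter n theta x), c); split=> //=.
    exact: mem_products.
  by rewrite in_fset_set ?inE//; exact: (is_Ffin IS).
exists k.+2, (w1 ++ [:: uc c]); split=> //.
- split; first by rewrite size_cat sw1 addn1.
  by move=> u; rewrite mem_cat inE => /orP[/w1b//|/eqP->].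
- case: w1 sw1 w1b w1x {E} => //= u w1 _ w1b [ux _].
  have [Fu sub] := beta_Omega IS (w1b u (mem_head _ _)).
  by apply: (alpha_eq MM) (sub _ ux) (wsub _ wx) => //; exact: (is_Fal IS).
rewrite word_value_cat huc -E /= mulg1 mulgA.
apply: same_actionM; last exact: same_action_refl.
rewrite cocycle_kappa ek cocycleD; apply: same_actionM; last exact: same_action_refl.
exact: wg.
Qed.

Lemma F_nonempty : exists a, F a.
Proof.
apply: contrapT => nF; have := Omega_pos IS.
rewrite (_ : Omega = set0) ?(charge_set0 (pr_charge mu)) ?ltxx//.
by rewrite (is_OmE IS); apply/seteqP; split=> // x [a Fa _]; apply: nF; exists a.
Qed.

Lemma loopX a k g n : loop a k g -> loop a (k * n.+1) (g ^+ n.+1)%g.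
Proof.
move=> lg; elim: n => [|n IH]; first by rewrite muln1 expg1.
by rewrite mulnS expgS; exact: loopM.
Qed.

Lemma word_loop a u : F a -> beta u -> head set0 u = a -> loop a 1 (kappa_value u a).
Proof.
move=> Fa bu hu; exists [:: u]; split=> //; last by rewrite /= mulg1.
by split=> // v; rewrite inE => /eqP ->.
Qed.

Variable dx : R.
Hypothesis dx0 : 0 < dx.
Hypothesis expan : expanding H gs dx.

(* One length k carries loops for the identity and for a set of elements that
   moves every vector. *)
Lemma expanding_loops a : F a -> exists2 c : R, 0 < c & exists2 k, (0 < k)%N &
  exists2 L : seq G, (forall e, e \in 1%g :: L -> loop a k e) &
    forall xi : set G -> R, vec H xi -> exists2 e, e \in L &
      c * nsq xi <= nsq (fun v => trans e xi v - xi v).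
Proof.
move=> Fa.
have [Q cov] := loop_cover Fa.
have [k0 lk0] : exists k, loop a k 1%g.
  apply: (@cocompact_semigroup_id _ [set g | exists k, loop a k g] Q) => [x y [k lx] [l ly]|].
    by exists (k + l)%N; exact: loopM.
  by move=> g; have [q qQ lq] := cov g; exists q.
have k00 : (0 < k0)%N by case: lk0 => w [].
have [u [bu hu]] := letter_in Fa.
pose e1 := kappa_value u a.
have le1 : loop a 1 e1 by exact: word_loop.
pose E := [set g | exists2 j, (0 < j)%N & loop a (j * k0) g].
pose Q' := [seq (q * e1 ^+ t.+1)%g | q <- Q, t <- iota 0 k0].
have EM x y : E x -> E y -> E (x * y)%g.
  move=> [i i0 lx] [j j0 ly]; exists (i + j)%N; first by rewrite addn_gt0 i0.
  by rewrite mulnDl; exact: loopM.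
have EQ g : exists2 q, q \in Q' & E (g * q)%g.
  have [q qQ [k lq]] := cov g.
  pose t := (k0 - k %% k0).-1.
  have tk : (k %% k0 < k0)%N by rewrite ltn_pmod.
  exists (q * e1 ^+ t.+1)%g.
    apply/allpairsP; exists (q, t); split=> //=; rewrite mem_iota /t; lia.
  exists (k %/ k0).+1 => //; rewrite mulgA.
  have -> : ((k %/ k0).+1 * k0 = k + 1 * t.+1)%N.
    by rewrite {2}(divn_eq k k0) mulSn /t; lia.
  exact: loopM lq (loopX t le1).
have [c c0 [L LE Lm]] := expanding_semigroup dx0 expan EM EQ.
have pad i j g : loop a (i * k0) g -> loop a ((i + j) * k0) g.
  move=> lg; elim: j => [|j IH]; first by rewrite addn0.
  by rewrite addnS mulSn addnC -[g]mulg1; exact: loopM.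
have [J [J0 JL]] : exists J, (0 < J)%N /\ forall e, e \in L -> loop a (J * k0) e.
  elim: (L) LE => [|e s IH] sE; first by exists 1%N.
  have [|J [J0 JP]] := IH; first by move=> x xs; apply: sE; rewrite inE xs orbT.
  have [i i0 li] := sE e (mem_head _ _); exists (i + J)%N; split; first by rewrite addn_gt0 i0.
  move=> x; rewrite inE => /predU1P[->|/JP lx]; first exact: pad.
  by rewrite addnC; exact: pad.
exists c => //; exists (J * k0)%N; first by rewrite muln_gt0 J0.
exists L => // e; rewrite inE => /predU1P[->|/JL//].
have := pad 1%N J.-1 1%g; rewrite mul1n add1n prednK//; exact.
Qed.

Lemma expanding_decay : exists k (lam : R), [/\ (0 < k)%N, 0 <= lam < 1 &
  forall v o n, right_cosets H v ->
    pr nu [set x | rtranslate v (cocycle sigma kap n x) = o] <= lam ^+ (n %/ k)].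
Proof.
have [C C0 dist] := branch_distortion IS.
have [a0 Fa0] := F_nonempty.
have [c c_gt0 [k k0 [L Lloop Lm]]] := expanding_loops Fa0.
pose Wd e := if pselect (loop a0 k e) is left l then projT1 (cid l) else [::].
have WdP e : e \in 1%g :: L -> [/\ words beta k (Wd e), head set0 (head [::] (Wd e)) = a0 &
    same_action H (word_value (Wd e) a0) e].
  move=> eL; rewrite /Wd; case: pselect => [l|/(_ (Lloop e eL))//].
  by have [] := projT2 (cid l).
pose uc a := if pselect (exists u, beta u /\ head set0 u = a) is left ex
  then projT1 (cid ex) else [::].
have ucP a : F a -> beta (uc a) /\ head set0 (uc a) = a.
  move=> Fa; rewrite /uc; case: pselect => [ex|]; first exact: (projT2 (cid ex)).
  by move=> /(_ (letter_in Fa)).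
have wP a e : F a -> e \in 1%g :: L -> words beta k.+1 (uc a :: Wd e).
  move=> Fa eL; have [[sw wb] _ _] := WdP e eL; have [bu _] := ucP a Fa.
  by split=> [/=|v]; [rewrite sw|rewrite inE => /predU1P[->//|/wb]].
have [c0 c00 c0P] : exists2 c0 : R, 0 < c0 &
    forall p, p \in [seq (a, e) | a <- fset_set F, e <- 1%g :: L] ->
      c0 <= pr nu (wcyl (uc p.1 :: Wd p.2)).
  apply: uniform_pos => -[a e] /allpairsP[[a' e'] [/= aF eL [-> ->]]].
  have [_ wb] := wP a' e' (mem_letters IS aF) eL.
  exact: (wcyl_pos IS dist wb).
pose dl := Num.min 1 c.
have dl01 : 0 < dl <= 1 by rewrite lt_min ltr01 c_gt0 ge_min lexx.
have spread a : F a -> exists W1 : seq (seq (seq (set X))),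
  [/\ forall w, w \in W1 ->
        [/\ words beta k.+1 w, head set0 (head [::] w) = a &
            c0 <= pr nu (wcyl w)] &
   forall xi : set G -> R, vec H xi -> exists w1 w2, [/\ w1 \in W1, w2 \in W1 &
     dl * nsq xi <=
     nsq (fun v => trans (word_value w1 a0) xi v - trans (word_value w2 a0) xi v)]].
  move=> Fa; have [bu hu] := ucP a Fa; have aF : a \in fset_set F.
    by rewrite in_fset_set ?inE//; exact: (is_Ffin IS).
  exists [seq uc a :: Wd e | e <- 1%g :: L]; split.
    move=> _ /mapP[e eL ->]; split=> //; first exact: wP.
    by apply: (c0P (a, e)); apply/allpairsP; exists (a, e).
  move=> xi vxi; set zeta := trans (kappa_value (uc a) a0) xi.
  have vz : vec H zeta by exact: vec_trans.
  have val e : e \in 1%g :: L -> trans (word_value (uc a :: Wd e) a0) xi = trans e zeta.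
    move=> eL; have [[sw wb] hw we] := WdP e eL.
    have -> : word_value (uc a :: Wd e) a0 = (kappa_value (uc a) a0 * word_value (Wd e) a0)%g.
      rewrite /=; case: (Wd e) sw hw k0 => [|v w'] /= swk; first by rewrite -swk.
      by move=> <- _.
    by rewrite -transM; exact: (same_action_trans we vz).
  have [e eL le] := Lm zeta vz.
  have eL1 : e \in 1%g :: L by rewrite inE eL orbT.
  exists (uc a :: Wd e), (uc a :: Wd 1%g); split; [exact: map_f|exact/map_f/mem_head|].
  rewrite !val ?mem_head// trans1; apply: le_trans le.
  by rewrite nsq_trans ler_wpM2r ?nsq_ge0// ge_min lexx orbT.
have [lam lam01 lamP] := cocycle_decay IS cG gconst C0 dist dl01 c00 Fa0 spread.
by exists k.+1, lam.
Qed.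

End LoopsAndDecay.



(** * Comparison of the two time scales *)

Section ExponentialDecay.
Context {R : realType}.
Implicit Types (a : nat -> R) (z K : R).

Lemma geometric_le (q : R) n : 0 <= q < 1 -> \sum_(i < n) q ^+ i <= (1 - q)^-1.
Proof.
move=> /andP[q0 q1]; have q1' : 0 < 1 - q by rewrite subr_gt0.
have E : (1 - q) * \sum_(i < n) q ^+ i = 1 - q ^+ n.
  elim: n => [|n IH]; first by rewrite big_ord0 mulr0 expr0 subrr.
  by rewrite big_ord_recr /= mulrDr IH exprS; ring.
by rewrite -[leRHS]mulr1 ler_pdivlMl// E gerBl exprn_ge0.
Qed.

Lemma bernoulli_le (t : R) n : 0 <= t -> 1 + n%:R * t <= (1 + t) ^+ n.
Proof.
move=> t0; elim: n => [|n IH]; first by rewrite mul0r addr0 expr0.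
rewrite exprS; apply: le_trans (ler_wpM2l _ IH); last by rewrite addr_ge0.
rewrite -natr1; have : 0 <= n%:R * t * t by rewrite !mulr_ge0.
lra.
Qed.

Lemma bernoulli_sub (t : R) n : 0 <= t <= 1 -> 1 - n%:R * t <= (1 - t) ^+ n.
Proof.
move=> /andP[t0 t1]; elim: n => [|n IH]; first by rewrite mul0r subr0 expr0.
rewrite exprS; apply: le_trans (ler_wpM2l _ IH); last by rewrite subr_ge0.
rewrite -natr1; have : 0 <= n%:R * t * t by rewrite !mulr_ge0.
lra.
Qed.

Lemma expr_unbounded (y B : R) : 1 < y -> exists2 D, (0 < D)%N & B <= y ^+ D.
Proof.
move=> y1; pose t := y - 1; have t0 : 0 < t by rewrite subr_gt0.
have [n nB] : exists n : nat, B / t <= n%:R.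
  by exists (Num.truncn (Num.max (B / t) 0)).+1; rewrite (le_trans _ (ltW (truncnS_gt _)))// le_max lexx.
exists n.+1 => //; have -> : y = 1 + t by rewrite /t; ring.
apply: le_trans (bernoulli_le n.+1 (ltW t0)); move: nB; rewrite ler_pdivrMr// -natr1.
lra.
Qed.

Definition exp_decay a := exists K z, [/\ 0 <= K, 0 < z < 1 &
  exists N, forall n, (N <= n)%N -> a n <= K * z ^+ n].

Lemma exp_decay_subexp (c : nat -> R) K z a M : (forall s : R, 1 < s ->
    exists N, forall n, (N <= n)%N -> expR (c n) <= s ^+ n) ->
  0 <= K -> 0 < z < 1 ->
  (exists N, forall n, (N <= n)%N -> a n <= expR (c n) * ((n + M)%:R * K * z ^+ n)) ->
  exp_decay a.
Proof.
move=> sub K0 /andP[z0 z1] [N aN].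
have mid (y : R) : 0 < y < 1 -> exists2 s, 1 < s & 0 < s * y < 1.
  move=> /andP[y0 y1]; exists ((1 + y^-1) / 2).
    have : 1 < y^-1 by rewrite invf_gt1.
    lra.
  have -> : (1 + y^-1) / 2 * y = (y + 1) / 2 by field; rewrite gt_eqF.
  by apply/andP; split; lra.
have [s s1 sz] := mid z (introT andP (conj z0 z1)).
have [s' s'1 s'z] := mid _ sz.
pose t := s - 1; have t0 : 0 < t by rewrite subr_gt0.
have [N' cN] := sub s' s'1.
exists (K * (t^-1 + M%:R)), (s' * (s * z)); split => //.
  by rewrite mulr_ge0// addr_ge0// invr_ge0 ltW.
exists (maxn N N') => n; rewrite geq_max => /andP[/aN an /cN cn].
apply: (le_trans an); rewrite exprMn exprMn.
have sn : (n + M)%:R <= (t^-1 + M%:R) * s ^+ n.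
  have -> : s = 1 + t by rewrite /t; ring.
  have B := bernoulli_le n (ltW t0).
  have X1 : 1 <= (1 + t) ^+ n by rewrite exprn_ege1// lerDl ltW.
  have e : t^-1 * (1 + n%:R * t) = t^-1 + n%:R by field; rewrite gt_eqF.
  have := ler_wpM2l (ltW (_ : 0 < t^-1)) B; rewrite invr_gt0 => /(_ t0).
  have : M%:R <= M%:R * (1 + t) ^+ n by rewrite ler_peMr.
  have : 0 < t^-1 by rewrite invr_gt0.
  rewrite natrD e mulrDl; lra.
have zn : 0 <= K * z ^+ n by rewrite mulr_ge0// exprn_ge0// ltW.
apply: (@le_trans _ _ (s' ^+ n * ((t^-1 + M%:R) * s ^+ n * (K * z ^+ n)))).
  apply: ler_pM; [exact: expR_ge0|by rewrite -mulrA mulr_ge0|exact: cn|].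
  by rewrite -mulrA; apply: ler_wpM2r.
by rewrite le_eqVlt; apply/orP; left; apply/eqP; ring.
Qed.

Lemma exp_div (lam : R) N : 0 <= lam < 1 -> (0 < N)%N ->
  exists K z, [/\ 0 <= K, 0 < z < 1 & forall n, lam ^+ (n %/ N) <= K * z ^+ n].
Proof.
move=> /andP[l0 l1] N0; pose l := Num.max lam 2^-1.
have lb : 2^-1 <= l < 1 by rewrite le_max lexx orbT gt_max l1/= invf_lt1//; lra.
case/andP: lb => lb lb1.
have NR : (1 : R) <= N%:R by rewrite ler1n.
have N0R : (0 : R) < N%:R by rewrite ltr0n.
pose t := (1 - l) / N%:R.
have tP : 0 < t <= 2^-1.
  rewrite divr_gt0 ?subr_gt0//= ler_pdivrMr//.
  have : (0 : R) < 2^-1 by rewrite invr_gt0.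
  nra.
case/andP: tP => t0 t12.
have z0 : 0 < 1 - t by lra.
have zN : lam <= (1 - t) ^+ N.
  have t1 : 0 <= t <= 1 by rewrite ltW//=; lra.
  apply: le_trans (bernoulli_sub N t1); rewrite /t mulrC divfK ?gt_eqF//.
  by rewrite subKr le_max lexx.
exists ((1 - t) ^- N), (1 - t); split => [||n].
- by rewrite invr_ge0 exprn_ge0// ltW.
- by apply/andP; split; lra.
have p0 : 0 < (1 - t) ^+ N by rewrite exprn_gt0.
rewrite mulrC ler_pdivlMr//; apply: (@le_trans _ _ (((1 - t) ^+ N) ^+ (n %/ N) * (1 - t) ^+ (n %% N))).
  apply: ler_pM; [exact: exprn_ge0|exact: ltW|by apply: lerXn2r; rewrite ?nnegrE// ltW|].
  by apply: ler_wiXn2l; [exact: ltW|lra|rewrite ltnW ?ltn_pmod].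
by rewrite -exprM -exprD mulnC -divn_eq.
Qed.

Lemma limsup_root_exp a : (forall n, 0 <= a n <= 1) ->
  (limsup_root (fun n => (a n)%:E) < 1)%E ->
  exists K z, [/\ 0 <= K, 0 < z < 1 & forall n, a n <= K * z ^+ n].
Proof.
move=> a01; rewrite /limsup_root /limn_esup limf_esupE => /ereal_inf_lt[_ [V [N _ NV] <-]] sup1.
pose s := Num.max (fine (ereal_sup [set ((a n)%:E `^ n%:R^-1)%E | n in V])) 2^-1.
have le_sup n : (N <= n)%N -> a n `^ n%:R^-1 <= s.
  move=> Nn; have up : ((a n `^ n%:R^-1)%:E <= ereal_sup [set ((a n)%:E `^ n%:R^-1)%E | n in V])%E.
    by apply: ereal_sup_ubound; exists n => //; exact: NV.
  rewrite /s le_max; apply/orP; left; rewrite -lee_fin fineK//.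
  by rewrite fin_numE -ltey -ltNye (lt_trans sup1) ?ltry// (lt_le_trans _ up)// ltNyr.
have s1 : s < 1.
  rewrite gt_max invf_lt1// ltr1n andbT.
  move: sup1; case: (ereal_sup _) => [x| |] //=; rewrite ?lte_fin//; by rewrite ltr01.
have s0 : 0 < s by rewrite lt_max invr_gt0 ltr0n orbT.
exists (s ^- N), s; split; [by rewrite invr_ge0 exprn_ge0// ltW|by rewrite s0|move=> n].
have /andP[an0 an1] := a01 n.
have p0 : 0 < s ^+ N by rewrite exprn_gt0.
rewrite mulrC ler_pdivlMr//; have [Nn|nN] := leqP N n; last first.
  apply: (@le_trans _ _ (1 * s ^+ n)); last by rewrite mul1r.
  apply: ler_pM => //; first exact: ltW.
  by apply: ler_wiXn2l; [exact: ltW|exact: ltW|exact: ltnW].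
apply: (@le_trans _ _ (a n)).
  by rewrite ler_piMr// exprn_ile1// ltW.
case: n an0 an1 Nn => [_ a1 _|n an0 an1 Nn]; first by rewrite expr0.
have := lerXn2r n.+1 _ _ (le_sup _ Nn); rewrite !nnegrE powR_ge0 ltW// => /(_ isT isT).
by rewrite -(powR_mulrn n.+1 (powR_ge0 (a n.+1) n.+1%:R^-1)) -powRrM mulVf ?powRr1// pnatr_eq0.
Qed.

Lemma exp_decay_limsup a : (forall n, 0 <= a n) -> exp_decay a ->
  (limsup_root (fun n => (a n)%:E) < 1)%E.
Proof.
move=> a0 [K [z [K0 /andP[z0 z1] [N aN]]]].
pose y := (z + 1) / 2.
have y1 : 1 < y / z by rewrite ltr_pdivlMr// /y; lra.
have [D D0 KD] := expr_unbounded K y1.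
have yz : 0 < y < 1 by rewrite /y; apply/andP; split; lra.
case/andP: yz => y0 y11.
have lim : (limsup_root (fun n => (a n)%:E) <= y%:E)%E.
  rewrite /limsup_root /limn_esup limf_esupE.
  apply: (@le_trans _ _ (ereal_sup [set ((a n)%:E `^ n%:R^-1)%E | n in [set n | (maxn N D <= n)%N]])).
    apply: ereal_inf_lbound; exists [set n | (maxn N D <= n)%N] => //.
    by exists (maxn N D).
  apply: ge_ereal_sup => _ [n /= + <-]; rewrite geq_max => /andP[Nn Dn].
  have n0 : n%:R != 0 :> R by rewrite pnatr_eq0 -lt0n (leq_trans D0).
  rewrite lee_fin; have -> : y = (y ^+ n) `^ n%:R^-1.
    by rewrite -powR_mulrn ?ltW// -powRrM mulfV// powRr1// ltW.
  apply: ge0_ler_powR; rewrite ?nnegrE ?invr_ge0//; first by rewrite exprn_ge0// ltW.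
  apply: le_trans (aN n Nn) _; rewrite -ler_pdivlMr ?exprn_gt0// -expr_div_n.
  apply: (le_trans KD); apply: ler_weXn2l => //; exact: ltW.
by apply: (le_lt_trans lim); rewrite lte_fin.
Qed.

End ExponentialDecay.

Section ReturnTimes.
Context {R : realType} {d : measure_display} {X : measurableType d}.
Variables (mu nu : probability X R) (theta : X -> X) (alpha : set (set X)).
Variables (Omega : set X) (F : set (set X)) (beta : set (seq (set X))).
Variables (eta : seq (set X) -> nat) (r : R).
Hypothesis IS : induced_system mu nu theta alpha Omega F beta eta r.
Local Notation sigma := (induced_map theta beta eta).
Local Notation bp := (base_partition theta beta).
Local Notation it := (itinerary sigma bp).
Local Notation cyl := (cylinder theta).
Local Notation etax := (return_time theta beta eta).
Local Notation etak := (etak theta beta eta).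
Hypothesis tails : exponential_tails mu theta Omega beta eta.

Lemma return_time_tail : exists K z, [/\ 0 <= K, 0 < z < 1 &
  forall n, pr nu (etax @^-1` [set n]) <= K * z ^+ n].
Proof.
have mO := Omega_measurable IS; have Op := Omega_pos IS.
have mE n : measurable [set x | Omega x /\ etax x = n].
  by apply: measurableI => //; exact: (etax_measurable IS).
have ch := pr_charge mu.
have ub n : 0 <= pr mu [set x | Omega x /\ etax x = n] <= 1 by rewrite ch.1// pr_le1.
have lt1 : (limsup_root (fun n => (pr mu [set x | Omega x /\ etax x = n])%:E) < 1)%E.
  rewrite (_ : (fun n => _) = (fun n => mu [set x | Omega x /\ etax x = n])) //.
  by apply/funext => n; rewrite -prE.
have [K [z [K0 z01 aK]]] := limsup_root_exp ub lt1.
exists ((pr mu Omega)^-1 * K), z; split=> //; first by rewrite mulr_ge0// invr_ge0 ltW.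
move=> n; rewrite (pr_nuE IS); last exact: (etax_measurable IS).
by rewrite -mulrA ler_pM2l ?invr_gt0// setIC; exact: aK.
Qed.

Lemma measurable_return_time (S : set nat) : measurable (etax @^-1` S).
Proof.
have -> : etax @^-1` S = \bigcup_(n in S) (etax @^-1` [set n]).
  by apply/seteqP; split=> [x Sx|x [n Sn /= xn]]; [exists (etax x)|rewrite /preimage /= xn].
by apply: bigcup_measurable => n _; exact: (etax_measurable IS).
Qed.

Lemma return_time_tail_gt : exists K z, [/\ 0 <= K, 0 < z < 1,
  forall n, pr nu (etax @^-1` [set n]) <= K * z ^+ n &
  forall n, pr nu (etax @^-1` [set j | (n <= j)%N]) <= K * z ^+ n].
Proof.
have [K1 [z [K0 /andP[z0 z1] one]]] := return_time_tail.
have ch := pr_charge nu.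
pose T n := etax @^-1` [set j | (n <= j)%N].
have mT n : measurable (T n) by exact: measurable_return_time.
pose K := K1 / (1 - z); have z1' : 0 < 1 - z by rewrite subr_gt0.
have KK : K1 <= K.
  by rewrite /K ler_pdivlMr// ler_piMr// gerBl ltW.
have step n i : pr nu (T n) <= K * (z ^+ n - z ^+ (n + i)) + pr nu (T (n + i)%N).
  elim: i => [|i IH]; first by rewrite addn0 subrr mulr0 add0r.
  apply: (le_trans IH).
  have -> : pr nu (T (n + i)%N) = pr nu (etax @^-1` [set (n + i)%N]) + pr nu (T (n + i).+1).
    rewrite -ch.2//; [|exact: (etax_measurable IS)|].
      congr (pr nu _); apply/seteqP; split=> x; rewrite /T /preimage /=.
        by rewrite leq_eqVlt => /predU1P[->|]; [left|right].
      by case=> [->|/ltnW].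
    by apply/seteqP; split=> // x; rewrite /T /preimage /= => -[->]; rewrite ltnn.
  have := one (n + i)%N; have -> : K1 = K * (1 - z) by rewrite /K divfK// gt_eqF.
  rewrite addnS (exprS z (n + i)); lra.
exists K, z; split=> [||n|n].
- exact: le_trans KK.
- by rewrite z0.
- by apply: le_trans (one n) _; rewrite ler_wpM2r// exprn_ge0// ltW.
apply/ler_addgt0Pr => e e0.
have cN : countable [set: nat] by exact: countableP.
have cov' x : [set: X] x -> (exists2 j, [set: nat] j & (etax @^-1` [set j]) x) \/ (set0 : set X) x.
  by move=> _; left; exists (etax x).
have [W0 [_ _ _ [D [mD De] cov]]] := finite_subcover (W1 := [::]) cN
  (fun j _ => etax_measurable IS j) (negligible_set0 nu) measurableT cov'
  (fun j h => False_ind _ (notF h)) e0.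
pose i := (\max_(j <- W0) j).+1.
have TD : T (n + i)%N `<=` D.
  move=> x; rewrite /T /preimage /= => xi; have [[j jW xj]|//] := cov x I.
  have jm : (j <= \max_(j <- W0) j)%N by exact: (@leq_bigmax_seq _ _ xpredT id j).
  have : (j < j)%N; last by rewrite ltnn.
  rewrite -[X in (_ < X)%N]xj; apply: leq_trans xi.
  by rewrite /i addnS ltnS (leq_trans jm)// leq_addl.
apply: (le_trans (step n i)); apply: lerD.
  rewrite ler_wpM2l//; first exact: le_trans KK.
  by rewrite gerBl exprn_ge0// ltW.
by apply: le_trans (ltW De); apply: le_charge.
Qed.

Lemma measurable_etak k n : measurable [set x | (n <= etak k x)%N].
Proof.
elim: k n => [|k IH] n.
  case: n => [|n]; first by rewrite (_ : [set x | _] = setT)//; apply/seteqP; split.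
  rewrite (_ : [set x | _] = set0)//; apply/seteqP; split=> // x /=.
  by rewrite etak0.
have -> : [set x | (n <= etak k.+1 x)%N] = \bigcup_(j in [set: nat])
    (etax @^-1` [set j] `&` sigma @^-1` [set x | (n - j <= etak k x)%N]).
  apply/seteqP; split=> [x /=|x [j _ [/= xj]]].
    by rewrite etakS => h; exists (etax x) => //; split=> //; rewrite /preimage /=; lia.
  by rewrite etakS /preimage /= xj; lia.
apply: bigcup_measurable => j _; apply: measurableI; first exact: (etax_measurable IS).
exact: (measurable_preimage_sigma IS).
Qed.

Variable C : R.
Hypothesis dist : forall u A B n, beta u -> measurable A -> measurable B ->
  agree it n A B -> pr nu (cyl u `&` sigma @^-1` A) * pr nu B <=
    expR (C * r ^+ n) * (pr nu (cyl u `&` sigma @^-1` B) * pr nu A).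

Lemma quasi_independence (S : set nat) A : measurable A ->
  pr nu (etax @^-1` S `&` sigma @^-1` A) <= expR C * pr nu A * pr nu (etax @^-1` S).
Proof.
move=> mA; have ch := pr_charge nu; have mS := measurable_return_time S.
have msA := measurable_preimage_sigma IS mA.
apply: (le_pr_pieces (J := beta) (F := cyl) (N := ~` domain theta beta)).
- exact: (beta_countable IS).
- by move=> u; exact: (beta_measurable IS).
- exact: (domain_conegligible IS).
- by move=> u v bu bv [x [ux vx]]; exact: (beta_disjoint IS) ux vx.
- by move=> x _; have [[u bu ux]|] := pselect (domain theta beta x); [left; exists u|right].
- exact: measurableI.
- by [].
- by rewrite mulr_ge0 ?expR_ge0 ?ch.1.
move=> u bu; have mu' := beta_measurable IS bu.
have [Su|nSu] := pselect (S (eta u)); last first.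
  rewrite (_ : _ `&` _ = set0) ?(charge_set0 ch).
    by rewrite !mulr_ge0 ?expR_ge0 ?ch.1//; exact: measurableI.
  apply/seteqP; split=> // x [[Sx _] ux]; apply: nSu.
  by move: Sx; rewrite /preimage /= (return_timeE IS bu ux).
have -> : etax @^-1` S `&` sigma @^-1` A `&` cyl u = cyl u `&` sigma @^-1` A.
  apply/seteqP; split=> [x [[]]//|x [ux Ax]]; split=> //; split=> //.
  by rewrite /preimage /= (return_timeE IS bu ux).
have -> : etax @^-1` S `&` cyl u = cyl u.
  by apply/setIidr => x ux; rewrite /preimage /= (return_timeE IS bu ux).
have agrT : agree it 0 A setT by move=> x y i _ _; rewrite ltn0.
have := dist bu mA measurableT agrT; rewrite preimage_setT setIT prT mulr1 expr0 mulr1.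
by rewrite mulrAC mulrA.
Qed.

Lemma etak_tail : exists B z, [/\ 1 <= B, 0 < z < 1 &
  forall k n, pr nu [set x | (n <= etak k x)%N] <= B ^+ k * z ^+ n].
Proof.
have [K [y [K0 /andP[y0 y1] one gt]]] := return_time_tail_gt.
have ch := pr_charge nu.
pose z := (1 + y) / 2; have yz : y < z by rewrite /z; lra.
have z1 : z < 1 by rewrite /z; lra.
have z0 : 0 < z by exact: lt_trans yz.
clearbody z; pose q := y / z; have q01 : 0 <= q < 1.
  by rewrite /q divr_ge0 ?ltW//= ltr_pdivrMr// mul1r.
have q1 : 0 < 1 - q by rewrite subr_gt0; case/andP: q01.
pose B0 := expR C * K / (1 - q) + K.
have B00 : 0 <= B0 by rewrite addr_ge0// divr_ge0 ?mulr_ge0 ?expR_ge0// ltW.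
exists (B0 + 1), z; split; [by rewrite lerDr|by rewrite z0|].
elim=> [|k IH] n.
  rewrite expr0 mul1r; case: n => [|n].
    by rewrite expr0; apply: pr_le1; exact: measurable_etak.
  rewrite (_ : [set x | _] = set0) ?(charge_set0 ch) ?exprn_ge0 ?ltW//.
  by apply/seteqP; split=> // x /=; rewrite etak0.
pose P j := etax @^-1` [set j] `&` sigma @^-1` [set x | (n - j <= etak k x)%N].
have mP j : measurable (P j).
  apply: measurableI; first exact: (etax_measurable IS).
  by apply: (measurable_preimage_sigma IS); exact: measurable_etak.
have mE := measurable_etak k.+1 n.
apply: le_trans (charge_le_sum ch (s := iota 0 n.+1) (B := P)
  (C := etax @^-1` [set j | (n <= j)%N]) mE (measurable_return_time _) (fun j _ => mP j) _) _.
  move=> x h; have {}h : (n <= etax x + etak k (sigma x))%N by rewrite -etakS.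
  have [lt|] := leqP n (etax x); first by right.
  move=> lt; left; exists (etax x); first by rewrite mem_iota add0n /= ltnS ltnW.
  by split=> //; rewrite /preimage /= leq_subLR.
have Pj j : (j <= n)%N -> pr nu (P j) <= expR C * K * (B0 + 1) ^+ k * z ^+ n * q ^+ j.
  move=> jn; apply: le_trans (quasi_independence _ _) _; first exact: measurable_etak.
  have zE : z ^+ n = z ^+ (n - j) * z ^+ j by rewrite -exprD subnK.
  have -> : expR C * K * (B0 + 1) ^+ k * z ^+ n * q ^+ j =
     expR C * ((B0 + 1) ^+ k * z ^+ (n - j)) * (K * y ^+ j).
    have -> : q ^+ j = y ^+ j / z ^+ j by exact: expr_div_n.
    rewrite zE; have : z ^+ j != 0 by rewrite expf_neq0// gt_eqF.
    move: (z ^+ (n - j)) (z ^+ j) (y ^+ j) ((B0 + 1) ^+ k) (expR C) => a b c e f bn.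
    by field.
  apply: ler_pM => //.
  - by rewrite mulr_ge0 ?expR_ge0// ch.1//; exact: measurable_etak.
  - by apply: ch.1; exact: (etax_measurable IS).
  - by rewrite ler_wpM2l ?expR_ge0.
have Bk : 1 <= (B0 + 1) ^+ k by rewrite exprn_ege1// lerDr.
have zn : 0 < z ^+ n by rewrite exprn_gt0.
apply: (@le_trans _ _ (expR C * K * (B0 + 1) ^+ k * z ^+ n * (1 - q)^-1 + K * z ^+ n)).
  apply: lerD; last first.
    apply: le_trans (gt n) _; rewrite ler_wpM2l//; apply: lerXn2r; rewrite ?nnegrE ?ltW//.
  apply: (@le_trans _ _ (\sum_(j <- iota 0 n.+1) expR C * K * (B0 + 1) ^+ k * z ^+ n * q ^+ j)).
    rewrite [leLHS]big_seq [leRHS]big_seq; apply: ler_sum => j; rewrite mem_iota add0n ltnS => jn.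
    apply: le_trans (Pj j jn); by apply: le_charge => //; exact: measurableI.
  rewrite -mulr_sumr ler_wpM2l//.
    apply: mulr_ge0; last exact: ltW.
    apply: mulr_ge0; last exact: le_trans Bk.
    by apply: mulr_ge0 => //; exact: expR_ge0.
  have := geometric_le n.+1 q01; rewrite -(big_mkord xpredT (fun i => q ^+ i)).
  by rewrite /index_iota subn0.
have -> : expR C * K * (B0 + 1) ^+ k * z ^+ n * (1 - q)^-1 =
  (B0 + 1) ^+ k * z ^+ n * (B0 - K) by rewrite /B0; ring.
rewrite exprS.
have : 0 <= ((B0 + 1) ^+ k - 1) * (K * z ^+ n).
  by rewrite mulr_ge0 ?subr_ge0// mulr_ge0// ltW.
have : 0 <= (B0 + 1) ^+ k * z ^+ n by apply: mulr_ge0; [exact: le_trans Bk|exact: ltW].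
move: ((B0 + 1) ^+ k) (z ^+ n) => a b; lra.
Qed.

End ReturnTimes.

Section TimeChange.
Context {R : realType} {d : measure_display} {X : measurableType d}.
Context {G : groupType}.
Variables (mu nu : probability X R) (theta : X -> X) (alpha : set (set X)).
Variables (Omega : set X) (F : set (set X)) (beta : set (seq (set X))).
Variables (eta : seq (set X) -> nat) (r : R) (gamma : X -> G) (H o : set G).
Variable gs : seq G.
Hypothesis IS : induced_system mu nu theta alpha Omega F beta eta r.
Hypothesis cG : countable [set: G].
Hypothesis gconst : forall a x y, alpha a -> a x -> a y -> gamma x = gamma y.
Hypothesis ggs : forall x, gamma x \in gs.
Hypothesis Ho : right_cosets H o.
Hypothesis eta_pos : forall u, beta u -> (0 < eta u)%N.
Hypothesis tails : exponential_tails mu theta Omega beta eta.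
Local Notation sigma := (induced_map theta beta eta).
Local Notation bp := (base_partition theta beta).
Local Notation cyl := (cylinder theta).
Local Notation kap := (kappa theta beta eta gamma).
Local Notation etak := (etak theta beta eta).
Hypothesis decay : exists k (lam : R), [/\ (0 < k)%N, 0 <= lam < 1 &
  forall v o n, right_cosets H v ->
    pr nu [set x | rtranslate v (cocycle sigma kap n x) = o] <= lam ^+ (n %/ k)].
Let MM := is_MM IS.
Let IM := is_IM IS.

Definition return_set n := [set x | [/\ Omega x, Omega (iter n theta x) &
  rtranslate o (cocycle theta gamma n x) = o]].

Definition prompt M := Omega `\` late theta Omega beta eta M.

Lemma cocycle_measurable n : group_measurable (cocycle theta gamma n).
Proof.
apply: group_measurable_cocycle => //; first exact: (theta_measurable MM).
exact: (gamma_measurable IS gconst).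
Qed.

Lemma return_set_measurable n : measurable (return_set n).
Proof.
have mO := Omega_measurable IS.
have -> : return_set n = Omega `&` iter n theta @^-1` Omega `&`
    cocycle theta gamma n @^-1` [set g | rtranslate o g = o].
  by apply/seteqP; split=> [x [? ? ?]|x [[? ?] ?]].
apply: measurableI; last exact: cocycle_measurable.
by apply: measurableI => //; exact: (measurable_preimage_iter MM).
Qed.

Lemma prompt_measurable M : measurable (prompt M).
Proof. by apply: measurableD; [exact: (Omega_measurable IS)|exact: (late_measurable IS)]. Qed.

Lemma sigma_cocycle_measurable n : group_measurable (cocycle sigma kap n).
Proof.
apply: group_measurable_cocycle => //; first exact: (sigma_measurable IS).
exact: (kappa_measurable IS).
Qed.

Lemma le_etak k l x : (k <= l)%N -> (etak k x <= etak l x)%N.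
Proof.
move=> kl; rewrite -(subnK kl); elim: (l - k)%N => [//|j IH].
by rewrite addSn etak_recr (leq_trans IH)// leq_addr.
Qed.

Lemma never_leaves_domain :
  nu.-negligible (~` [set x | forall i, domain theta beta (iter i sigma x)]).
Proof.
apply: (negligibleS (A := \bigcup_(i in [set: nat]) (iter i sigma @^-1` (~` domain theta beta)))).
  by move=> x /existsNP[i ni]; exists i.
apply: negligible_bigcup => i; apply: (negligible_preimage_iter_sigma IS).
exact: (domain_conegligible IS).
Qed.

Lemma prompt_decay M : exists K z, [/\ 0 <= K, 0 < z < 1 & forall n,
  pr nu (return_set n `&` iter n theta @^-1` prompt M) <= (n + M.+2)%:R * K * z ^+ n].
Proof.
have [C C0 dist] := branch_distortion IS.
have [B [z [B1 /andP[z0 z1] tail]]] := etak_tail IS tails dist.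
have [k [lam [k0 lam01 dec]]] := decay.
have ch := pr_charge nu.
pose y := (1 + z^-1) / 2.
have z'1 : 1 < z^-1 by rewrite invf_gt1.
have y1 : 1 < y by rewrite /y; lra.
have yz : 0 < y * z < 1.
  have -> : y * z = (z + 1) / 2 by rewrite /y; field; rewrite gt_eqF.
  by apply/andP; split; lra.
have [D D0 BD] := expr_unbounded B y1.
have Dk0 : (0 < D * k)%N by rewrite muln_gt0 D0.
have [K1 [z2 [K10 z201 ldec]]] := exp_div lam01 Dk0.
pose OM := [seq rtranslate o p | p <- products gs M].
pose K := (size OM)%:R * K1 + 1.
pose w := Num.max (y * z) z2.
have w01 : 0 < w < 1 by rewrite lt_max gt_max; case/andP: yz => -> ->; case/andP: z201 => _ ->.
have z2w : z2 <= w by rewrite le_max lexx orbT.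
have yzw : y * z <= w by rewrite le_max lexx.
have z20 : 0 <= z2 by case/andP: z201 => /ltW.
have yz0 : 0 <= y * z by case/andP: yz => /ltW.
clearbody w; case/andP: w01 => w0 w1.
have K0 : 0 <= K by rewrite addr_ge0// mulr_ge0.
exists K, w; split=> [//||n]; first by rewrite w0.
set P := _ `&` _.
have mP : measurable P.
  apply: measurableI; first exact: return_set_measurable.
  by apply: (measurable_preimage_iter MM); exact: prompt_measurable.
pose q := (n %/ D)%N.
pose hit i v := [set x | rtranslate o (cocycle sigma kap i x) = v].
have mhit i v : measurable (hit i v) by exact: (sigma_cocycle_measurable i [set g | rtranslate o g = v]).
have [N [mN N0 subN]] := never_leaves_domain.
have mtail := measurable_etak IS q n.
have mC : measurable ([set x | (n <= etak q x)%N] `|` N) by exact: measurableU.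
pose I := [seq (i, v) | i <- [seq i <- iota 0 (n + M).+1 | (q <= i)%N], v <- OM].
apply: le_trans (charge_le_sum ch (s := I) (B := fun p => hit p.1 p.2) mP mC (fun p _ => mhit _ _) _) _.
  move=> x [[Ox On xo] [_ nl]].
  have [dom|nd] := pselect (forall i, domain theta beta (iter i sigma x)); last first.
    by right; right; exact: subN.
  have [l [j [/andP[j0 jM] ek]]] := next_return IS eta_pos dom On nl.
  have [ql|lq] := leqP q l.+1; last first.
    right; left => /=; apply: leq_trans (le_etak x (ltnW lq)); rewrite ek; exact: leq_addr.
  left; exists (l.+1, rtranslate o (cocycle theta gamma j (iter n theta x))) => /=.
    apply/allpairsP; exists (l.+1, rtranslate o (cocycle theta gamma j (iter n theta x))).
    split; [|by apply/map_f/mem_products|by []].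
    rewrite mem_filter ql mem_iota add0n !ltnS.
    have lk : (l.+1 <= etak l.+1 x)%N by apply: (etak_ge IS).
    by apply: leq_trans lk _; rewrite ek leq_add2l.
  by rewrite /hit /= cocycle_kappa ek cocycleD -rtranslateM xo.
have lam0 : 0 <= lam by case/andP: lam01.
have lamq : lam ^+ (q %/ k) <= K1 * w ^+ n.
  rewrite /q -divnMA; apply: le_trans (ldec n) _; rewrite ler_wpM2l//.
  by apply: lerXn2r; rewrite ?nnegrE//; exact: ltW.
have part1 : \sum_(p <- I) pr nu (P `&` hit p.1 p.2) <= (n + M).+1%:R * ((size OM)%:R * (K1 * w ^+ n)).
  apply: (@le_trans _ _ (\sum_(p <- I) K1 * w ^+ n)).
    rewrite [leLHS]big_seq [leRHS]big_seq; apply: ler_sum => -[i v] /allpairsP[[i' v'] [iI _ [-> _]]].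
    move: iI; rewrite mem_filter => /andP[/= qi _]; apply: le_trans lamq.
    apply: (@le_trans _ _ (pr nu (hit i' v))).
      by apply: le_charge => //; exact: measurableI.
    apply: le_trans (dec o v i' Ho) _; apply: ler_wiXn2l => //; last exact: leq_div2r.
    by case/andP: lam01 => _ /ltW.
  rewrite sum_const_seq size_allpairs natrM -mulrA.
  have Kw : 0 <= (size OM)%:R * (K1 * w ^+ n).
    by rewrite !mulr_ge0// exprn_ge0// ltW.
  apply: ler_wpM2r => //; rewrite ler_nat size_filter.
  by apply: leq_trans (count_size _ _) _; rewrite size_iota.
have part2 : pr nu ([set x | (n <= etak q x)%N] `|` N) <= w ^+ n.
  have -> : pr nu ([set x | (n <= etak q x)%N] `|` N) = pr nu [set x | (n <= etak q x)%N].
    apply: pr_eq_negligible => //.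
      apply: (negligibleS (A := N)); first by move=> x [[|//] h1 h2].
      by exists N; split.
    by apply: negligibleS (negligible_set0 _) => x [h1 h2]; apply: h2; left.
  apply: le_trans (tail q n) _; apply: (@le_trans _ _ ((y * z) ^+ n)); last first.
    by apply: lerXn2r; rewrite ?nnegrE//; exact: ltW.
  rewrite exprMn ler_wpM2r//; first by rewrite exprn_ge0// ltW.
  apply: (@le_trans _ _ ((y ^+ D) ^+ q)).
    by apply: lerXn2r; rewrite ?nnegrE ?exprn_ge0// (le_trans ler01)// ltW.
  by rewrite -exprM; apply: ler_weXn2l; [exact: ltW|rewrite mulnC leq_trunc_div].
have nM : (1 : R) <= (n + M.+2)%:R by rewrite addnS ler1n.
have nM' : (n + M).+1%:R <= (n + M.+2)%:R :> R by rewrite ler_nat !addnS.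
have wn : 0 <= w ^+ n by rewrite exprn_ge0// ltW.
have h1 := ler_wpM2r (mulr_ge0 (ler0n R (size OM)) (mulr_ge0 K10 wn)) nM'.
have h2 := ler_wpM2r wn nM.
rewrite /K mulrDr mulr1 mulrDl; apply: lerD; first by apply: (le_trans part1); rewrite -!mulrA in h1 *.
by apply: (le_trans part2); rewrite mul1r in h2.
Qed.

End TimeChange.

Section Comparison.
Context {R : realType} {d : measure_display} {X : measurableType d}.
Context {G : groupType}.
Variables (mu nu : probability X R) (theta : X -> X) (alpha : set (set X)).
Variables (Omega : set X) (F : set (set X)) (beta : set (seq (set X))).
Variables (eta : seq (set X) -> nat) (r : R) (gamma : X -> G) (o : set G).
Hypothesis IS : induced_system mu nu theta alpha Omega F beta eta r.
Hypothesis cG : countable [set: G].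
Hypothesis gconst : forall a x y, alpha a -> a x -> a y -> gamma x = gamma y.
Local Notation sigma := (induced_map theta beta eta).
Local Notation bp := (base_partition theta beta).
Local Notation cyl := (cylinder theta).
Local Notation late := (late theta Omega beta eta).
Local Notation prompt := (prompt theta Omega beta eta).
Local Notation return_set := (return_set theta Omega gamma o).
Variable C : nat -> R.
Hypothesis Cw : forall n w, admissible mu theta alpha n w ->
  exists2 phi, inverse_branch_density mu theta w phi &
  forall a, alpha a -> cyl (rcons w a) !=set0 -> cyl w `<=` Omega -> a `<=` Omega ->
  forall x y, a x -> a y ->
    `|ln (phi x) - ln (phi y)| <= C n * itinerary_dist r sigma bp x y.
Let MM := is_MM IS.
Let IM := is_IM IS.

Lemma branch_comparison n w a D : (0 < n)%N -> words alpha n w -> F a ->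
  cyl w `<=` Omega -> measurable D -> D `<=` a ->
  pr mu (cyl w `&` iter n theta @^-1` a) * pr mu D <=
  expR (Num.max (C n) 0) * pr mu (cyl w `&` iter n theta @^-1` D).
Proof.
move=> n0 [sw wa] Fa wO mD Da; have aa := is_Fal IS Fa.
have ma := alpha_measurable MM aa; have mw := measurable_cylinder MM wa.
have ch := pr_charge mu.
have mpre A : measurable A -> measurable (cyl w `&` iter n theta @^-1` A).
  by move=> mA; apply: measurableI => //; exact: (measurable_preimage_iter MM).
pose I := iter n theta @` cyl w.
have mI : measurable I by exact: (measurable_image_iter MM).
have dich := image_cylinder_dichotomy MM wa aa; rewrite sw -/I in dich.
case: dich => [nul|cov].
  have := negligible_preimage_iter MM IM n nul => n1.
  have /negligibleP : mu.-negligible (cyl w `&` iter n theta @^-1` a).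
    by apply: negligibleS n1 => x [wx ax]; split=> //; exists x.
  move=> /(_ (mpre _ ma)); rewrite {1}/pr => -> /=; rewrite mul0r.
  by rewrite mulr_ge0 ?expR_ge0 ?ch.1//; exact: mpre.
have [/eqP e0|ne0] := eqVneq (pr mu (cyl w `&` iter n theta @^-1` a)) 0.
  rewrite (eqP e0) mul0r.
  by rewrite mulr_ge0 ?expR_ge0 ?ch.1//; exact: mpre.
have nw : ~ mu.-negligible (cyl w `&` iter n theta @^-1` a).
  by move=> /negligibleP => /(_ (mpre _ ma)) h; move: ne0; rewrite /pr h /= eqxx.
have adm : admissible mu theta alpha n w.
  rewrite -{1}sw; apply: (cylinder_admissible MM IM) => //; last by rewrite sw.
  by move=> h; apply: nw; apply: negligibleS h => x [].
have [x0 x0P] : exists x, (cyl w `&` iter n theta @^-1` a) x.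
  apply: contrapT => h; apply: nw.
  by apply: negligibleS (negligible_set0 _) => x hx; apply: h; exists x.
have [phi [mphi phi0 int] lip] := Cw adm.
have inter A : cyl w `&` iter n theta @^-1` (A `&` I) = cyl w `&` iter n theta @^-1` A.
  by apply/seteqP; split=> [x [wx []]//|x [wx Ax]]; split=> //; split=> //; exists x.
have intE A : measurable A -> (\int[mu]_(x in A `&` I) (phi x)%:E)%E =
    (pr mu (cyl w `&` iter n theta @^-1` A))%:E.
  move=> mA; rewrite -prE; last exact: mpre.
  by have := int (A `&` I) (measurableI _ _ mA mI); rewrite sw inter => -> //.
have prI A : measurable A -> A `<=` a -> pr mu (A `&` I) = pr mu A.
  move=> mA Aa; apply: pr_eq_negligible => //; first exact: measurableI.
    by apply: negligibleS (negligible_set0 _) => x [[]].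
  by apply: negligibleS cov => x [Ax nx]; split; [exact: Aa|move=> Ix; apply: nx].
have r01 := metric_ratio01 IS.
have K0 : 0 <= expR (Num.max (C n) 0) by exact: expR_ge0.
have := density_ratio mphi phi0 (measurableI _ _ ma mI) (measurableI _ _ mD mI)
  (intE _ ma) (intE _ mD) K0.
rewrite !prI// => h; apply: le_trans (h _) _.
  move=> x y [ax _] [Dy _].
  have nz : cyl (rcons w a) !=set0 by exists x0; rewrite cylinder_rcons sw.
  have := lip a aa nz wO (F_Omega IS Fa) x y ax (Da _ Dy).
  have d0 := itinerary_dist_ge0 sigma bp x y r01.
  have d1 : itinerary_dist r sigma bp x y <= 1.
    by rewrite -(expr0 r); apply: itinerary_dist_le.
  have c0 : C n * itinerary_dist r sigma bp x y <= Num.max (C n) 0.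
    apply: (@le_trans _ _ (Num.max (C n) 0 * itinerary_dist r sigma bp x y)).
      by rewrite ler_wpM2r// le_max lexx.
    by rewrite ler_piMr// le_max lexx orbT.
  move=> h1; rewrite -[phi x]lnK ?posrE// -[phi y in leRHS]lnK ?posrE// -expRD ler_expR.
  by have := ler_norm (ln (phi x) - ln (phi y)); lra.
rewrite ler_wpM2l// ler_piMr ?ch.1 ?pr_le1//; exact: mpre.
Qed.

Lemma prompt_comparison M : (forall a, F a -> ~ mu.-negligible (a `\` late M)) ->
  exists2 K, 0 <= K & forall n, (0 < n)%N -> pr mu (return_set n) <=
    expR (Num.max (C n) 0) * (K * pr mu (return_set n `&` iter n theta @^-1` prompt M)).
Proof.
move=> small; have ch := pr_charge mu.
have mF a : F a -> measurable a by move=> /(is_Fal IS); exact: (alpha_measurable MM).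
have mD a : F a -> measurable (a `\` late M).
  by move=> Fa; apply: measurableD; [exact: mF|exact: (late_measurable IS)].
have [c c0 cP] : exists2 c, 0 < c & forall a, a \in fset_set F -> c <= pr mu (a `\` late M).
  apply: uniform_pos => a /(mem_letters IS) Fa.
  rewrite lt_neqAle ch.1 ?andbT; last exact: mD.
  apply/eqP => E; apply: (small a Fa); apply/negligibleP; first exact: mD.
  by have := prE mu (mD a Fa); rewrite -E.
exists c^-1; first by rewrite invr_ge0 ltW.
move=> n n0; have mR := return_set_measurable o IS cG gconst n.
have mP : measurable (return_set n `&` iter n theta @^-1` prompt M).
  apply: measurableI => //; apply: (measurable_preimage_iter MM).
  exact: (prompt_measurable IS).
have K0 : 0 <= expR (Num.max (C n) 0) * c^-1 by rewrite mulr_ge0 ?expR_ge0// invr_ge0 ltW.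
rewrite mulrA.
apply: (le_pr_pieces (mu := mu) (J := F) (F := fun a => iter n theta @^-1` a) (N := set0)) => //.
- exact: finite_set_countable (is_Ffin IS).
- by move=> a Fa; apply: (measurable_preimage_iter MM); exact: mF.
- exact: negligible_set0.
- move=> a b Fa Fb [x [ax bx]].
  exact: (alpha_eq MM (is_Fal IS Fa) (is_Fal IS Fb) ax bx).
- by move=> x [_ + _]; rewrite (is_OmE IS) => -[a Fa ax]; left; exists a.
move=> a Fa.
have mpa : measurable (iter n theta @^-1` a) by apply: (measurable_preimage_iter MM); exact: mF.
apply: (le_pr_pieces (mu := mu) (J := words alpha n) (F := cyl) (N := set0)) => //.
- exact: (words_countable MM).
- by move=> w [_ wa]; exact: (measurable_cylinder MM).
- exact: negligible_set0.
- by move=> w w' ww ww' [x [wx w'x]]; exact: (words_eq MM ww ww' wx w'x).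
- by move=> x _; left; have [w ww wx] := word_of MM n x; exists w.
- exact: measurableI.
- exact: measurableI.
move=> w ww; have [sw wa] := ww; have mw := measurable_cylinder MM wa.
have [[x [Rx wx]]|nx] := pselect (exists x, return_set n x /\ cyl w x); last first.
  rewrite (_ : _ `&` cyl w = set0) ?(charge_set0 ch).
    by rewrite mulr_ge0// ch.1//; do 2 apply: measurableI => //.
  by apply/seteqP; split=> // x [[Rx _] wx]; apply: nx; exists x.
have [Ox _ fx] := Rx.
have n0w : (0 < size w)%N by rewrite sw.
have wO : cyl w `<=` Omega.
  move: Ox; rewrite (is_OmE IS) => -[b Fb bx] y wy; exists b => //.
  have -> : b = nth set0 w 0.
    by apply: (alpha_eq MM) bx (wx 0%N n0w); [exact: (is_Fal IS)|exact/wa/mem_nth].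
  exact: (wy 0%N n0w).
have inR y : cyl w y -> Omega (iter n theta y) -> return_set n y.
  move=> wy Oy; split=> //; first exact: wO.
  by rewrite (cocycle_cylinder gconst wa _ wy wx)// sw.
have -> : return_set n `&` iter n theta @^-1` a `&` cyl w = cyl w `&` iter n theta @^-1` a.
  apply/seteqP; split=> [y [[_ ay] wy]//|y [wy ay]]; split=> //; split=> //.
  by apply: inR => //; exact: (F_Omega IS Fa).
have -> : return_set n `&` iter n theta @^-1` prompt M `&` iter n theta @^-1` a `&` cyl w =
    cyl w `&` iter n theta @^-1` (a `\` late M).
  apply/seteqP; split=> [y [[[_ [_ ly]] ay] wy]//|y [wy [ay ly]]].
  have Oy := F_Omega IS Fa ay.
  by split=> //; split=> //; split=> //; exact: inR.
have sub : a `\` late M `<=` a by move=> y [].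
have := branch_comparison n0 ww Fa wO (mD a Fa) sub => h.
have cD : c <= pr mu (a `\` late M).
  by apply: cP; rewrite in_fset_set ?inE//; exact: (is_Ffin IS).
have p0 : 0 <= pr mu (cyl w `&` iter n theta @^-1` a) by apply: ch.1; exact: measurableI.
have := le_trans (ler_wpM2l p0 cD) h; rewrite -ler_pdivlMr//.
by rewrite mulrAC.
Qed.

Hypothesis C0 : (fun n => C n / n%:R) @ \oo --> (0 : R).

Lemma distortion_subexp s : 1 < s ->
  exists N, forall n, (N <= n)%N -> expR (Num.max (C n) 0) <= s ^+ n.
Proof.
move=> s1; have s0 : 0 < s by exact: lt_trans s1.
have ls : 0 < ln s by exact: ln_gt0.
have /cvgrPdist_lt /(_ _ ls) [N _ NP] := C0.
exists N.+1 => n Nn; have n0 : (0 < n)%N by exact: leq_trans Nn.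
have := NP n (ltnW Nn); rewrite /= sub0r normrN => h.
rewrite -[s in leRHS]lnK ?posrE// -expRM_natl ler_expR ge_max.
apply/andP; split; last by apply: mulr_ge0 => //; exact: ltW.
have := le_lt_trans (ler_norm _) h; rewrite ltr_pdivrMr ?ltr0n// mulrC => lt.
exact: ltW.
Qed.

Variables (H : set G) (gs : seq G).
Hypothesis ggs : forall x, gamma x \in gs.
Hypothesis Ho : right_cosets H o.
Hypothesis eta_pos : forall u, beta u -> (0 < eta u)%N.
Hypothesis tails : exponential_tails mu theta Omega beta eta.
Hypothesis decay : exists k (lam : R), [/\ (0 < k)%N, 0 <= lam < 1 &
  forall v o n, right_cosets H v ->
    pr nu [set x | rtranslate v (cocycle sigma (kappa theta beta eta gamma) n x) = o] <=
    lam ^+ (n %/ k)].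
Hypothesis small : exists M, forall a, F a -> ~ mu.-negligible (a `\` late M).

Lemma return_set_decay : exp_decay (fun n => pr mu (return_set n)).
Proof.
have [M /prompt_comparison [K1 K10 cmp]] := small.
have [K [z [K0 z01 dec]]] := prompt_decay IS cG gconst ggs Ho eta_pos tails decay M.
have mO := Omega_measurable IS; have Op := Omega_pos IS.
apply: (exp_decay_subexp (c := fun n => Num.max (C n) 0) (K := K1 * (pr mu Omega * K)) (z := z)
  (M := M.+2) distortion_subexp) => //.
  by rewrite !mulr_ge0// ltW.
exists 1%N => n n0; apply: le_trans (cmp n n0) _; apply: ler_wpM2l; first exact: expR_ge0.
rewrite [X in _ <= X](_ : _ = K1 * (pr mu Omega * ((n + M.+2)%:R * K * z ^+ n))); last by ring.
apply: ler_wpM2l => //; have := dec n; rewrite (pr_nuE IS); last first.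
  apply: measurableI; first exact: (return_set_measurable o IS cG gconst).
  apply: (measurable_preimage_iter MM); exact: (prompt_measurable IS).
rewrite setIidl; last by move=> x [[]].
by rewrite mulrC ler_pdivrMr// mulrC.
Qed.

End Comparison.

(** * Return words of length zero *)

Section Degenerate.
Context {R : realType} {d : measure_display} {X : measurableType d}.
Context {G : groupType}.
Variables (mu nu : probability X R) (theta : X -> X) (alpha : set (set X)).
Variables (Omega : set X) (F : set (set X)) (beta : set (seq (set X))).
Variables (eta : seq (set X) -> nat) (r : R) (gamma : X -> G) (H : set G).
Variable u0 : seq (set X).
Hypothesis IS : induced_system mu nu theta alpha Omega F beta eta r.
Hypothesis cG : countable [set: G].
Hypothesis gconst : forall a x y, alpha a -> a x -> a y -> gamma x = gamma y.
Hypothesis sH : subgroup H.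
Hypothesis tt0 : topologically_transitive mu theta alpha gamma (normal_core H).
Hypothesis bu0 : beta u0.
Hypothesis eta0 : eta u0 = 0%N.
Local Notation sigma := (induced_map theta beta eta).
Local Notation cyl := (cylinder theta).
Let MM := is_MM IS.
Let IM := is_IM IS.

Let sigma_id x : cyl u0 x -> sigma x = x.
Proof. by move=> ux; rewrite (sigmaE IS bu0 ux) eta0. Qed.

Let full : nu.-negligible (~` cyl u0).
Proof.
have [_ full _ _] := is_GM IS.
have E : sigma @` cyl u0 = cyl u0.
  apply/seteqP; split=> [_ [x ux <-]|x ux]; first by rewrite sigma_id.
  by exists x => //; exact: sigma_id.
apply/negligibleP; first by apply: measurableC; exact: (beta_measurable IS).
by have := full _ (ex_intro2 _ _ u0 bu0 erefl); rewrite E.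
Qed.

Lemma atom (A : set X) : measurable A -> nu.-negligible A \/ nu.-negligible (~` A).
Proof.
move=> mA; have [[_ _ _ _ gen] _ _ _] := is_GM IS.
have [A' A'gen dA] := gen A mA.
have one u : beta u -> u = u0.
  move=> bu; apply: contrapT => neq; have := beta_pos IS bu.
  suff : nu.-negligible (cyl u).
    by move=> /negligibleP => /(_ (beta_measurable IS bu)) ->; rewrite ltxx.
  by apply: negligibleS full => x ux u0x; apply: neq; exact: (beta_disjoint IS bu bu0 ux u0x).
have A'P : cyl u0 `<=` A' \/ A' `&` cyl u0 = set0.
  pose CC := [set B : set X | cyl u0 `<=` B \/ B `&` cyl u0 = set0].
  suff : CC A' by [].
  move: A'gen; apply; split.
  - split=> [|B [sub|dis]|B BC].
    + by right; rewrite set0I.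
    + by right; apply/seteqP; split=> // x [[_ nB] /sub].
    + by left => x ux; split=> // Bx; have : (B `&` cyl u0) x by []; rewrite dis.
    + have [[n sub]|nex] := pselect (exists n, cyl u0 `<=` B n).
        by left=> x /sub Bx; exists n.
      right; apply/seteqP; split=> // x [[n _ Bx] ux].
      have [sub|dis] := BC n; first by apply: nex; exists n.
      by have : (B n `&` cyl u0) x by []; rewrite dis.
  - move=> _ [w [_ wb ->]]; left=> x ux k kw.
    have [u bu uE] := wb _ (mem_nth set0 kw).
    rewrite -uE (one u bu); have : iter k sigma x = x by elim: k {kw uE} => //= k ->; exact: sigma_id.
    by move=> ->.
have mA' : measurable A'.
  suff : [set B : set X | measurable B] A' by [].
  move: A'gen; apply; split; first exact: sigma_algebra_measurable.
  move=> _ [w [_ wb ->]].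
  have -> : cylinder sigma w = \bigcap_(k in [set k | (k < size w)%N])
      (iter k sigma @^-1` nth set0 w k) by [].
  apply: bigcap_measurableType => k kw; apply: (measurable_preimage_iter_sigma IS).
  have [u bu <-] := wb _ (mem_nth set0 kw); exact: (beta_measurable IS).
have nAA' : nu.-negligible (A `+` A').
  by exists (A `+` A'); split=> //; apply: measurableU; exact: measurableD.
case: A'P => [sub|dis]; [right|left].
  apply: negligibleS (negligibleU nAA' full) => x nA.
  have [ux|] := pselect (cyl u0 x); last by right.
  by left; right; split=> //; exact: sub.
apply: negligibleS (negligibleU nAA' full) => x Ax.
have [ux|] := pselect (cyl u0 x); last by right.
by left; left; split=> // A'x; have : (A' `&` cyl u0) x by []; rewrite dis.
Qed.

Lemma degenerate_finite : exists K : {fset (set G)}, forall v, right_cosets H v -> v \in K.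
Proof.
have [Fa usub] := beta_Omega IS bu0; set a := head set0 u0 in Fa usub.
have aa := is_Fal IS Fa; have ma := alpha_measurable MM aa.
have aO : a `<=` Omega := F_Omega IS Fa.
have na : ~ nu.-negligible a.
  move=> /negligibleP => /(_ ma) h; have := F_pos IS Fa; by rewrite /pr h /= ltxx.
pose good n g w := [/\ (0 < n)%N, words alpha n w, cyl w `<=` a,
  forall x, cyl w x -> same_action H (cocycle theta gamma n x) g &
  nu.-negligible (~` (cyl w `&` iter n theta @^-1` a))].
have ex_good g : exists n w, good n g w.
  have [n [w [n0 ww cov wa wg]]] := transitive_word IS cG gconst sH tt0 g aa.
  exists n, w; split=> //; have mw := measurable_cylinder MM ww.2.
  have mC : measurable (cyl w `&` iter n theta @^-1` a).
    by apply: measurableI => //; exact: (measurable_preimage_iter MM).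
  have [nC|//] := atom mC; exfalso; apply: na; apply: (negligible_mu_nu IS).
  have := negligibleU cov (negligible_image_iter MM n (_ : mu.-negligible (cyl w `&` iter n theta @^-1` a))).
  move=> h; apply: negligibleS (h _) => [x ax|].
    have [[y wy yx]|nx] := pselect ((iter n theta @` cyl w) x); last by left.
    by right; exists y => //; split=> //; rewrite /preimage /= yx.
  move/(negligible_nu IS): nC; apply: negligibleS => x [wx ax]; split=> //.
  by apply: aO; exact: wa.
have [n1 [w1 [n10 ww1 w1a w1g nw1]]] := ex_good 1%g.
pose bad := Omega `\` (cyl w1 `&` iter n1 theta @^-1` a).
have nbad : mu.-negligible bad.
  by move/(negligible_nu IS): nw1; apply: negligibleS => x [Ox nx]; split.
have congr_action n m g h w w' : good n g w -> good m h w' -> (m <= n)%N ->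
    (n = m %[mod n1])%N -> same_action H g h.
  move=> [n0 ww wa wg nw] [m0 ww' wa' wg' nw'] mn nm.
  pose k := ((n - m) %/ n1)%N.
  have nE : n = (m + k * n1)%N.
    by rewrite /k divnK ?subnKC// -eqn_mod_dvd//; apply/eqP.
  pose Bad := ~` (cyl w `&` iter n theta @^-1` a) `|` ~` (cyl w' `&` iter m theta @^-1` a) `|`
    \bigcup_(j in [set: nat]) (iter (m + j * n1) theta @^-1` bad).
  have nBad : nu.-negligible Bad.
    apply: negligibleU; first exact: negligibleU.
    apply: negligible_bigcup => j; apply: (negligible_mu_nu IS).
    exact: (negligible_preimage_iter MM IM).
  have [x nx] : exists x, ~ Bad x.
    apply: contrapT => hyp; apply: na; apply: negligibleS nBad => x _.
    by apply: contrapT => nB; apply: hyp; exists x.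
  have [wx ax] : (cyl w `&` iter n theta @^-1` a) x.
    by apply: contrapT => hyp; apply: nx; left; left.
  have [w'x a'x] : (cyl w' `&` iter m theta @^-1` a) x.
    by apply: contrapT => hyp; apply: nx; left; right.
  have nb j : ~ bad (iter (m + j * n1) theta x).
    by move=> hyp; apply: nx; right; exists j.
  have step j : a (iter (m + j * n1) theta x) /\
      same_action H (cocycle theta gamma (m + j * n1) x) h.
    elim: j => [|j [aj gj]]; first by rewrite mul0n addn0; split=> //; exact: wg'.
    have [w1j a1j] : (cyl w1 `&` iter n1 theta @^-1` a) (iter (m + j * n1) theta x).
      by apply: contrapT => hh; apply: (nb j); split=> //; exact: aO.
    have E : (m + j.+1 * n1 = (m + j * n1) + n1)%N by rewrite mulSn; lia.
    rewrite E; split; first by rewrite addnC iterD.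
    rewrite cocycleD -[h]mulg1; apply: same_actionM => //; exact: w1g.
  have [_ hk] := step k; rewrite -nE in hk.
  by move=> v Vv; rewrite -(hk v Vv) (wg x wx v Vv).
pose rep i := if pselect (exists p : G * nat, (exists w, good p.2 p.1 w) /\ (p.2 %% n1 = i)%N) is left ex
  then (projT1 (cid ex)).1 else 1%g.
exists [fset rtranslate H (rep i) | i in iota 0 n1]%fset => v [g _ <-].
have [n [w gw]] := ex_good g.
apply/imfsetP; exists (n %% n1)%N; first by rewrite /= mem_iota /= ltn_mod.
have VH : right_cosets H H by exists 1%g => //; rewrite /right_coset rtranslate1.
rewrite /right_coset /rep; case: pselect => [ex|]; last by case; exists (g, n); split => //; exists w.
case: (cid ex) => -[h m] /= [[w' hw'] mE].
have [mn|/ltnW nm] := leqP m n; first by apply: (congr_action _ _ _ _ _ _ gw hw' mn) => //.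
by apply/esym; apply: (congr_action _ _ _ _ _ _ hw' gw nm) => //.
Qed.

End Degenerate.

Lemma not_expanding_amenable (R : realType) (d : measure_display) (X : measurableType d)
    (mu : probability X R) (G : groupType) (gamma : X -> G) (H : set G) (gs : seq G) :
  (forall x, gamma x \in gs) ->
  (forall dx : R, 0 < dx -> ~ expanding H gs dx) -> schreier_amenable mu gamma H.
Proof.
move=> ggs nexp; rewrite /schreier_amenable.
suff -> : isoperimetric_constant mu gamma H = fun=> 0 by exact: cvg_cst.
apply/funext => eps; rewrite /isoperimetric_constant.
set S := [set q | _].
have S0 q : S q -> 0 <= q by move=> [K [_ _ _ ->]]; rewrite divr_ge0.
have lbS : has_lbound S by exists 0 => q /S0.
have inf0 : 0 <= inf S.
  have [[q Sq]|nS] := pselect (S !=set0); first by apply: lb_le_inf; [exists q|move=> y /S0].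
  by rewrite (_ : S = set0) ?inf0//; apply/seteqP; split=> // q Sq; apply: nS; exists q.
apply/eqP; rewrite eq_le inf0 andbT leNgt; apply/negP => pos.
apply: (nexp (inf S) pos) => K K0 KV.
have fK : finite_set [set` K] by exact: finite_fset.
have KE : fset_set [set` K] = K by rewrite set_fsetK.
pose q : R := #|` fset_set (edge_boundary mu gamma H eps [set` K])|%:R / #|` K|%:R.
have Sq : S q.
  exists [set` K]; split=> //; last by rewrite KE.
  by have [v vK] := fset0Pn _ K0; exists v.
have cK : 0 < #|` K|%:R :> R by rewrite ltr0n cardfs_gt0.
have := ge_inf lbS Sq; rewrite /q ler_pdivlMr// => /le_trans; apply.
rewrite ler_nat; apply: fsubset_leq_card; apply/fsubsetP => v.
have fB : finite_set (edge_boundary mu gamma H eps [set` K]).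
  by apply: sub_finite_set fK => u [].
rewrite in_fset_set// inE => -[vK [e [[g [h [[x _ xh] ->]]] /= gv nK _]]].
rewrite !inE /=; apply/andP; split; first exact: vK.
apply/hasP; exists h; first by rewrite -xh.
apply/negP => vhK; apply: nK; rewrite /right_coset -rtranslateM.
by move: gv; rewrite /right_coset => ->.
Qed.

Theorem theorem5p1 (R : realType) (d : measure_display) (X : measurableType d)
    (mu : probability X R) (theta : X -> X) (alpha : set (set X))
    (Omega : set X) (beta : set (seq (set X))) (eta : seq (set X) -> nat)
    (G : groupType) (H : set G) (gamma : X -> G) (o : set G) :
  markov_map mu theta alpha ->
  invariant_measure mu theta ->
  adequately_embedded mu theta alpha Omega beta eta ->
  exponential_tails mu theta Omega beta eta ->
  countable [set: G] ->
  subgroup H ->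
  (forall a x y, alpha a -> a x -> a y -> gamma x = gamma y) ->
  finite_set (range gamma) ->
  topologically_transitive mu theta alpha gamma (normal_core H) ->
  right_cosets H o ->
  return_rate mu theta gamma Omega o = 1%E ->
  schreier_amenable mu gamma H.
Proof.
move=> MM IM [r [[F [Ffin Fal OmE]] badm bpart [nu nuE GM]] [[C C0 Cw] dagger]].
move=> tails cG sH gconst gfin tt0 Ho rate.
have IS : induced_system mu nu theta alpha Omega F beta eta r by [].
pose gs : seq G := fset_set (range gamma).
have ggs x : gamma x \in gs by rewrite in_fset_set// inE; exists x.
apply: (not_expanding_amenable mu ggs) => dx dx0 exp.
have [[u [bu u0]]|pos] := pselect (exists u, beta u /\ eta u = 0%N).
  have [K KV] := degenerate_finite IS cG gconst sH tt0 bu u0.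
  pose K' := [fset v in K | `[< right_cosets H v >]]%fset.
  have oK' : o \in K' by rewrite !inE /= KV//; exact/asboolP.
  have K'0 : K' != fset0 by apply/fset0Pn; exists o.
  have := exp K' K'0; rewrite leNgt => /(_ _)/negP; apply.
    by move=> v; rewrite !inE => /andP[_ /asboolP].
  rewrite (_ : [fset v in _ | _]%fset = fset0) ?cardfs0.
    by rewrite mulr_gt0// ltr0n cardfs_gt0.
  apply/eqP; rewrite -fsubset0; apply/fsubsetP => v.
  rewrite !inE /= => /andP[/andP[_ /asboolP Vv] /hasP[h _]].
  have Vh := right_cosets_translate h Vv.
  by rewrite !inE /= KV//; case: asboolP.
have eta_pos u : beta u -> (0 < eta u)%N.
  by move=> bu; rewrite lt0n; apply/eqP => u0; apply: pos; exists u.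
have small := late_small IS dagger.
have decay := expanding_decay IS cG gconst ggs sH eta_pos small tt0 dx0 exp.
have mR n := return_set_measurable o IS cG gconst n.
have := exp_decay_limsup (fun n => (pr_charge mu).1 _ (mR n))
  (return_set_decay IS cG gconst Cw C0 ggs Ho eta_pos tails decay small).
move: rate; rewrite /return_rate.
rewrite (_ : (fun n => mu _) = (fun n => (pr mu (return_set theta Omega gamma o n))%:E)).
  by move=> ->; rewrite ltxx.
by apply/funext => n; rewrite -prE.
Qed.
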